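(* Let $M$ be a complex manifold of complex dimension $n>1$ and let $\mathcal F$ be a complex foliation of $M$ whose leaves have complex dimension $n-1$ (that is, of complex codimension $1$). If every leaf of $\mathcal F$ is parabolic, then $\mathcal F$ is a holomorphic foliation.
   Context: A complex foliation of $M$ is a smooth ($C^\infty$) foliation of $M$ whose leaves are (immersed) complex submanifolds of $M$. A leaf $L$ of complex dimension $d$ is called parabolic if there is a holomorphic covering map $F:\mathbf C^{d}\to L$ (here $d=n-1$). The foliation $\mathcal F$ is called holomorphic if the distribution $\mathcal T\subset T^{(1,0)}M$ of $(1,0)$-vectors tangent to the leaves is a holomorphic sub-bundle of $T^{(1,0)}M$. *)

(* Defs.v *)
From HB Require Import structures.
From mathcomp Require Import all_boot all_order all_algebra.
From mathcomp Require Import all_classical all_reals all_analysis.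
From mathcomp Require Import complex.

Set Implicit Arguments.
Unset Strict Implicit.
Unset Printing Implicit Defensive.

Import Order.TTheory GRing.Theory Num.Theory.
Import numFieldNormedType.Exports.

Local Open Scope classical_set_scope.
Local Open Scope ring_scope.

(* The complex numbers over R. Bundling R[i] this way gives C^n, 'rV[Cplx R]_n,
   the topology and the norm that the library attaches to numClosedFieldType. *)
Definition Cplx (R : realType) : numClosedFieldType := R[i].

(* A homeomorphism from the open set [chart_dom] of T onto an open set of E.
   Both directions are total functions; only their values on [chart_dom] and
   on its image matter. *)
Record chart (T E : topologicalType) := Chart {
  chart_dom : set T ;
  chart_map :> T -> E ;
  chart_inv : E -> T ;
  open_chart_dom : open chart_dom ;
  open_chart_im : open (chart_map @` chart_dom) ;
  chart_mapK : forall x, chart_dom x -> chart_inv (chart_map x) = x ;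
  chart_map_continuous :
    forall x, chart_dom x -> {for x, continuous chart_map} ;
  chart_inv_continuous :
    forall y, (chart_map @` chart_dom) y -> {for y, continuous chart_inv} }.

(* For U open: [differentiable] is Frechet differentiability over C. *)
Definition holomorphic_on (R : realType) (V W : normedModType (Cplx R))
    (U : set V) (f : V -> W) : Prop :=
  forall z, U z -> differentiable f z.

Record complex_manifold (R : realType) (n : nat) := ComplexManifold {
  carrier :> topologicalType ;
  manifold_hausdorff : hausdorff_space carrier ;
  manifold_second_countable : @second_countable carrier ;
  atlas : set (chart carrier 'rV[Cplx R]_n) ;
  atlas_cover : forall p, exists2 c, atlas c & chart_dom c p ;
  atlas_holomorphic : forall c c', atlas c -> atlas c' ->
    holomorphic_on (c @` (chart_dom c `&` chart_dom c'))
                   (c' \o chart_inv c) }.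

Section HolomorphicMaps.
Variable R : realType.

Definition holomorphic_at (m k : nat) (N : complex_manifold R k)
    (f : 'rV[Cplx R]_m -> N) (z : 'rV[Cplx R]_m) : Prop :=
  {for z, continuous f} /\
  forall c, atlas c -> chart_dom c (f z) -> differentiable (c \o f) z.

Definition holomorphic_map (m k : nat) (M : complex_manifold R m)
    (N : complex_manifold R k) (f : M -> N) : Prop :=
  forall c p, atlas c -> chart_dom c p ->
    holomorphic_at (f \o chart_inv c) (c p).

Definition holomorphic_immersion (m k : nat) (M : complex_manifold R m)
    (N : complex_manifold R k) (f : M -> N) : Prop :=
  holomorphic_map f /\
  forall c c' p, atlas c -> chart_dom c p -> atlas c' -> chart_dom c' (f p) ->
    injective ('d (c' \o f \o chart_inv c) (c p)).

End HolomorphicMaps.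

Definition covering_map (X Y : topologicalType) (f : X -> Y) : Prop :=
  [/\ continuous f, range f = setT &
      forall y, exists V : set Y, [/\ open V, V y &
        exists sheets : set (set X),
        [/\ forall S, sheets S -> open S,
            trivIset sheets id,
            \bigcup_(S in sheets) S = f @^-1` V &
            forall S, sheets S -> f @` S = V /\
              exists g : Y -> X,
                (forall x, S x -> g (f x) = x) /\
                (forall v, V v -> {for v, continuous g})]]].

Definition parabolic (R : realType) (d : nat) (L : complex_manifold R d)
    : Prop :=
  exists F : 'rV[Cplx R]_d -> L, (forall z, holomorphic_at F z) /\ covering_map F.

Section Smoothness.
Variables (R : realType) (V W : normedModType R).

(* For U open and V finite dimensional, this is the usual class C^k on U. *)
Fixpoint Ck_on (k : nat) (U : set V) (f : V -> W) : Prop :=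
  match k with
  | 0 => forall x, U x -> {for x, continuous f}
  | k'.+1 => (forall x, U x -> differentiable f x) /\
             (forall v, Ck_on k' U (fun x => 'D_v f x))
  end.

Definition smooth_on (U : set V) (f : V -> W) : Prop := forall k, Ck_on k U f.

End Smoothness.

(* The identification of C^n with R^(2n), z = x + i y |-> (x, y). *)
Definition realify (R : realType) (n : nat) (z : 'rV[Cplx R]_n)
    : 'rV[R]_(n + n) :=
  row_mx (map_mx (@complex.Re R) z) (map_mx (@complex.Im R) z).

Definition complexify (R : realType) (n : nat) (x : 'rV[R]_(n + n))
    : 'rV[Cplx R]_n :=
  \row_j Complex (lsubmx x 0 j) (rsubmx x 0 j).

Section Foliations.
Variables (R : realType) (n : nat) (M : complex_manifold R n).

Definition smooth_chart (E : normedModType R) (h : chart M E) : Prop :=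
  forall c, atlas c ->
    smooth_on ((@realify R n \o c) @` (chart_dom c `&` chart_dom h))
              (h \o chart_inv c \o @complexify R n) /\
    smooth_on (h @` (chart_dom c `&` chart_dom h))
              (@realify R n \o c \o chart_inv h).

(* A foliation is given by its leaves: a partition of M into connected,
   injectively immersed submanifolds (here complex ones, each with its own
   leaf topology), such that M is covered by smooth flat charts. A flat chart
   has as image a cube of R^(2d) x R^(2(n-d)) (the balls of these spaces are
   cubes, their norms being maximum norms), and each leaf meets its domain in
   a countable union of slices R^(2d) x {s}. *)
Record complex_foliation (d : nat) := ComplexFoliation {
  leaf_index : Type ;
  leaf : leaf_index -> complex_manifold R d ;
  leaf_incl : forall i, leaf i -> M ;
  leaf_nonempty : forall i, [set: leaf i] !=set0 ;
  leaf_connected : forall i, connected [set: leaf i] ;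
  leaf_immersion : forall i, holomorphic_immersion (@leaf_incl i) ;
  leaf_incl_inj : forall i, injective (@leaf_incl i) ;
  leaf_disjoint : forall i j (x : leaf i) (y : leaf j),
    leaf_incl x = leaf_incl y -> i = j ;
  leaf_cover : forall p : M, exists i, exists x : leaf i, leaf_incl x = p ;
  flat_charts : forall p : M,
    exists h : chart M ('rV[R]_(d.*2) * 'rV[R]_((n - d).*2))%type,
    [/\ chart_dom h p, smooth_chart h,
        exists a (r : R), 0 < r /\ h @` chart_dom h = ball a r &
        forall i, exists2 S : set 'rV[R]_((n - d).*2), countable S &
          forall q, chart_dom h q -> (range (@leaf_incl i) q <-> S (h q).2)] }.

End Foliations.

Arguments leaf_index {R n M d} F : rename.
Arguments leaf {R n M d} F i : rename.
Arguments leaf_incl {R n M d F} i x : rename.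

Section HolomorphicFoliations.
Variables (R : realType) (n : nat) (M : complex_manifold R n).

(* A family of sets of (1,0)-vectors of M: [D c p] consists of the components
   (v_1, ..., v_n), with respect to the frame d/dz_1, ..., d/dz_n of T^(1,0)M
   given by the chart c, of the vectors at p. *)
Definition distribution10 := chart M 'rV[Cplx R]_n -> M -> set 'rV[Cplx R]_n.

(* The (1,0)-vectors tangent to the leaves: those of T^(1,0)L, for L a leaf. *)
Definition tangent10 (d : nat) (F : complex_foliation M d) : distribution10 :=
  fun c p => [set v | exists i (x : leaf F i) b w,
    [/\ leaf_incl i x = p, atlas b, chart_dom b x &
        v = 'd (c \o leaf_incl i \o chart_inv b) (b x) w]].

(* Rank d, with a local holomorphic frame (the rows of A) around each point. *)
Definition holomorphic_subbundle (d : nat) (D : distribution10) : Prop :=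
  forall p : M, exists (c : chart M 'rV[Cplx R]_n) (V : set M)
                       (A : 'rV[Cplx R]_n -> 'M[Cplx R]_(d, n)),
    [/\ atlas c, open V /\ V p, V `<=` chart_dom c,
        holomorphic_on (c @` V) A &
        forall q, V q -> row_free (A (c q)) /\
          D c q = [set v | (v <= A (c q))%MS]].

Definition holomorphic_foliation (d : nat) (F : complex_foliation M d) : Prop :=
  holomorphic_subbundle d (tangent10 F).

End HolomorphicFoliations.

(* Main.v *)
Require Import Defs.
From HB Require Import structures.
From mathcomp Require Import all_boot all_order all_algebra.
From mathcomp Require Import all_classical all_reals all_analysis.
From mathcomp Require Import complex ring lra.

(** In a flat chart, the differentials of the two real transverse coordinates are
    the real parts of covectors omega_0, omega_1 of type (1,0), both vanishing
    exactly on the leaf directions; hence omega_1 = tau omega_0 with tau nonreal.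
    By symmetry of the second derivatives, the conjugate of tau is holomorphic
    along the leaves.  Another flat chart changes (omega_0, omega_1) by a real
    matrix which is constant along the leaf, hence tau by a real Moebius
    transformation.  Pulled back to a complex line of the covering C^(n-1) of a
    leaf, these local functions glue by monodromy to an entire function without
    real values, which is constant by Liouville's theorem.  So tau is constant
    along the leaves, and then the second derivatives also show that omega_0,
    normalized to have one coefficient equal to 1, is holomorphic in all
    directions: its kernel is the tangent distribution. *)

Set Implicit Arguments.
Unset Strict Implicit.
Unset Printing Implicit Defensive.

Import Order.TTheory GRing.Theory Num.Theory.
Import numFieldNormedType.Exports.

Local Open Scope classical_set_scope.
Local Open Scope ring_scope.

Local Notation Re := (@complex.Re _).
Local Notation Im := (@complex.Im _).

(** * Real and complex differentials *)

(** In a flat chart the normal space of a leaf is R^2, and tau is the complex structure that M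
    induces on it, known only up to the choice of the chart. Conjugated, it gives each leaf a
    multivalued holomorphic function without real values, defined up to real Moebius maps; on lines
    in C^(n-1) there is room only for constants. This is the one place where parabolicity enters.

    Multivaluedness is the obstacle. Values of tau cannot be continued directly, for a real Moebius
    map may fix a nonreal value without being the identity. What is continued is the pair (omega_0,
    omega_1), as a matrix up to a constant invertible real left factor. Its rows are independent
    over R, although dependent over C, so the factor is determined by the matrix at a single point:
    this is the unique continuation that monodromy requires. Restricting to complex lines makes
    Liouville's theorem in one variable sufficient, and monodromy is needed over the plane only. *)

Lemma near_continuous (T U : topologicalType) (f : T -> U) (t : T) (P : U -> Prop) :
  {for t, continuous f} -> (\forall u \near f t, P u) -> \forall s \near t, P (f s).
Proof. by move=> cf N; exact: (cf P N). Qed.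

Section Differentials.
Variable K : numFieldType.

Lemma is_diff_eps (V W : normedModType K) (f : V -> W) (x : V)
    (L : {linear V -> W}) : continuous L ->
  (forall e : K, 0 < e -> \forall h \near (0 : V),
    `|f (h + x) - f x - L h| <= e * `|h|) ->
  is_diff x f L.
Proof.
move=> cL H.
have E : f \o shift x = cst (f x) + L +o_0 id.
  apply/eqaddoP => e e0; near=> h.
  rewrite [leLHS](_ : _ = `|f (h + x) - f x - L h|); first by near: h; exact: H.
  by rewrite -[in RHS]addrA -opprD.
have D := diff_unique cL E.
split => //; apply/diff_locallyP; split; first by rewrite D.
by rewrite D.
Unshelve. all: by end_near. Qed.

Lemma diff_eps (V W : normedModType K) (f : V -> W) (x : V) :
  differentiable f x -> forall e : K, 0 < e -> \forall h \near (0 : V),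
    `|f (h + x) - f x - 'd f x h| <= e * `|h|.
Proof.
move=> /diff_locally /eqaddoP H e /H; apply: filterS => h.
by rewrite -[_ - _ - _]addrA -opprD.
Qed.

Lemma linear_rV_continuous m (W : normedModType K)
    (L : {linear 'rV[K]_m -> W}) : continuous L.
Proof.
have -> : (L : 'rV[K]_m -> W) =
    (fun x : 'rV[K]_m => \sum_(i < m) x 0 i *: L (delta_mx 0 i)).
  apply/funext => x; rewrite [in LHS](row_sum_delta x) linear_sum.
  by apply: eq_bigr => i _; rewrite linearZ.
apply: (@continuous_big _ _ +%R 0 xpredT add_continuous) => i _ x.
by apply: cvgZr_tmp; [exact: nbhs_filter|exact: (@coord_continuous K 1 m 0 i x)].
Qed.

Lemma differentiable_rV (V : normedModType K) m k (f : V -> 'M[K]_(m, k)) x :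
  (forall i j, differentiable (fun y => f y i j) x) -> differentiable f x.
Proof.
move=> H.
have -> : f = \sum_(p < m) \sum_(q < k) (fun y => f y p q *: delta_mx p q).
  apply/funext => y; rewrite [LHS]matrix_sum_delta fct_sumE.
  by apply: eq_bigr => p _; rewrite fct_sumE.
apply: differentiable_sum => p; apply: differentiable_sum => q.
exact: differentiableZl.
Qed.

End Differentials.

Section Realification.
Variable R : realType.
Local Notation C := (Cplx R).

Lemma cnormE (z : C) : `|z| = (Num.sqrt ((Re z)^+2 + (Im z)^+2))%:C%C.
Proof. exact: normc_def. Qed.

(* The norms on [C] and ['rV[C]_n] take their values in [C]; [cabs] and [vabs]
   are their real-valued versions. *)
Definition cabs (z : C) : R := Re `|z|.

Lemma cabsE (z : C) : `|z| = (cabs z)%:C%C.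
Proof. by rewrite /cabs cnormE. Qed.

Lemma cabs_ge_Re (z : C) : `|Re z| <= cabs z.
Proof. by rewrite -lecR -cabsE; exact: normc_ge_Re. Qed.

Lemma cabs_ge_Im (z : C) : `|Im z| <= cabs z.
Proof.
rewrite /cabs cnormE /= -sqrtr_sqr ler_sqrt ?lerDr ?sqr_ge0 //.
by rewrite addr_ge0 ?sqr_ge0.
Qed.

Lemma cabs_le (z : C) : cabs z <= `|Re z| + `|Im z|.
Proof.
rewrite /cabs cnormE /= -[leRHS]ger0_norm ?addr_ge0 // -sqrtr_sqr.
rewrite ler_sqrt ?sqr_ge0 // sqrrD !real_normK ?num_real //.
by rewrite -addrA lerD2l lerDr mulrn_wge0 // mulr_ge0.
Qed.

Lemma realifyK n : cancel (@realify R n) (@complexify R n).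
Proof.
move=> z; apply/rowP => j; rewrite mxE row_mxKl row_mxKr !mxE.
by case: (z 0 j).
Qed.

Lemma complexifyK n : cancel (@complexify R n) (@realify R n).
Proof.
move=> x; rewrite -[RHS]hsubmxK /realify.
by congr row_mx; apply/rowP => j; rewrite !mxE.
Qed.

Lemma realifyD n : {morph @realify R n : u v / u + v}.
Proof.
move=> u v; rewrite /realify add_row_mx.
by congr row_mx; apply/rowP => j; rewrite !mxE; case: (u 0 j); case: (v 0 j).
Qed.

Lemma realifyN n : {morph @realify R n : u / - u}.
Proof.
move=> u; rewrite /realify opp_row_mx.
by congr row_mx; apply/rowP => j; rewrite !mxE; case: (u 0 j).
Qed.

Lemma realifyB n : {morph @realify R n : u v / u - v}.
Proof. by move=> u v; rewrite realifyD realifyN. Qed.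

Lemma realifyZ n (a : R) (u : 'rV[C]_n) :
  realify ((a%:C%C : C) *: u) = a *: realify u.
Proof.
rewrite /realify scale_row_mx.
congr row_mx; apply/rowP => j; rewrite !mxE; case: (u 0 j) => x y /=; ring.
Qed.

Lemma realify0 n : realify (0 : 'rV[C]_n) = 0.
Proof. by rewrite -(subrr 0) realifyB subrr. Qed.

Lemma complexifyD n : {morph @complexify R n : u v / u + v}.
Proof.
by move=> u v; apply: (can_inj (@realifyK n)); rewrite realifyD !complexifyK.
Qed.

Lemma complexifyB n : {morph @complexify R n : u v / u - v}.
Proof.
by move=> u v; apply: (can_inj (@realifyK n)); rewrite realifyB !complexifyK.
Qed.

Lemma complexifyZ n (a : R) (x : 'rV[R]_(n + n)) :
  complexify (a *: x) = (a%:C%C : C) *: complexify x.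
Proof.
by apply: (can_inj (@realifyK n)); rewrite realifyZ !complexifyK.
Qed.

Lemma complexify0 n : complexify (0 : 'rV[R]_(n + n)) = 0.
Proof. by rewrite -(subrr 0) complexifyB subrr. Qed.

Lemma mx_norm_ge_coord (K : numFieldType) m n (A : 'M[K]_(m, n)) i j :
  `|A i j| <= `|A|.
Proof.
rewrite [leRHS]/Num.norm /= mx_normE [leLHS](_ : _ = `|A i j|%:nng%:num) //.
by rewrite num_le; exact: (le_bigmax _ (fun p => `|A p.1 p.2|%:nng) (i, j)).
Qed.

Lemma mx_norm_le (K : numFieldType) m n (A : 'M[K]_(m, n)) (e : K) :
  0 <= e -> (forall i j, `|A i j| <= e) -> `|A| <= e.
Proof.
move=> e0 H; rewrite /Num.norm /=.
have [->//|/mx_norm_neq0[[i j] ->]] := eqVneq (mx_norm A) 0.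
exact: H.
Qed.

Definition vabs n (z : 'rV[C]_n) : R := Re `|z|.

Lemma vabsE n (z : 'rV[C]_n) : `|z| = (vabs z)%:C%C.
Proof. by apply/esym/RRe_real; exact: normr_real. Qed.

Lemma vabs_ge0 n (z : 'rV[C]_n) : 0 <= vabs z.
Proof. by rewrite -ler0c -vabsE. Qed.

Lemma realify_le n (z : 'rV[C]_n) : `|realify z| <= vabs z.
Proof.
apply: mx_norm_le => [|i j]; first exact: vabs_ge0.
have H k : cabs (z 0 k) <= vabs z.
  by rewrite -lecR -cabsE -vabsE; exact: mx_norm_ge_coord.
rewrite (ord1 i) mxE; case: splitP => k _; rewrite mxE; apply: le_trans (H k).
  exact: cabs_ge_Re.
exact: cabs_ge_Im.
Qed.

(** The factor 2 comes from |z| <= |Re z| + |Im z|; [realify_is_diff] absorbs it by working with e /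
    2. *)
Lemma realify_ge n (z : 'rV[C]_n) : vabs z <= 2 * `|realify z|.
Proof.
rewrite -lecR -vabsE; apply: mx_norm_le => [|i j].
  by rewrite ler0c mulr_ge0.
rewrite cabsE lecR (ord1 i); apply: le_trans (cabs_le _) _.
rewrite [leRHS]mulr_natl mulr2n lerD //.
  have := mx_norm_ge_coord (realify z) 0 (lshift n j).
  by rewrite row_mxEl mxE.
have := mx_norm_ge_coord (realify z) 0 (rshift n j).
by rewrite row_mxEr mxE.
Qed.

Lemma realify_continuous n : continuous (@realify R n).
Proof.
move=> z A /nbhs_ballP[e /= e0 eA].
have e0' : 0 < e%:C%C :> C by rewrite ltcR.
change (nbhs z (@realify R n @^-1` A)).
apply/(nbhs_ballP z); exists (e%:C%C) => //= y.
rewrite -ball_normE /= => H; apply: eA; rewrite -ball_normE /=.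
by rewrite -realifyB (le_lt_trans (realify_le _)) // -ltcR -vabsE.
Qed.

Lemma complexify_continuous n : continuous (@complexify R n).
Proof.
move=> x A /nbhs_ballP[e /= e0 eA].
have eE : e = (Re e)%:C%C by apply/esym/RRe_real/gtr0_real.
have e0' : 0 < Re e by rewrite -ltcR -eE.
have e20 : 0 < Re e / 2 by rewrite divr_gt0.
change (nbhs x (@complexify R n @^-1` A)).
apply/(nbhs_ballP x); exists (Re e / 2) => //= y.
rewrite -ball_normE /= => H; apply: eA; rewrite -ball_normE /=.
rewrite -complexifyB vabsE [X in _ < X]eE ltcR (le_lt_trans (realify_ge _)) //.
by rewrite complexifyK -ltr_pdivlMl // mulrC.
Qed.

Lemma near_complexify n (x : 'rV[R]_(n + n)) (P : 'rV[C]_n -> Prop) :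
  (\forall z \near complexify x, P z) -> \forall y \near x, P (complexify y).
Proof. by move=> H; apply: (@complexify_continuous n x). Qed.

Lemma near_realify n (z : 'rV[C]_n) (P : 'rV[R]_(n + n) -> Prop) :
  (\forall y \near realify z, P y) -> \forall x \near z, P (realify x).
Proof. by move=> H; apply: (@realify_continuous n z). Qed.

Section RealPart.
Variables (m n : nat) (L : {linear 'rV[C]_m -> 'rV[C]_n}).

Definition real_linear (x : 'rV[R]_(m + m)) : 'rV[R]_(n + n) :=
  realify (L (complexify x)).

Lemma real_linear_is_linear : linear real_linear.
Proof.
move=> a x y.
by rewrite /real_linear complexifyD complexifyZ linearD linearZ realifyD realifyZ.
Qed.

HB.instance Definition _ := GRing.isLinear.Build R _ _ _ real_linear
  real_linear_is_linear.

End RealPart.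

Lemma realify_is_diff m n (G : 'rV[C]_m -> 'rV[C]_n) z : differentiable G z ->
  is_diff (realify z) (@realify R n \o G \o @complexify R m)
    (real_linear ('d G z)).
Proof.
move=> dG; apply: is_diff_eps; first exact: linear_rV_continuous.
move=> e e0; have e2 : 0 < (e / 2)%:C%C :> C by rewrite ltcR divr_gt0.
have := diff_eps dG e2; rewrite -(complexify0 m) => /near_complexify; apply: filterS => h /=.
rewrite complexifyD realifyK -!realifyB => H.
apply: le_trans (realify_le _) _.
rewrite -lecR -vabsE; apply: le_trans H _.
rewrite vabsE -rmorphM lecR.
have := realify_ge (complexify h); rewrite complexifyK => H2.
apply: le_trans (ler_wpM2l _ H2) _; first by rewrite ltW ?divr_gt0.
by rewrite mulrA divfK.
Qed.

Local Notation iC := (Complex 0 1 : C).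

Lemma complex_scale n (c : C) (u : 'rV[C]_n) :
  c *: u = ((Re c)%:C%C : C) *: u + ((Im c)%:C%C : C) *: (iC *: u).
Proof.
rewrite scalerA -scalerDl; congr (_ *: _); case: c => x y /=.
apply/eqP; rewrite eq_complex /=; apply/andP; split; apply/eqP; ring.
Qed.

Section CauchyRiemann.
Variables (m : nat) (a b : {linear 'rV[R]_(m + m) -> R}).
Hypothesis abi : forall u : 'rV[C]_m, a (realify (iC *: u)) = - b (realify u).
Hypothesis bai : forall u : 'rV[C]_m, b (realify (iC *: u)) = a (realify u).

Definition complex_linear (u : 'rV[C]_m) : C := Complex (a (realify u)) (b (realify u)).

Lemma complex_linear_is_linear : linear complex_linear.
Proof.
move=> c u v; rewrite /complex_linear complex_scale !realifyD !realifyZ.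
rewrite !linearD !linearZ /= abi bai; case: c => x y.
apply/eqP; rewrite eq_complex /=; apply/andP; split; apply/eqP; rewrite /GRing.scale /=; ring.
Qed.

HB.instance Definition _ := GRing.isLinear.Build C _ _ _ complex_linear
  complex_linear_is_linear.

(** The hypotheses on [a] and [b] are the Cauchy-Riemann equations, written as commutation of a + i
    b with multiplication by i. The remainders of the two parts add up, so each gets half of [e]. *)
Lemma is_diff_CR (f : 'rV[C]_m -> C) (z : 'rV[C]_m) :
  is_diff (realify z) (fun x => Re (f (complexify x))) a ->
  is_diff (realify z) (fun x => Im (f (complexify x))) b ->
  is_diff z f complex_linear.
Proof.
move=> [da Ea] [db Eb]; apply: is_diff_eps; first exact: linear_rV_continuous.
move=> e e0.
have eE : e = (Re e)%:C%C by apply/esym/RRe_real/gtr0_real.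
have e0' : 0 < Re e by rewrite -ltcR -eE.
have e20 : 0 < Re e / 2 by rewrite divr_gt0.
have := diff_eps da e20; have := diff_eps db e20.
rewrite -(realify0 m) => /near_realify Hb /near_realify Ha.
apply: filterS2 Ha Hb => h /=.
rewrite Ea Eb complexifyD !realifyK => Ha Hb.
have {}Ha : `|Re (f (h + z) - f z - complex_linear h)| <= Re e / 2 * vabs h.
  apply: le_trans (ler_wpM2l (ltW e20) (realify_le h)).
  move: Ha; rewrite /complex_linear; by case: (f (h + z)); case: (f z).
have {}Hb : `|Im (f (h + z) - f z - complex_linear h)| <= Re e / 2 * vabs h.
  apply: le_trans (ler_wpM2l (ltW e20) (realify_le h)).
  move: Hb; rewrite /complex_linear; by case: (f (h + z)); case: (f z).
rewrite cabsE vabsE [X in _ <= X * _]eE -rmorphM lecR.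
apply: le_trans (cabs_le _) _; apply: le_trans (lerD Ha Hb) _.
by rewrite -mulrDl -splitr.
Qed.

End CauchyRiemann.

End Realification.

(** * Goursat's and Liouville's theorems *)

Section Quadrisection.
Variable R : realType.

(** Induction over rectangles of fixed shape w x h, scaled by r: a failure would persist in one
    quarter at each step, and the nested rectangles shrink to a point where [P] holds locally. It
    serves Goursat's theorem as well as uniqueness and existence of flat sections; [w] and [h] may
    vanish, so that segments are included. *)
Lemma quadrisection (w h : R) (P : R -> R -> R -> Prop) : 0 <= w -> 0 <= h ->
  (forall x y, exists2 d, 0 < d & forall a b r, 0 < r -> r < d ->
     a <= x <= a + r * w -> b <= y <= b + r * h -> P a b r) ->
  (forall a b r, 0 < r -> P a b (r / 2) -> P (a + r / 2 * w) b (r / 2) ->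
     P a (b + r / 2 * h) (r / 2) -> P (a + r / 2 * w) (b + r / 2 * h) (r / 2) ->
     P a b r) ->
  forall a b r, 0 < r -> P a b r.
Proof.
move=> w0 h0 loc merge a0 b0 r0 r00; apply: contrapT => NP0.
pose T := {t : R * R * R | 0 < t.2 /\ ~ P t.1.1 t.1.2 t.2}.
pose S (s t : T) := [/\ (sval t).2 = (sval s).2 / 2,
  (sval s).1.1 <= (sval t).1.1 <= (sval s).1.1 + (sval t).2 * w &
  (sval s).1.2 <= (sval t).1.2 <= (sval s).1.2 + (sval t).2 * h].
have step (s : T) : {t : T | S s t}.
  apply: cid; case: s => -[[a b] r] /= [rp NP].
  have r2 : 0 < r / 2 by rewrite divr_gt0.
  have rw : 0 <= r / 2 * w by rewrite mulr_ge0 // ltW.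
  have rh : 0 <= r / 2 * h by rewrite mulr_ge0 // ltW.
  have mk a' b' (N : ~ P a' b' (r / 2)) : T by exists (a', b', r / 2).
  have [N1|/contrapT P1] := pselect (~ P a b (r / 2)).
    by exists (exist _ (a, b, r / 2) (conj r2 N1)); split => //=; rewrite lexx lerDl.
  have [N2|/contrapT P2] := pselect (~ P (a + r / 2 * w) b (r / 2)).
    exists (exist _ (a + r / 2 * w, b, r / 2) (conj r2 N2)).
    by split => //=; rewrite !lexx lerDl ?andbT.
  have [N3|/contrapT P3] := pselect (~ P a (b + r / 2 * h) (r / 2)).
    exists (exist _ (a, b + r / 2 * h, r / 2) (conj r2 N3)).
    by split => //=; rewrite !lexx lerDl ?andbT.
  have [N4|/contrapT P4] := pselect (~ P (a + r / 2 * w) (b + r / 2 * h) (r / 2)).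
    exists (exist _ (a + r / 2 * w, b + r / 2 * h, r / 2) (conj r2 N4)).
    by split => //=; rewrite !lexx lerDl ?andbT.
  by case: NP; exact: merge.
have [f [f0 fS]] := dependent_choice step (exist _ (a0, b0, r0) (conj r00 NP0) : T).
pose a n := (sval (f n)).1.1; pose b n := (sval (f n)).1.2; pose r n := (sval (f n)).2.
have rp n : 0 < r n by rewrite /r; case: (f n) => ? [].
have NP n : ~ P (a n) (b n) (r n) by rewrite /a /b /r; case: (f n) => ? [].
have rS n : r n.+1 = r n / 2 by case: (fS n).
have aS n : a n <= a n.+1 /\ a n.+1 + r n.+1 * w <= a n + r n * w.
  case: (fS n); rewrite -/(a n) -/(a n.+1) -/(r n) -/(r n.+1) => E /andP[H1 H2] _.
  split => //; rewrite [in leRHS](_ : r n = r n.+1 + r n.+1); last by rewrite E -splitr.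
  lra.
have bS n : b n <= b n.+1 /\ b n.+1 + r n.+1 * h <= b n + r n * h.
  case: (fS n); rewrite -/(b n) -/(b n.+1) -/(r n) -/(r n.+1) => E _ /andP[H1 H2].
  split => //; rewrite [in leRHS](_ : r n = r n.+1 + r n.+1); last by rewrite E -splitr.
  lra.
(* The supremum of the lower ends lies in all the nested intervals. *)
have nested (u : nat -> R) (k : R) : 0 <= k ->
    (forall n, u n <= u n.+1 /\ u n.+1 + r n.+1 * k <= u n + r n * k) ->
    exists x, forall n, u n <= x <= u n + r n * k.
  move=> k0 uS.
  have up n m : u n <= u (n + m)%N /\ u (n + m)%N + r (n + m)%N * k <= u n + r n * k.
    elim: m => [|m [IH1 IH2]]; first by rewrite addn0.
    by rewrite addnS; have [H1 H2] := uS (n + m)%N; split; lra.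
  have bd n m : u m <= u n + r n * k.
    have [H1 _] := up m n; have [_ H2] := up n m.
    have := mulr_ge0 (ltW (rp (n + m)%N)) k0; rewrite addnC in H1; lra.
  exists (sup (range u)) => n; apply/andP; split.
    by apply: ub_le_sup; [exists (u n + r n * k) => _ [m _ <-]; exact: bd | exists n].
  apply: ge_sup; first by exists (u 0), 0%N.
  by move=> _ [m _ <-]; exact: bd.
have [x xP] := nested a w w0 aS.
have [y yP] := nested b h h0 bS.
have [d d0 dP] := loc x y.
have rE n : r n = r 0%N / 2 ^+ n.
  elim: n => [|n IH]; first by rewrite expr0 divr1.
  by rewrite rS IH exprS invfM mulrA mulrAC.
have [n nd] : exists n, r n < d.
  have [n hn] : exists n : nat, r 0%N / d < 2 ^+ n.
    exists (Num.Def.archi_bound (r 0%N / d)).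
    apply: lt_trans (archi_boundP _) _; first by rewrite divr_ge0 // ltW.
    rewrite -natrX ltr_nat; exact: ltn_expl.
  exists n; rewrite rE ltr_pdivrMr ?exprn_gt0 // mulrC -ltr_pdivrMr //.
by apply: (NP n); exact: dP.
Qed.

End Quadrisection.

Section Goursat.
Variable R : realType.
Local Notation mu := (@lebesgue_measure R).

(* A primitive of [g] on the half-line [x > s] only. *)
Definition primitive (s : R) (g : R -> R) (x : R) : R := (\int[mu]_(t in `[s, x]) g t)%R.

Lemma is_derive_primitive (s : R) (g : R -> R) (x : R) : continuous g -> s < x ->
  is_derive x 1 (primitive s g) (g x).
Proof.
move=> cg sx.
have ig : mu.-integrable `[s, x + 1] (EFin \o g).
  apply: continuous_compact_integrable; first exact: segment_compact.
  exact: continuous_subspaceT.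
have xx1 : x < x + 1 by rewrite ltrDl ltr01.
have [d e] := @continuous_FTC1_closed R g s x (x + 1) xx1 ig sx (cg x).
by apply: DeriveDef => //; rewrite -e derive1E.
Qed.

(** The correction term is the exact integral of k + m t, so the difference [G] has derivative at
    most [e] in absolute value and the mean value theorem applies. *)
Lemma primitive_bound (s : R) (g : R -> R) (a b k m e : R) : continuous g -> s < a -> a <= b ->
  (forall t, a <= t <= b -> `|g t - (k + m * t)| <= e) ->
  `|primitive s g b - primitive s g a - (k * (b - a) + m * (b ^+ 2 - a ^+ 2) / 2)|
    <= e * (b - a).
Proof.
move=> cg sa ab H.
pose G t := primitive s g t - (k * t + m / 2 * t ^+ 2).
have dG t : a <= t -> is_derive t 1 G (g t - (k + m * t)).
  move=> at_; have := is_derive_primitive cg (lt_le_trans sa at_) => ?.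
  by apply: is_derive_eq; rewrite /GRing.scale /=; field.
have cG : {within `[a, b], continuous G}.
  apply: derivable_within_continuous => z; rewrite in_itv /= => /andP[/dG D _].
  exact: ex_derive.
have [|c cab E] := @MVT_segment R G (fun t => g t - (k + m * t)) a b ab _ cG.
  by move=> t; rewrite in_itv /= => /andP[/ltW /dG].
rewrite (_ : _ - _ - _ = G b - G a); last by rewrite /G; field.
rewrite E normrM (ger0_norm (_ : 0 <= b - a)) ?subr_ge0 //.
by apply: ler_wpM2r; [rewrite subr_ge0|apply: H; rewrite in_itv /= in cab].
Qed.

(** Real differentiability of [p] at (x, y), with partial derivatives [p1] and [p2]. *)
Definition affine_near (p : R -> R -> R) (x y p1 p2 : R) :=
  forall e, 0 < e -> exists2 d, 0 < d & forall x' y', `|x' - x| < d -> `|y' - y| < d ->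
    `|p x' y' - (p x y + p1 * (x' - x) + p2 * (y' - y))| <= e * (`|x' - x| + `|y' - y|).

Lemma affine_near_continuous p x y p1 p2 : affine_near p x y p1 p2 ->
  {for x, continuous (p^~ y)} /\ {for y, continuous (p x)}.
Proof.
move=> H; have [d d0 dP] := H 1 ltr01.
have K1 : 0 < 1 + `|p1| by rewrite ltr_pwDl.
have K2 : 0 < 1 + `|p2| by rewrite ltr_pwDl.
split; apply/cvgrPdist_lt => e e0.
  apply/nbhs_ballP; exists (Num.min d (e / (1 + `|p1|))) => /=.
    by rewrite lt_min d0 divr_gt0.
  move=> z; rewrite /ball /= lt_min distrC => /andP[zd ze].
  have := dP z y zd; rewrite subrr normr0 mulr0 !addr0 mul1r => /(_ d0) Hz.
  rewrite distrC; apply: le_lt_trans (_ : (1 + `|p1|) * `|z - x| < e).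
    rewrite mulrDl mul1r -normrM.
    rewrite (_ : p z y - p x y = p z y - (p x y + p1 * (z - x)) + p1 * (z - x)); last by ring.
    by apply: le_trans (ler_normD _ _) _; rewrite lerD2r.
  by rewrite mulrC -ltr_pdivlMr.
apply/nbhs_ballP; exists (Num.min d (e / (1 + `|p2|))) => /=.
  by rewrite lt_min d0 divr_gt0.
move=> z; rewrite /ball /= lt_min distrC => /andP[zd ze].
have := dP x z; rewrite subrr normr0 mulr0 addr0 add0r mul1r => /(_ d0 zd) Hz.
rewrite distrC; apply: le_lt_trans (_ : (1 + `|p2|) * `|z - y| < e).
  rewrite mulrDl mul1r -normrM.
  rewrite (_ : p x z - p x y = p x z - (p x y + p2 * (z - y)) + p2 * (z - y)); last by ring.
  by apply: le_trans (ler_normD _ _) _; rewrite lerD2r.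
by rewrite mulrC -ltr_pdivlMr.
Qed.

Section ClosedForm.
Variables p q : R -> R -> R.
Hypothesis closed_form : forall x y, exists p1 p2 q2,
  affine_near p x y p1 p2 /\ affine_near q x y p2 q2.

Let cp y : continuous (p^~ y).
Proof. by move=> x; have [? [? [? [/affine_near_continuous[]]]]] := closed_form x y. Qed.

Let cq x : continuous (q x).
Proof. by move=> y; have [? [? [? [_ /affine_near_continuous[]]]]] := closed_form x y. Qed.

Section Rectangle.
Variables s t : R.

(** The integral of p dx + q dy counterclockwise around [a, a'] x [b, b']. In [closed_form] the
    shared coefficient [p2] expresses dp/dy = dq/dx, pointwise and without continuity of the
    derivatives, as in Goursat's setting. *)
Definition boundary_integral a b a' b' :=
  (primitive s (p^~ b) a' - primitive s (p^~ b) a) +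
  (primitive t (q a') b' - primitive t (q a') b) -
  (primitive s (p^~ b') a' - primitive s (p^~ b') a) -
  (primitive t (q a) b' - primitive t (q a) b).

(** The affine parts of [p] and [q] contribute nothing because their cross coefficients agree. What
    remains is at most (e / 2) D on sides of total length 2 D, where D is half the perimeter. *)
Lemma boundary_integral_near x y e : 0 < e -> exists2 d, 0 < d &
  forall a b a' b', s < a -> t < b -> a' - a < d -> b' - b < d ->
    a <= x <= a' -> b <= y <= b' ->
    `|boundary_integral a b a' b'| <= e * ((a' - a) + (b' - b)) ^+ 2.
Proof.
move=> e0; have [p1 [p2 [q2 [Hp Hq]]]] := closed_form x y.
have e20 : 0 < e / 2 by rewrite divr_gt0.
have [d1 d10 H1] := Hp _ e20; have [d2 d20 H2] := Hq _ e20.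
exists (Num.min d1 d2); first by rewrite lt_min d10.
move=> a b a' b' sa tb; rewrite !lt_min => /andP[a1 a2] /andP[b1 b2] /andP[xa xa'] /andP[yb yb'].
set D := (a' - a) + (b' - b).
have near u v : a <= u <= a' -> b <= v <= b' ->
    [/\ `|u - x| < d1, `|u - x| < d2, `|v - y| < d1, `|v - y| < d2 &
      `|u - x| + `|v - y| <= D].
  move=> /andP[au ua'] /andP[bv vb'].
  have Hu : `|u - x| <= a' - a by rewrite ler_norml; lra.
  have Hv : `|v - y| <= b' - b by rewrite ler_norml; lra.
  by split; rewrite /D; lra.
have P1 v : b <= v <= b' -> forall u, a <= u <= a' ->
    `|p u v - ((p x y - p1 * x + p2 * (v - y)) + p1 * u)| <= e / 2 * D.
  move=> hv u hu; have [n1 _ n2 _ n3] := near u v hu hv.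
  have := H1 u v n1 n2; rewrite [X in `|_ - X|](_ : _ = p x y - p1 * x + p2 * (v - y) + p1 * u); last by ring.
  by move=> /le_trans; apply; rewrite ler_wpM2l // ltW.
have Q1 u : a <= u <= a' -> forall v, b <= v <= b' ->
    `|q u v - ((q x y - q2 * y + p2 * (u - x)) + q2 * v)| <= e / 2 * D.
  move=> hu v hv; have [_ n1 _ n2 n3] := near u v hu hv.
  have := H2 u v n1 n2; rewrite [X in `|_ - X|](_ : _ = q x y - q2 * y + p2 * (u - x) + q2 * v); last by ring.
  by move=> /le_trans; apply; rewrite ler_wpM2l // ltW.
have aa' : a <= a' by lra.
have bb' : b <= b' by lra.
have ia : a <= a <= a' by rewrite lexx.
have ia' : a <= a' <= a' by rewrite lexx andbT.
have ib : b <= b <= b' by rewrite lexx.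
have ib' : b <= b' <= b' by rewrite lexx andbT.
have := primitive_bound (@cp b) sa aa' (P1 b ib).
have := primitive_bound (@cp b') sa aa' (P1 b' ib').
have := primitive_bound (@cq a) tb bb' (Q1 a ia).
have := primitive_bound (@cq a') tb bb' (Q1 a' ia').
rewrite /boundary_integral.
set A1 := primitive s (p^~ b) a'; set A2 := primitive s (p^~ b) a.
set A3 := primitive s (p^~ b') a'; set A4 := primitive s (p^~ b') a.
set B1 := primitive t (q a') b'; set B2 := primitive t (q a') b.
set B3 := primitive t (q a) b'; set B4 := primitive t (q a) b.
set E1 := (X in `|B1 - B2 - X|); set E2 := (X in `|B3 - B4 - X|).
set E3 := (X in `|A3 - A4 - X|); set E4 := (X in `|A1 - A2 - X|).
move=> K1 K2 K3 K4.
have -> : A1 - A2 + (B1 - B2) - (A3 - A4) - (B3 - B4) =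
   (A1 - A2 - E4) + (B1 - B2 - E1) - (A3 - A4 - E3) - (B3 - B4 - E2).
  by rewrite /E1 /E2 /E3 /E4; field.
have -> : e * D ^+ 2 = e / 2 * D * (a' - a) + e / 2 * D * (b' - b)
   + e / 2 * D * (a' - a) + e / 2 * D * (b' - b) by rewrite /D; field.
apply: le_trans (ler_normB _ _) _; apply: lerD => //.
apply: le_trans (ler_normB _ _) _; apply: lerD => //.
by apply: le_trans (ler_normD _ _) _; apply: lerD.
Qed.

(** The bound e r^2 on the boundary integral passes from the quarters to the whole, since inner
    edges cancel and 4 (r / 2)^2 = r^2; and [e] is arbitrary. *)
Lemma goursat a b a' b' : s < a -> t < b -> a <= a' -> b <= b' ->
  boundary_integral a b a' b' = 0.
Proof.
move=> sa tb aa' bb'; apply/eqP; rewrite -normr_le0; apply/ler_addgt0Pr => e e0; rewrite add0r.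
pose w := a' - a; pose h := b' - b.
have w0 : 0 <= w by rewrite subr_ge0.
have h0 : 0 <= h by rewrite subr_ge0.
(* Half the perimeter is r (w + h), so the local bound c (r (w + h))^2 is at most e r^2; the + 1
   covers w = h = 0. *)
pose c := e / ((w + h) ^+ 2 + 1).
have D0 : 0 < (w + h) ^+ 2 + 1 by rewrite ltr_wpDl // sqr_ge0.
have c0 : 0 < c by rewrite divr_gt0.
have := @quadrisection R w h (fun u v r => s < u -> t < v ->
  `|boundary_integral u v (u + r * w) (v + r * h)| <= e * r ^+ 2) w0 h0.
move=> /(_ _ _ a b 1 ltr01 sa tb).
rewrite !mul1r !subrKC expr1n mulr1; apply.
  move=> x y; have [d d0 H] := boundary_integral_near x y c0.
  exists (d / (w + h + 1)); first by rewrite divr_gt0 // ltr_wpDl // addr_ge0.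
  move=> u v r r0 rd hx hy su tv.
  have rd' : r * (w + h + 1) < d by rewrite -ltr_pdivlMr // ltr_wpDl // addr_ge0.
  have rw : 0 <= r * w by rewrite mulr_ge0 // ltW.
  have rh : 0 <= r * h by rewrite mulr_ge0 // ltW.
  have Ew : u + r * w - u = r * w by rewrite addrAC subrr add0r.
  have Eh : v + r * h - v = r * h by rewrite addrAC subrr add0r.
  have := H u v (u + r * w) (v + r * h) su tv; rewrite Ew Eh.
  move=> /(_ _ _ hx hy) /le_trans; apply; [lra|lra|].
  rewrite -mulrDr exprMn mulrCA [leRHS]mulrC.
  rewrite ler_wpM2l ?sqr_ge0 // /c mulrAC ler_pdivrMr // ler_wpM2l ?lerDl //.
  exact: ltW.
move=> u v r r0 H1 H2 H3 H4 su tv.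
have r20 : 0 <= r / 2 by rewrite divr_ge0 // ltW.
have su' : s < u + r / 2 * w by rewrite ltr_wpDr // mulr_ge0.
have tv' : t < v + r / 2 * h by rewrite ltr_wpDr // mulr_ge0.
have {H1} := H1 su tv; have {H2} := H2 su' tv; have {H3} := H3 su tv'.
have {H4} := H4 su' tv'.
have Ew : u + r / 2 * w + r / 2 * w = u + r * w by field.
have Eh : v + r / 2 * h + r / 2 * h = v + r * h by field.
rewrite Ew Eh.
set um := u + r / 2 * w; set vm := v + r / 2 * h; set u' := u + r * w; set v' := v + r * h => K4 K3 K2 K1.
have -> : boundary_integral u v u' v' =
  boundary_integral u v um vm + boundary_integral um v u' vm +
  boundary_integral u vm um v' + boundary_integral um vm u' v'.
  by rewrite /boundary_integral; ring.
have -> : e * r ^+ 2 = e * (r / 2) ^+ 2 + e * (r / 2) ^+ 2 + e * (r / 2) ^+ 2 +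
  e * (r / 2) ^+ 2 by field.
apply: le_trans (ler_normD _ _) _; apply: lerD => //.
apply: le_trans (ler_normD _ _) _; apply: lerD => //.
by apply: le_trans (ler_normD _ _) _; apply: lerD.
Qed.

End Rectangle.

(** On a rectangle of height 2 pi the horizontal sides cancel by periodicity, so the two vertical
    integrals agree; far to the left this integral is close to 2 pi k, far to the right to 0. *)
Lemma periodic_closed_form_eq0 (k : R) : (forall x, p x (2 * pi) = p x 0) ->
  (forall e, 0 < e -> exists x0, forall x y, x < x0 -> `|q x y - k| <= e) ->
  (forall e, 0 < e -> exists x0, forall x y, x0 < x -> `|q x y| <= e) ->
  k = 0.
Proof.
move=> per Hk H0; apply/eqP; rewrite -normr_le0; apply/ler_addgt0Pr => e e0; rewrite add0r.
have e2 : 0 < e / 2 by rewrite divr_gt0.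
have pi20 : 0 < 2 * pi :> R by rewrite mulr_gt0 ?pi_gt0.
have [m Hm] := Hk _ e2; have [M HM] := H0 _ e2.
pose a := Num.min m M - 1; pose a' := Num.max m M + 1.
have [m1 m2] : Num.min m M <= m /\ Num.min m M <= M by rewrite !ge_min !lexx orbT.
have [M1 M2] : m <= Num.max m M /\ M <= Num.max m M by rewrite !le_max !lexx orbT.
have am : a < m by rewrite /a; lra.
have aM : M < a' by rewrite /a'; lra.
have aa' : a <= a' by rewrite /a /a'; lra.
(* The base points a - 1 and -1 only have to lie strictly to the left of and below the rectangle. *)
have := @goursat (a - 1) (-1) a 0 a' (2 * pi) _ _ aa' (ltW pi20).
rewrite ltrBlDr ltrDl ltrN10 => /(_ ltr01 isT).
rewrite /boundary_integral (funext per).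
have sm1 : -1 < 0 :> R by rewrite ltrN10.
have Ka : forall t, 0 <= t <= 2 * pi -> `|q a t - (k + 0 * t)| <= e / 2.
  by move=> t _; rewrite mul0r addr0; exact: Hm.
have Ka' : forall t, 0 <= t <= 2 * pi -> `|q a' t - (0 + 0 * t)| <= e / 2.
  by move=> t _; rewrite mul0r addr0 subr0; exact: HM.
have := primitive_bound (@cq a) sm1 (ltW pi20) Ka.
have := primitive_bound (@cq a') sm1 (ltW pi20) Ka'.
rewrite !mul0r !addr0 !subr0.
set A := primitive _ _ _ - _; set B := primitive _ _ _ - _; set D := primitive _ _ _ - _.
move=> H1 H2 E.
have {E} E : B = A by lra.
rewrite -(ler_pM2r pi20) -[leLHS](ger0_norm (mulr_ge0 (normr_ge0 k) (ltW pi20))).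
rewrite normrM normr_id -normrM.
rewrite (_ : k * (2 * pi) = A - (B - k * (2 * pi))); last by rewrite E; ring.
by apply: le_trans (ler_normB _ _) _; rewrite [leRHS](_ : _ = e / 2 * (2 * pi) + e / 2 * (2 * pi)) ?lerD //; field.
Qed.

End ClosedForm.
End Goursat.

Section Liouville.
Variable R : realType.
Local Notation C := (Cplx R).

Lemma near_cabsP (P : C -> Prop) : (\forall h \near (0 : C), P h) <->
  exists2 d : R, 0 < d & forall h : C, cabs h < d -> P h.
Proof.
split=> [/nbhs_ballP[e /= e0 H]|[d d0 H]].
  have eE : e = (Re e)%:C%C by apply/esym/RRe_real/gtr0_real.
  exists (Re e); first by rewrite -ltcR -eE.
  move=> h hd; apply: H; rewrite -ball_normE /= sub0r normrN cabsE [ltRHS]eE.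
  by rewrite ltcR.
apply/nbhs_ballP; exists (d%:C%C) => /=; first by rewrite ltcR.
by move=> h; rewrite -ball_normE /= sub0r normrN cabsE ltcR; exact: H.
Qed.

Lemma derivable_eps (f : C -> C) z : derivable f z 1 -> forall e : R, 0 < e ->
  exists2 d : R, 0 < d & forall h : C, cabs h < d ->
    cabs (f (h + z) - f z - h * 'D_1 f z) <= e * cabs h.
Proof.
move=> df e e0; have ec : 0 < e%:C%C :> C by rewrite ltcR.
have dfz : differentiable f z by apply/derivable1_diffP.
have /near_cabsP[d d0 H] := diff_eps dfz ec.
exists d => // h /H; rewrite diff1E // derive1E.
by rewrite !cabsE -rmorphM lecR.
Qed.

Lemma derivable_affine_near (f : C -> C) x y : derivable f (Complex x y) 1 ->
  let d := 'D_1 f (Complex x y) in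
  affine_near (fun x y => Re (f (Complex x y))) x y (Re d) (- Im d) /\
  affine_near (fun x y => Im (f (Complex x y))) x y (Im d) (Re d).
Proof.
move=> df d; rewrite /d; set D := 'D_1 f _.
have K e : 0 < e -> exists2 d : R, 0 < d & forall x' y', `|x' - x| < d -> `|y' - y| < d ->
    cabs (f (Complex x' y') - f (Complex x y) - Complex (x' - x) (y' - y) * D)
      <= e * (`|x' - x| + `|y' - y|).
  move=> e0; have [d1 d10 H] := derivable_eps df e0.
  exists (d1 / 2) => [|x' y' xd yd]; first by rewrite divr_gt0.
  have hd : cabs (Complex (x' - x) (y' - y) : C) <= `|x' - x| + `|y' - y| by exact: cabs_le.
  have := H (Complex (x' - x) (y' - y)); rewrite -/D.
  have -> : Complex (x' - x) (y' - y) + Complex x y = Complex x' y' :> C.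
    by apply/eqP; rewrite eq_complex /= !subrK !eqxx.
  move=> {}H; apply: le_trans (H _) _; first by lra.
  by rewrite ler_wpM2l // ltW.
split=> e e0; have [d0 dp H] := K e e0; exists d0 => // x' y' hx hy.
  have := le_trans (cabs_ge_Re _) (H x' y' hx hy).
  case: (f (Complex x' y')) => a b; case: (f (Complex x y)) => a' b'; case: (D) => p q /=.
  by congr (`|_| <= _); ring.
have := le_trans (cabs_ge_Im _) (H x' y' hx hy).
case: (f (Complex x' y')) => a b; case: (f (Complex x y)) => a' b'; case: (D) => p q /=.
by congr (`|_| <= _); ring.
Qed.

Definition cexp (z : C) : C := Complex (expR (Re z) * cos (Im z)) (expR (Re z) * sin (Im z)).

Lemma cexpD z w : cexp (z + w) = cexp z * cexp w.
Proof.
case: z w => [a b] [c d]; rewrite /cexp /= expRD cosD sinD.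
by apply/eqP; rewrite eq_complex /=; apply/andP; split; apply/eqP; ring.
Qed.

Lemma cexp0 : cexp 0 = 1.
Proof. by rewrite /cexp /= expR0 cos0 sin0 mulr1 mulr0. Qed.

Lemma cabs_cexp z : cabs (cexp z) = expR (Re z).
Proof.
rewrite /cabs cnormE /= !exprMn -mulrDr cos2Dsin2 mulr1 sqrtr_sqr ger0_norm // expR_ge0.
Qed.

Lemma cexpN z : cexp z * cexp (- z) = 1.
Proof. by rewrite -cexpD subrr cexp0. Qed.

Lemma is_derive_eps (f : R -> R) (x l : R) : is_derive x 1 f l ->
  forall e : R, 0 < e -> exists2 d, 0 < d & forall h, `|h| < d ->
    `|f (h + x) - f x - h * l| <= e * `|h|.
Proof.
move=> [df El] e e0; have dfx : differentiable f x by apply/derivable1_diffP.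
have /nbhs_ballP[d d0 H] := diff_eps dfx e0.
exists d => // h hd; have := H h; rewrite -ball_normE /= sub0r normrN => /(_ hd).
by rewrite diff1E // derive1E El.
Qed.

Lemma is_derive_of_eps (f : R -> R) (x l : R) :
  (forall e : R, 0 < e -> exists2 d, 0 < d & forall h, `|h| < d ->
    `|f (h + x) - f x - h * l| <= e * `|h|) -> is_derive x 1 f l.
Proof.
move=> H; have [df Edf] : is_diff x f ( *:%R l).
  apply: is_diff_eps; first exact: scaler_continuous.
  move=> e e0; have [d d0 {}H] := H e e0.
  apply/nbhs_ballP; exists d => // h; rewrite -ball_normE /= sub0r normrN => hd.
  by rewrite /GRing.scale /= mulrC; exact: H.
apply: DeriveDef; first exact/derivable1_diffP.
by rewrite deriveE // Edf /GRing.scale /= mulr1.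
Qed.

Lemma derivable_cexp z : derivable cexp z 1.
Proof.
have K : forall e : R, 0 < e -> exists2 d, 0 < d & forall h : C, cabs h < d ->
    cabs (cexp h - 1 - h) <= e * cabs h.
  move=> e e0; have e6 : 0 < e / 6 by rewrite divr_gt0.
  have [d1 d10 H1] := is_derive_eps (is_derive_expR 0) e6.
  have [d2 d20 H2] := is_derive_eps (is_derive_cos 0) e6.
  have [d3 d30 H3] := is_derive_eps (is_derive_sin 0) e6.
  have [d4 d40 H4] := is_derive_eps (is_derive_expR 0) ltr01.
  (* With N = |h|, the bound 1/2 gives |exp a| <= 2. The real part then costs 3 (e / 6) N, the
     imaginary part 2 (e / 6) N + 2 N^2 with 2 N^2 <= (e / 6) N, in all e N. *)
  exists (Num.min (Num.min d1 d2) (Num.min (Num.min d3 d4) (Num.min (e / 12) (1/2)))).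
    by rewrite !lt_min d10 d20 d30 d40 !divr_gt0.
  move=> h; rewrite !lt_min => /andP[/andP[hd1 hd2] /andP[/andP[hd3 hd4] /andP[hd5 hd6]]].
  have ha := cabs_ge_Re h; have hb := cabs_ge_Im h.
  have [Er Ei] : Re (cexp h - 1 - h) = expR (Re h) * cos (Im h) - 1 - Re h /\
      Im (cexp h - 1 - h) = expR (Re h) * sin (Im h) - 0 - Im h.
    by rewrite /cexp; case: (h).
  have := cabs_le (cexp h - 1 - h); rewrite Er Ei => /le_trans; apply.
  move: ha hb hd1 hd2 hd3 hd4 hd5 hd6.
  move: (Re h) (Im h) (cabs h) => a b N ha hb hd1 hd2 hd3 hd4 hd5 hd6.
  have {}H1 := H1 a (le_lt_trans ha hd1).
  have {}H2 := H2 b (le_lt_trans hb hd2).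
  have {}H3 := H3 b (le_lt_trans hb hd3).
  have {}H4 := H4 a (le_lt_trans ha hd4).
  move: H1 H2 H3 H4; rewrite !addr0 expR0 cos0 sin0 !oppr0 !mulr1 mulr0 !subr0 !addr0 mul1r => H1 H2 H3 H4.
  have N0 : 0 <= N by rewrite (le_trans _ ha).
  have e1 : `|expR a - 1| <= 2 * N.
    rewrite (_ : expR a - 1 = (expR a - 1 - a) + a); last by ring.
    by apply: le_trans (ler_normD _ _) _; lra.
  have e2 : `|expR a| <= 2.
    rewrite (_ : expR a = (expR a - 1) + 1); last by ring.
    by apply: le_trans (ler_normD _ _) _; rewrite normr1; lra.
  have K1 : `|expR a * cos b - 1 - a| <= e / 6 * N + 2 * (e / 6 * N).
    rewrite (_ : _ - 1 - a = (expR a - 1 - a) + expR a * (cos b - 1)); last by ring.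
    apply: le_trans (ler_normD _ _) _; apply: lerD.
      by apply: le_trans H1 _; rewrite ler_wpM2l // ltW.
    rewrite normrM ler_pM // (le_trans H2) // ler_wpM2l //; exact: ltW.
  have K2 : `|expR a * sin b - b| <= 2 * (e / 6 * N) + 2 * N * N.
    rewrite (_ : _ - b = expR a * (sin b - b) + (expR a - 1) * b); last by ring.
    apply: le_trans (ler_normD _ _) _; apply: lerD.
      rewrite normrM ler_pM // (le_trans H3) // ler_wpM2l //; exact: ltW.
    by rewrite normrM ler_pM.
  have : 2 * N * N <= 2 * (e / 12) * N by rewrite ler_wpM2r // ler_wpM2l // ltW.
  have -> : e * N = (e / 6 * N + 2 * (e / 6 * N)) + (2 * (e / 6 * N) + 2 * (e / 12) * N) by field.
  by move=> KN; apply: le_trans (lerD K1 K2) _; rewrite lerD2l lerD2l.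
(* The addition theorem reduces the estimate at [z] to the one at 0, with tolerance divided by |exp
   z|. *)
have [dE _] : is_diff z cexp ( *:%R (cexp z)).
  apply: is_diff_eps; first exact: scaler_continuous.
  move=> e e0; have eE : e = (Re e)%:C%C by apply/esym/RRe_real/gtr0_real.
  have M0 : 0 < expR (Re z) by exact: expR_gt0.
  have [|d d0 H] := K (Re e / expR (Re z)).
    by rewrite divr_gt0 // -ltcR -eE.
  apply/near_cabsP; exists d => // h /H {}H.
  rewrite cexpD [X in `|X|](_ : _ = cexp z * (cexp h - 1 - h)); last by rewrite /GRing.scale /= !mulrBr mulr1 [cexp h * _]mulrC.
  rewrite normrM !cabsE cabs_cexp [in X in _ <= X]eE -!rmorphM lecR.
  by apply: le_trans (ler_wpM2l (ltW M0) H) _; rewrite mulrCA mulrA divfK ?gt_eqF.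
by apply/derivable1_diffP.
Qed.

(* [phi zeta = (f (z0 + e^zeta) - f z0) e^(-zeta)] is entire and 2 pi i-periodic,
   tends to [f' z0] on the left and to [0] on the right; its mean over a vertical
   period does not depend on the real part by Goursat. *)
Lemma bounded_entire_derive0 (f : C -> C) (M : R) : (forall z, derivable f z 1) ->
  (forall z, cabs (f z) <= M) -> forall z, 'D_1 f z = 0.
Proof.
move=> df fM z0; set D := 'D_1 f z0.
pose phi z := (f (cexp z + z0) - f z0) * cexp (- z).
have dphi z : derivable phi z 1.
  apply: derivableM.
    apply: derivableB; last exact: derivable_cst.
    apply/derivable1_diffP; apply: differentiable_comp; last exact/derivable1_diffP.
    apply: differentiableD; last exact: differentiable_cst.
    exact/derivable1_diffP/derivable_cexp.
  apply/derivable1_diffP; apply: differentiable_comp.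
    by apply: differentiableN.
  exact/derivable1_diffP/derivable_cexp.
pose u x y := Re (phi (Complex x y)); pose v x y := Im (phi (Complex x y)).
have an x y : exists p q, affine_near u x y p (- q) /\ affine_near v x y q p.
  by have [] := derivable_affine_near (dphi (Complex x y)); do 2!eexists; split; eassumption.
have phiE z : cabs (phi z) = cabs (f (cexp z + z0) - f z0) / expR (Re z).
  have -> : (expR (Re z))^-1 = cabs (cexp (- z)) by rewrite cabs_cexp; case: z => a b /=; rewrite expRN.
  by rewrite /phi; apply: complexI; rewrite rmorphM -!cabsE normrM.
have left e : 0 < e -> exists x0, forall x y, x < x0 -> cabs (phi (Complex x y) - D) <= e.
  move=> e0; have [d d0 H] := derivable_eps (df z0) e0.
  (* For x < ln d the point exp zeta lies within d of 0, where the difference quotient of [f] at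
     [z0] is close to [D]. *)
  exists (ln d) => x y xd; set z := Complex x y.
  have ed : cabs (cexp z) < d by rewrite cabs_cexp /= -[ltRHS]lnK // ltr_expR.
  have := H _ ed; rewrite cabs_cexp /= => {}H.
  have -> : phi z - D = (f (cexp z + z0) - f z0 - cexp z * D) * cexp (- z).
    by rewrite mulrBl mulrAC cexpN mul1r.
  have -> : cabs ((f (cexp z + z0) - f z0 - cexp z * D) * cexp (- z)) =
      cabs (f (cexp z + z0) - f z0 - cexp z * D) / expR x.
    have -> : (expR x)^-1 = cabs (cexp (- z)) by rewrite cabs_cexp /= expRN.
    by apply: complexI; rewrite rmorphM -!cabsE normrM.
  by rewrite ler_pdivrMr ?expR_gt0.
have right e : 0 < e -> exists x0, forall x y, x0 < x -> cabs (phi (Complex x y)) <= e.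
  move=> e0; have M0 : 0 <= M by apply: le_trans (fM 0); rewrite -ler0c -cabsE.
  have N0 : 0 < (2 * M + 1) / e by rewrite divr_gt0 // ltr_wpDl // mulr_ge0.
  (* Here exp(-x) outweighs the bound 2 M on the increment of [f]; the + 1 keeps the logarithm's
     argument positive. *)
  exists (ln ((2 * M + 1) / e)) => x y; rewrite -ltr_expR lnK // => H.
  rewrite phiE /= ler_pdivrMr ?expR_gt0 // mulrC -ler_pdivrMr //.
  apply: le_trans (ltW H); rewrite ler_pM2r ?invr_gt0 //.
  have : cabs (f (cexp (Complex x y) + z0) - f z0) <= cabs (f (cexp (Complex x y) + z0)) + cabs (f z0).
    by rewrite -lecR rmorphD -!cabsE ler_normB.
  have := fM z0; have := fM (cexp (Complex x y) + z0); lra.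
have per x : phi (Complex x (2 * pi)) = phi (Complex x 0).
  by rewrite /phi /cexp /= !cosN !sinN mulr_natl cos2pi sin2pi cos0 sin0.
(* The closed forms are the two parts of phi dz = (u dx - v dy) + i (v dx + u dy): the imaginary one
   yields Re D, the real one yields - Im D. *)
have Re0 : Re D = 0.
  apply: (@periodic_closed_form_eq0 R v u) => //.
  - by move=> x y; have [p [q [H1 H2]]] := an x y; exists q, p, (- q).
  - by move=> x; rewrite /v per.
  - move=> e /left[x0 H]; exists x0 => x y /H - /(_ y); apply: le_trans.
    by apply: le_trans (cabs_ge_Re _); rewrite /u; case: (phi _); case: (D).
  - move=> e /right[x0 H]; exists x0 => x y /H - /(_ y); apply: le_trans.
    exact: cabs_ge_Re.
have Im0 : - Im D = 0.
  apply: (@periodic_closed_form_eq0 R u (fun x y => - v x y)) => //.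
  - move=> x y; have [p [q [H1 H2]]] := an x y; exists p, (- q), (- p); split => //.
    move=> e e0; have [d d0 H] := H2 e e0; exists d => // x' y' hx hy.
    apply: le_trans (H x' y' hx hy); rewrite -[leRHS]normrN.
    by rewrite le_eqVlt; apply/orP; left; apply/eqP; congr (`|_|); ring.
  - by move=> x; rewrite /u per.
  - move=> e /left[x0 H]; exists x0 => x y /H - /(_ y); apply: le_trans.
    apply: le_trans (cabs_ge_Im _); rewrite /v; case: (phi _) => a b; case: (D) => c d /=.
    by rewrite -normrN opprB opprK addrC.
  - move=> e /right[x0 H]; exists x0 => x y /H - /(_ y); apply: le_trans.
    by rewrite normrN; exact: cabs_ge_Im.
move/eqP: Im0; rewrite oppr_eq0 => /eqP; move: Re0; case: (D) => a b /= -> ->.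
by [].
Qed.

(** Here [g] stands for Re or Im, of which only real linearity and the bound by the modulus
    matter. *)
Lemma is_derive_ray (g : C -> R) (f : C -> C) z (t : R) :
  (forall w, `|g w| <= cabs w) -> (forall v w, g (v - w) = g v - g w) ->
  (forall (s : R) w, g (s%:C%C * w) = s * g w) -> derivable f (t%:C%C * z) 1 ->
  is_derive t 1 (fun t : R => g (f (t%:C%C * z))) (g (z * 'D_1 f (t%:C%C * z))).
Proof.
move=> gN gB gZ df; set D := 'D_1 f _.
have cz : 0 <= cabs z by rewrite -ler0c -cabsE.
apply: is_derive_of_eps => e e0.
have e1 : 0 < e / (cabs z + 1) by rewrite divr_gt0 // ltr_wpDl.
have [d d0 H] := derivable_eps df e1.
exists (d / (cabs z + 1)); first by rewrite divr_gt0 // ltr_wpDl.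
move=> s; rewrite ltr_pdivlMr ?ltr_wpDl // => sd.
have sz : cabs (s%:C%C * z) = `|s| * cabs z.
  by apply: complexI; rewrite -cabsE normrM (cabsE z) rmorphM normc_def /= expr0n addr0 sqrtr_sqr.
have s1 : `|s| * cabs z <= `|s| * (cabs z + 1) by rewrite ler_wpM2l // lerDl.
have := H (s%:C%C * z); rewrite sz => /(_ (le_lt_trans s1 sd)).
rewrite -mulrDl -rmorphD -gB -gZ -gB mulrA => {}H.
apply: le_trans (gN _) _; apply: le_trans H _.
by rewrite mulrAC ler_pdivrMr ?ltr_wpDl // -mulrA ler_wpM2l // ltW.
Qed.

Lemma is_derive_ray_Re (f : C -> C) z (t : R) : derivable f (t%:C%C * z) 1 ->
  is_derive t 1 (fun t : R => Re (f (t%:C%C * z))) (Re (z * 'D_1 f (t%:C%C * z))).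
Proof.
apply: is_derive_ray; [exact: cabs_ge_Re|by move=> [? ?] [? ?]|].
by move=> s [a b] /=; rewrite mul0r subr0.
Qed.

Lemma is_derive_ray_Im (f : C -> C) z (t : R) : derivable f (t%:C%C * z) 1 ->
  is_derive t 1 (fun t : R => Im (f (t%:C%C * z))) (Im (z * 'D_1 f (t%:C%C * z))).
Proof.
apply: is_derive_ray; [exact: cabs_ge_Im|by move=> [? ?] [? ?]|].
by move=> s [a b] /=; rewrite mul0r addr0.
Qed.

Theorem liouville (f : C -> C) (M : R) : (forall z, derivable f z 1) ->
  (forall z, cabs (f z) <= M) -> forall z, f z = f 0.
Proof.
move=> df fM z; have D0 := bounded_entire_derive0 df fM.
have HR (t : R) : is_derive t 1 (fun t : R => Re (f (t%:C%C * z))) 0.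
  by have := is_derive_ray_Re (df (t%:C%C * z)); rewrite D0 mulr0.
have HI (t : R) : is_derive t 1 (fun t : R => Im (f (t%:C%C * z))) 0.
  by have := is_derive_ray_Im (df (t%:C%C * z)); rewrite D0 mulr0.
have := is_derive_0_is_cst 1 0 HR; have := is_derive_0_is_cst 1 0 HI.
rewrite mul1r mul0r; case: (f z) => a b; case: (f 0) => c d /= -> ->.
by [].
Qed.

(** By the intermediate value theorem on rays Im f keeps its sign, which may be taken positive after
    replacing f by -f. Then |f + i| >= 1, and Liouville's theorem applies to 1 / (f + i). *)
Lemma entire_nonreal_cst (f : C -> C) : (forall z, derivable f z 1) ->
  (forall z, Im (f z) != 0) -> forall z, f z = f 0.
Proof.
move=> + + z; wlog f0 : f / 0 < Im (f 0) => [H df fN0|df fN0].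
  have [f0|f0|f0] := ltrgtP 0 (Im (f 0)); first exact: H.
    have ImN w : Im (- f w) = - Im (f w) by case: (f w).
    have := H (- f); rewrite !fctE ImN oppr_gt0 => /(_ f0 _ _)/oppr_inj; apply.
      by move=> w; exact: derivableN.
    by move=> w; rewrite ImN oppr_eq0.
  by have := fN0 0; rewrite -f0 eqxx.
have f_gt0 w : 0 < Im (f w).
  rewrite ltNge; apply/negP => fw.
  pose h (t : R) := Im (f (t%:C%C * w)).
  have ch : {within `[0, 1], continuous h}.
    apply: derivable_within_continuous => t _.
    by have [] := is_derive_ray_Im (df (t%:C%C * w)).
  have [|t _ /eqP] := IVT ler01 ch (v := 0).
    by rewrite /h mul0r mul1r ge_min le_max fw (ltW f0) orbT.
  exact/negP/fN0.
have gN w : f w + 'i%C != 0.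
  apply/eqP => /(congr1 (@complex.Im _)); have := f_gt0 w.
  by case: (f w) => a b /=; lra.
pose g w := (f w + 'i%C)^-1.
suff : g z = g 0 by move=> /invr_inj/addIr.
apply: (@liouville g 1) => w.
  apply: derivableV => //; apply: derivableD; [exact: df|exact: derivable_cst].
have cw : 0 < cabs (f w + 'i%C).
  by rewrite -ltcR -cabsE normr_gt0.
have -> : cabs (g w) = (cabs (f w + 'i%C))^-1.
  by apply: complexI; rewrite -cabsE normrV ?unitfE // cabsE fmorphV.
rewrite invf_le1 //; apply: le_trans (cabs_ge_Im _).
have := f_gt0 w; case: (f w) => a b /= b0.
by apply: le_trans (ler_norm _); lra.
Qed.

End Liouville.

(** * Monodromy over the plane *)

Section Monodromy.
Variables (R : realType) (Y : Type).
(** An abstract covering of the plane, with no topology on [Y]: [fiber p] holds the admissible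
    values over p, and [flat s p] says that s is a parallel section near p. In [flat_extend] the
    radius depends on the centre only, not on the value to be extended. *)
Variables (flat : (R * R -> Y) -> R * R -> Prop) (fiber : R * R -> Y -> Prop).

Hypothesis flat_germ : forall s s' p,
  (\forall q \near p, s q = s' q) -> flat s p -> flat s' p.
Hypothesis flat_extend : forall p, exists2 d, 0 < d & forall q y, ball p d q -> fiber q y ->
  exists s, s q = y /\ forall q', ball p d q' -> flat s q'.
Hypothesis flat_unique : forall s s' p, flat s p -> flat s' p ->
  exists2 d, 0 < d & forall q q', ball p d q -> ball p d q' -> s q = s' q -> s q' = s' q'.
Hypothesis flat_fiber : forall s p, flat s p -> fiber p (s p).

Definition flat_on (Q : set (R * R)) (s : R * R -> Y) := forall p, Q p ->
  exists2 s', flat s' p & \forall q \near p, Q q -> s q = s' q.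

Definition box (a b w h : R) : set (R * R) :=
  [set p | a <= p.1 <= a + w /\ b <= p.2 <= b + h].

Lemma box_closed a b w h : closed (box a b w h).
Proof.
have -> : box a b w h = fst @^-1` `[a, a + w]%classic `&` snd @^-1` `[b, b + h]%classic.
  by apply/seteqP; split => p; rewrite /box /= !in_itv.
apply: closedI; apply: preimage_closed; try exact: interval_closed.
  by move=> ? _; exact: cvg_fst.
by move=> ? _; exact: cvg_snd.
Qed.

Lemma ballRRP (p q : R * R) d : ball p d q <-> `|p.1 - q.1| < d /\ `|p.2 - q.2| < d.
Proof. by split => -[]. Qed.

Lemma box_small_ball a b w h d p q : 0 <= w -> 0 <= h -> w + h < d ->
  box a b w h p -> box a b w h q -> ball p d q.
Proof.
by move=> w0 h0 wd [/andP[? ?] /andP[? ?]] [/andP[? ?] /andP[? ?]]; apply/ballRRP; rewrite !ltr_norml; lra.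
Qed.

Lemma flat_onS Q Q' s : Q' `<=` Q -> flat_on Q s -> flat_on Q' s.
Proof.
move=> QQ' fs p /QQ' /fs[s' fs' E]; exists s' => //.
by apply: filterS E => q E /QQ'.
Qed.

Lemma flat_on_fiber Q s p : flat_on Q s -> Q p -> fiber p (s p).
Proof.
by move=> fs Qp; have [s' fs' /nbhs_singleton ->//] := fs p Qp; exact: flat_fiber.
Qed.

Lemma quadrants a b w h r : 0 < r -> 0 <= w -> 0 <= h ->
  box a b (r * w) (r * h) = (box a b (r / 2 * w) (r / 2 * h) `|`
    box (a + r / 2 * w) b (r / 2 * w) (r / 2 * h)) `|`
   (box a (b + r / 2 * h) (r / 2 * w) (r / 2 * h) `|`
    box (a + r / 2 * w) (b + r / 2 * h) (r / 2 * w) (r / 2 * h)).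
Proof.
move=> r0 w0 h0.
have -> : r * w = r / 2 * w + r / 2 * w by field.
have -> : r * h = r / 2 * h + r / 2 * h by field.
have {w0} : 0 <= r / 2 * w by rewrite mulr_ge0 // ltW ?divr_gt0.
have {h0} : 0 <= r / 2 * h by rewrite mulr_ge0 // ltW ?divr_gt0.
move: (r / 2 * w) (r / 2 * h) => u v v0 u0.
apply/seteqP; split => -[x y]; rewrite /box /= !addrA.
  move=> [/andP[? ?] /andP[? ?]].
  have [?|/ltW ?] := leP x (a + u); have [?|/ltW ?] := leP y (b + v).
  - by left; left; lra.
  - by right; left; lra.
  - by left; right; lra.
  - by right; right; lra.
by move=> [[]|[]] [/andP[? ?] /andP[? ?]]; lra.
Qed.

(** Agreement at one point spreads within small boxes by [flat_unique], and from quarter to quarter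
    through the centre. The degenerate boxes with [w] or [h] zero are the common edges along which
    sections are glued. *)
Lemma flat_on_box_unique a b w h s s' : 0 <= w -> 0 <= h ->
  flat_on (box a b w h) s -> flat_on (box a b w h) s' ->
  forall p q, box a b w h p -> box a b w h q -> s p = s' p -> s q = s' q.
Proof.
move=> w0 h0 fs fs'.
have := @quadrisection R w h (fun u v r => box u v (r * w) (r * h) `<=` box a b w h ->
  forall p q, box u v (r * w) (r * h) p -> box u v (r * w) (r * h) q ->
  s p = s' p -> s q = s' q) w0 h0.
move=> /(_ _ _ a b 1 ltr01); rewrite !mul1r; apply => //.
  (* A point outside the big box lies in none of its sub-boxes, so any radius will do there. *)
  move=> x y; have [Qp|NQ] := pselect (box a b w h (x, y)); last first.
    by exists 1 => // u v r _ _ hx hy /(_ (x, y)) H; case: NQ; apply: H.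
  have [s1 f1 E1] := fs _ Qp; have [s2 f2 E2] := fs' _ Qp.
  have [d d0 U] := flat_unique f1 f2.
  have /nbhs_ballP[d' /= d'0 E] : \forall q \near (x, y), (box a b w h q -> s q = s1 q) /\
    (box a b w h q -> s' q = s2 q) by apply: filterS2 E1 E2.
  have d3 : 0 < Num.min d d' / (w + h + 1).
    by rewrite divr_gt0 ?lt_min ?d0 // ltr_wpDl // addr_ge0.
  exists (Num.min d d' / (w + h + 1)) => // u v r r0.
  rewrite ltr_pdivlMr ?ltr_wpDl ?addr_ge0 // => rd hx hy sub p q Bp Bq.
  have rw : 0 <= r * w by rewrite mulr_ge0 // ltW.
  have rh : 0 <= r * h by rewrite mulr_ge0 // ltW.
  have rd' : r * w + r * h < Num.min d d' by lra.
  have inb z : box u v (r * w) (r * h) z -> ball (x, y) d z /\ ball (x, y) d' z.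
    by move=> Bz; split; apply: box_small_ball Bz => //; move: rd'; rewrite lt_min => /andP[].
  have [Bp1 Bp2] := inb p Bp; have [Bq1 Bq2] := inb q Bq.
  have [Ep1 Ep2] := E p Bp2; have [Eq1 Eq2] := E q Bq2.
  rewrite (Ep1 (sub _ Bp)) (Ep2 (sub _ Bp)) (Eq1 (sub _ Bq)) (Eq2 (sub _ Bq)).
  exact: U.
move=> u v r r0 H1 H2 H3 H4; rewrite quadrants // => sub.
have rw : 0 <= r / 2 * w by rewrite mulr_ge0 // divr_ge0 // ltW.
have rh : 0 <= r / 2 * h by rewrite mulr_ge0 // divr_ge0 // ltW.
(* The centre belongs to all four quarters, so agreement at [p] reaches [q] through it. *)
pose c := (u + r / 2 * w, v + r / 2 * h).
have c1 : box u v (r / 2 * w) (r / 2 * h) c by rewrite /box /=; lra.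
have c2 : box (u + r / 2 * w) v (r / 2 * w) (r / 2 * h) c by rewrite /box /=; lra.
have c3 : box u (v + r / 2 * h) (r / 2 * w) (r / 2 * h) c by rewrite /box /=; lra.
have c4 : box (u + r / 2 * w) (v + r / 2 * h) (r / 2 * w) (r / 2 * h) c by rewrite /box /=; lra.
have {}H1 := H1 (fun z Bz => sub z (or_introl (or_introl Bz))).
have {}H2 := H2 (fun z Bz => sub z (or_introl (or_intror Bz))).
have {}H3 := H3 (fun z Bz => sub z (or_intror (or_introl Bz))).
have {}H4 := H4 (fun z Bz => sub z (or_intror (or_intror Bz))).
move=> p q Bp Bq E.
have Ec : s c = s' c.
  by case: Bp => [[]|[]] Bp; [apply: (H1 p)|apply: (H2 p)|apply: (H3 p)|apply: (H4 p)].
by case: Bq => [[]|[]] Bq; [apply: (H1 c)|apply: (H2 c)|apply: (H3 c)|apply: (H4 c)].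
Qed.

(* Sections are only required to be flat as functions on [Q], so that those of
   two adjacent boxes can be glued along their common edge. *)
Definition extendable (Q : set (R * R)) := forall p y, Q p -> fiber p y ->
  exists2 s, flat_on Q s & s p = y.

Lemma flat_on_glue Q1 Q2 s1 s2 : closed Q1 -> closed Q2 -> flat_on Q1 s1 -> flat_on Q2 s2 ->
  (forall q, Q1 q -> Q2 q -> s1 q = s2 q) ->
  exists2 s, flat_on (Q1 `|` Q2) s & (forall q, Q1 q -> s q = s1 q).
Proof.
move=> c1 c2 f1 f2 E.
pose s q := if asbool (Q1 q) then s1 q else s2 q.
have sE1 q : Q1 q -> s q = s1 q by move=> Q1q; rewrite /s asboolT.
have sE2 q : Q2 q -> s q = s2 q.
  by move=> Q2q; rewrite /s; case: asboolP => // Q1q; exact: E.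
exists s => // p Qp.
have away (Q : set (R * R)) : closed Q -> ~ Q p -> \forall q \near p, ~ Q q.
  by move=> cQ NQ; apply: open_nbhs_nbhs; split => //; exact: closed_openC.
have [Q1p|NQ1] := pselect (Q1 p); have [Q2p|NQ2] := pselect (Q2 p).
- have [s1' g1 E1] := f1 p Q1p; have [s2' g2 E2] := f2 p Q2p.
  have [d d0 U] := flat_unique g1 g2.
  have Ep : s1' p = s2' p.
    by rewrite -(nbhs_singleton E1) // -(nbhs_singleton E2) // E.
  exists s1' => //; near=> q => -[Q1q|Q2q].
    by rewrite sE1 //; move: Q1q; near: q.
  rewrite sE2 //; transitivity (s2' q); first by move: Q2q; near: q.
  apply/esym; apply: (U p) => //; first exact: ballxx.
  by near: q; exact: nbhsx_ballx.
- have [s1' g1 E1] := f1 p Q1p; have N2 := away _ c2 NQ2.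
  exists s1' => //; apply: filterS2 E1 N2 => q E1 N2 [Q1q|//].
  by rewrite sE1 // E1.
- have [s2' g2 E2] := f2 p Q2p; have N1 := away _ c1 NQ1.
  exists s2' => //; apply: filterS2 E2 N1 => q E2 N1 [//|Q2q].
  by rewrite sE2 // E2.
- by case: Qp.
Unshelve. all: by end_near. Qed.

(** A section on the piece containing [p] is continued to the other piece from its value at [c];
    uniqueness on the intersection makes the two agree there. *)
Lemma extendableU Q1 Q2 c : closed Q1 -> closed Q2 -> Q1 c -> Q2 c ->
  (forall s s', flat_on (Q1 `&` Q2) s -> flat_on (Q1 `&` Q2) s' -> s c = s' c ->
    forall q, Q1 q -> Q2 q -> s q = s' q) ->
  extendable Q1 -> extendable Q2 -> extendable (Q1 `|` Q2).
Proof.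
have half Q Q' p y : closed Q -> closed Q' -> Q c -> Q' c ->
   (forall s s', flat_on (Q `&` Q') s -> flat_on (Q `&` Q') s' -> s c = s' c ->
     forall q, Q q -> Q' q -> s q = s' q) ->
   extendable Q -> extendable Q' -> Q p -> fiber p y -> exists2 s, flat_on (Q `|` Q') s & s p = y.
  move=> cQ cQ' Qc Q'c U EQ EQ' Qp Fy.
  have [s fs sp] := EQ p y Qp Fy.
  have [s' fs' sc] := EQ' c (s c) Q'c (flat_on_fiber fs Qc).
  have [|s'' f'' E''] := flat_on_glue cQ cQ' fs fs'.
    by apply: U => //; [apply: flat_onS fs => ? []|apply: flat_onS fs' => ? []].
  by exists s'' => //; rewrite E''.
move=> c1 c2 Q1c Q2c U E1 E2 p y [Q1p|Q2p] Fy; first exact: half.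
rewrite setUC; apply: half => //.
move=> s s' fs fs' e q Q2q Q1q; apply: U => //; by rewrite setIC.
Qed.

Lemma box_extendable a b r : 0 < r -> extendable (box a b r r).
Proof.
move=> r0; rewrite -[X in box a b X X](mulr1 r); move: a b r r0.
apply: (@quadrisection R 1 1 (fun a b r => extendable (box a b (r * 1) (r * 1)))) => //.
  move=> x y; have [d d0 H] := flat_extend (x, y).
  exists (d / 2) => [|a b r r0 rd hx hy p z Bp Fz]; first by rewrite divr_gt0.
  have inb q : box a b (r * 1) (r * 1) q -> ball (x, y) d q.
    by move=> Bq; apply: box_small_ball Bq => //; lra.
  have [s [sp fs]] := H p z (inb p Bp) Fz.
  by exists s => // q Bq; exists s; [exact/fs/inb|near=> t].
move=> a b r r0 H1 H2 H3 H4; rewrite quadrants //.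
rewrite !mulr1 in H1 H2 H3 H4 *.
have r20 : 0 <= r / 2 by rewrite divr_ge0 // ltW.
have c0 : box a b (r / 2) (r / 2) (a + r / 2, b + r / 2) by rewrite /box /=; lra.
pose c := (a + r / 2, b + r / 2).
have seg (Q : set (R * R)) a' b' w h : 0 <= w -> 0 <= h -> Q = box a' b' w h -> Q c ->
    forall s s', flat_on Q s -> flat_on Q s' -> s c = s' c -> forall q, Q q -> s q = s' q.
  by move=> w0 h0 -> Qc s s' fs fs' e q Qq; apply: (@flat_on_box_unique a' b' w h s s' w0 h0 fs fs' c).
apply: (@extendableU _ _ c).
- by apply: closedU; exact: box_closed.
- by apply: closedU; exact: box_closed.
- by left.
- by left; rewrite /box /=; lra.
(* The lower and upper halves meet in a horizontal segment, a box of height 0; within each half the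
   quarters meet in vertical segments. *)
- move=> s s' fs fs' e q Q1 Q2.
  apply: (@seg _ a (b + r / 2) r 0 (ltW r0) (lexx 0) _ _ s s' fs fs' e q (conj Q1 Q2)).
    apply/seteqP; split => -[x y]; rewrite /box /=.
      by move=> [[[/andP[? ?] /andP[? ?]]|[/andP[? ?] /andP[? ?]]] [[/andP[? ?] /andP[? ?]]|[/andP[? ?] /andP[? ?]]]]; lra.
    move=> [/andP[? ?] /andP[? ?]]; have [?|/ltW ?] := leP x (a + r / 2).
      by split; left; lra.
    by split; right; lra.
  by split; left; rewrite /box /=; lra.
- apply: (@extendableU _ _ c) => //; try exact: box_closed.
    by rewrite /box /=; lra.
  move=> s s' fs fs' e q Q1 Q2.
  apply: (@seg _ (a + r / 2) b 0 (r / 2) (lexx 0) r20 _ _ s s' fs fs' e q (conj Q1 Q2)).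
    apply/seteqP; split => -[x y]; rewrite /box /=; last by move=> [/andP[? ?] /andP[? ?]]; lra.
    by move=> [[/andP[? ?] /andP[? ?]] [/andP[? ?] /andP[? ?]]]; lra.
  by split; rewrite /box /=; lra.
- apply: (@extendableU _ _ c) => //; try exact: box_closed.
    by rewrite /box /=; lra.
    by rewrite /box /=; lra.
  move=> s s' fs fs' e q Q1 Q2.
  apply: (@seg _ (a + r / 2) (b + r / 2) 0 (r / 2) (lexx 0) r20 _ _ s s' fs fs' e q (conj Q1 Q2)).
    apply/seteqP; split => -[x y]; rewrite /box /=; last by move=> [/andP[? ?] /andP[? ?]]; lra.
    by move=> [[/andP[? ?] /andP[? ?]] [/andP[? ?] /andP[? ?]]]; lra.
  by split; rewrite /box /=; lra.
Unshelve. all: by end_near. Qed.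

(** Sections on concentric squares with the prescribed value at the origin agree where both are
    defined, and the squares exhaust the plane. *)
Theorem monodromy y0 : fiber (0, 0) y0 ->
  exists2 s, s (0, 0) = y0 & forall p, flat s p.
Proof.
move=> F0.
pose B r := box (- r) (- r) (r + r) (r + r).
have BP r p : B r p <-> `|p.1| <= r /\ `|p.2| <= r.
  by rewrite /B /box /= !ler_norml !addKr; split => -[-> ->].
have /choice[S SP] : forall r : R, exists s, 0 < r -> flat_on (B r) s /\ s (0, 0) = y0.
  move=> r; have [r0|r0] := leP r 0; first by exists (fun=> y0).
  have rr : 0 < r + r by rewrite addr_gt0.
  have [|s fs s0] := @box_extendable (- r) (- r) (r + r) rr (0, 0) y0 _ F0.
    by apply/(BP r); rewrite /= normr0 ltW.
  by exists s.
have agree r r' p : 0 < r -> r <= r' -> B r p -> S r p = S r' p.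
  move=> r0 rr' Bp; have [f1 e1] := SP r r0; have [f2 e2] := SP r' (lt_le_trans r0 rr').
  apply: (@flat_on_box_unique (- r) (- r) (r + r) (r + r) _ _ _ _ f1 _ (0, 0)) => //.
  - by rewrite addr_ge0 // ltW.
  - by rewrite addr_ge0 // ltW.
  - apply: flat_onS f2 => q /BP[q1 q2]; apply/BP; split; exact: le_trans rr'.
  - by apply/(BP r); rewrite /= normr0 ltW.
  - by rewrite e1 e2.
(* The square of radius [rad p] contains p. For q within 1 of p one has rad q <= rad p + 2, so near
   p the global section coincides with the one on a single square. *)
pose rad (p : R * R) := `|p.1| + `|p.2| + 1.
have rad0 p : 0 < rad p by rewrite /rad ltr_wpDl // addr_ge0.
exists (fun p => S (rad p) p) => [|p]; first by have [] := SP (rad (0, 0)) (rad0 _).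
have rp2 : 0 < rad p + 2 by rewrite addr_gt0.
have [f _] := SP _ rp2.
have Bp q : ball p 1 q -> rad q <= rad p + 2.
  move=> /ballRRP[q1 q2]; rewrite /rad.
  have := ler_normB p.1 (p.1 - q.1); have := ler_normB p.2 (p.2 - q.2).
  by rewrite !subKr; lra.
have Brad q : B (rad q) q.
  apply/BP; rewrite /rad; split; rewrite -addrA; last rewrite addrCA.
    by rewrite lerDl addr_ge0.
  by rewrite lerDl addr_ge0.
have Bbig q : ball p 1 q -> B (rad p + 2) q.
  move=> /Bp h; have /BP[q1 q2] := Brad q; apply/BP; split; exact: le_trans h.
have [s' fs' E] := f p (Bbig p (ballxx _ ltr01)).
apply: flat_germ fs'; near=> q.
have b1 : ball p 1 q by near: q; exact: nbhsx_ballx.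
rewrite (agree (rad q) (rad p + 2)) //; last exact: Bp.
by apply/esym; move: (Bbig q b1); near: q.
Unshelve. all: by end_near. Qed.

End Monodromy.

(** * Second derivatives and complex covectors *)

Section SecondDerivatives.
Variables (R : realType) (V : normedModType R).

Lemma is_derive_line (W : normedModType R) (f : V -> W) (a v : V) (t : R) :
  differentiable f (a + t *: v) ->
  is_derive t 1 (fun s : R => f (a + s *: v)) ('D_v f (a + t *: v)).
Proof.
move=> df.
have E : (fun h : R => h^-1 *: (f (a + (h *: (1 : R) + t) *: v) - f (a + t *: v)))
       = (fun h : R => h^-1 *: (f (h *: v + (a + t *: v)) - f (a + t *: v))).
  apply/funext => h; congr (_ *: (f _ - _)).
  by rewrite scalerDl addrCA /GRing.scale /= mulr1.
have dv := diff_derivable (v := v) df.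
apply: DeriveDef; first by rewrite /derivable E.
by rewrite /derive E.
Qed.

(* The second difference being symmetric in [u] and [v], dividing by [s ^+ 2]
   yields the symmetry of second derivatives without any continuity assumption. *)
Lemma second_difference (f : V -> R) (x u v : V) :
  (\forall y \near x, differentiable f y) -> differentiable ('D_v f) x ->
  forall e : R, 0 < e -> exists2 d : R, 0 < d & forall s : R, 0 < s -> s < d ->
  `|f (x + s *: u + s *: v) - f (x + s *: v) - (f (x + s *: u) - f x)
     - s ^+ 2 * 'D_u ('D_v f) x| <= e * s ^+ 2.
Proof.
move=> df dg e e0; rewrite (deriveE u dg).
set N := `|u| + `|v| + 1.
have N0 : 0 < N by rewrite ltr_wpDl // addr_ge0.
have e1 : 0 < e / (2 * N) by rewrite divr_gt0 // mulr_gt0.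
have /nbhs_ballP[d1 /= d10 H1] := diff_eps dg e1.
have /nbhs_ballP[d2 /= d20 H2] := df.
exists (Num.min d1 d2 / N) => [|s s0]; first by rewrite divr_gt0 // lt_min d10.
rewrite ltr_pdivlMr // lt_min => /andP[sd1 sd2].
pose dst (h : V) := `|h| <= s * N.
have near_uv (b t : R) : 0 <= b <= s -> 0 <= t <= s -> dst (b *: u + t *: v).
  move=> /andP[b0 bs] /andP[t0 ts]; rewrite /dst; apply: le_trans (ler_normD _ _) _.
  rewrite !normrZ !ger0_norm // /N !mulrDr mulr1 -addrA lerD ?ler_wpM2r //.
  by rewrite ler_wpDr ?ler_wpM2r // ltW.
(* The second difference is the increment of [g] over [0, s]; the mean value theorem in t leaves a
   first difference of the derivative along [v]. *)
pose g (t : R) := f (x + s *: u + t *: v) - f (x + t *: v).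
pose dg' (t : R) := 'D_v f (x + s *: u + t *: v) - 'D_v f (x + t *: v).
have inball h : dst h -> ball x d2 (x + h).
  by move=> hd; rewrite -ball_normE /= opprD addrA subrr sub0r normrN (le_lt_trans hd).
have s01 : 0 <= s <= s by rewrite lexx ltW.
have s00 : (0 : R) <= 0 <= s by apply/andP; split; [exact: lexx|exact: ltW].
have dgt t : 0 <= t <= s -> is_derive t 1 g (dg' t).
  move=> ts; apply: is_deriveB; apply: is_derive_line; apply: H2.
    by rewrite -addrA; apply: inball; exact: near_uv.
  by apply: inball; have := near_uv 0 t s00 ts; rewrite scale0r add0r.
have [||c cs E] := @MVT_segment R g dg' 0 s (ltW s0).
- by move=> t; rewrite in_itv /= => /andP[t0 ts]; apply: dgt; rewrite !ltW.
- apply: derivable_within_continuous => t; rewrite in_itv /= => ts.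
  by have [] := dgt t ts.
rewrite in_itv /= in cs.
have -> : f (x + s *: u + s *: v) - f (x + s *: v) - (f (x + s *: u) - f x) = g s - g 0.
  by rewrite /g !scale0r !addr0.
rewrite E subr0.
have rem h : dst h -> `|'D_v f (x + h) - 'D_v f x - 'd ('D_v f) x h| <= e / 2 * s.
  move=> hd; have := H1 h; rewrite -ball_normE /= sub0r normrN => /(_ (le_lt_trans hd sd1)).
  rewrite (addrC h x) => /le_trans; apply.
  apply: le_trans (ler_wpM2l (ltW e1) hd) _.
  by rewrite le_eqVlt; apply/orP; left; apply/eqP; field; rewrite gt_eqF.
have K1 := rem _ (near_uv s c s01 cs).
have K2 := rem _ (near_uv 0 c s00 cs).
have Ed : 'd ('D_v f) x (s *: u + c *: v) - 'd ('D_v f) x (0 *: u + c *: v) = s * 'd ('D_v f) x u.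
  by rewrite -linearB scale0r add0r addrK linearZ.
move: K1 K2 Ed; rewrite scale0r add0r addrA /dg'.
set A := 'D_v f (x + s *: u + c *: v); set B := 'D_v f (x + c *: v); set A0 := 'D_v f x.
set P := 'd _ _ _; set Q := 'd _ _ _; set U := 'd _ _ u => K1 K2 Ed.
have -> : (A - B) * s - s ^+ 2 * U = s * ((A - A0 - P) - (B - A0 - Q)).
  by rewrite expr2 -mulrA -Ed; ring.
rewrite normrM gtr0_norm // [leRHS](_ : _ = s * (e / 2 * s + e / 2 * s)); last by field.
rewrite ler_pM2l //; apply: le_trans (ler_normB _ _) _; exact: lerD.
Qed.

Lemma derive_sym (f : V -> R) (x u v : V) : (\forall y \near x, differentiable f y) ->
  differentiable ('D_u f) x -> differentiable ('D_v f) x ->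
  'D_u ('D_v f) x = 'D_v ('D_u f) x.
Proof.
move=> df du dv; apply/eqP; rewrite -subr_eq0 -normr_le0; apply/ler_addgt0Pr => e e0.
rewrite add0r; have e2 : 0 < e / 2 by rewrite divr_gt0.
have [d1 d10 H1] := second_difference u df dv e2.
have [d2 d20 H2] := second_difference v df du e2.
pose s := Num.min d1 d2 / 2.
have m0 : 0 < Num.min d1 d2 by rewrite lt_min d10.
have s0 : 0 < s by rewrite divr_gt0.
have : s < Num.min d1 d2 by rewrite /s; lra.
rewrite lt_min => /andP[sd1 sd2].
have := H1 s s0 sd1; have := H2 s s0 sd2.
rewrite (addrAC x (s *: v) (s *: u)).
set A := f (x + s *: u + s *: v); set B := f (x + s *: u); set D := f (x + s *: v).
set E := f x; set P := 'D_u ('D_v f) x; set Q := 'D_v ('D_u f) x => K2 K1.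
have ss : 0 < s ^+ 2 by rewrite exprn_gt0.
rewrite -(ler_pM2l ss) -{1}(gtr0_norm ss) -normrM.
have -> : s ^+ 2 * (P - Q) = (A - B - (D - E) - s ^+ 2 * Q) - (A - D - (B - E) - s ^+ 2 * P).
  by ring.
rewrite [leRHS](_ : _ = e / 2 * s ^+ 2 + e / 2 * s ^+ 2); last by field.
exact: le_trans (ler_normB _ _) (lerD K2 K1).
Qed.

End SecondDerivatives.

(** * Complex covectors and the algebra of their derivatives *)

Section Covectors.
Variables (R : realType) (n : nat).
Local Notation C := (Cplx R).
Local Notation iC := (Complex 0 1 : C).

Definition pairing (w v : 'rV[C]_n) : C := (w *m v^T) 0 0.

Lemma pairingDl w w' v : pairing (w + w') v = pairing w v + pairing w' v.
Proof. by rewrite /pairing mulmxDl mxE. Qed.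

Lemma pairingZl c w v : pairing (c *: w) v = c * pairing w v.
Proof. by rewrite /pairing -scalemxAl mxE. Qed.

Lemma pairingDr w v v' : pairing w (v + v') = pairing w v + pairing w v'.
Proof. by rewrite /pairing linearD mulmxDr mxE. Qed.

Lemma pairingZr c w v : pairing w (c *: v) = c * pairing w v.
Proof. by rewrite /pairing linearZ -scalemxAr mxE. Qed.

Lemma pairingNl w v : pairing (- w) v = - pairing w v.
Proof. by rewrite -scaleN1r pairingZl mulN1r. Qed.

Lemma pairing_delta w j : pairing w (delta_mx 0 j) = w 0 j.
Proof. by rewrite /pairing trmx_delta -colE mxE. Qed.

Lemma pairingC u v : pairing u v = pairing v u.
Proof. by rewrite /pairing -[in LHS](trmxK u) -trmx_mul [LHS]mxE. Qed.

(** A dimension count: the row space lies in the kernel of [w], and both have rank n - 1. *)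
Lemma row_free_sub_ker (A : 'M[C]_(n.-1, n)) w v : row_free A -> w != 0 ->
  (forall u, pairing w (u *m A) = 0) -> (v <= A)%MS = (pairing w v == 0).
Proof.
move=> fA w0 Aw.
have AK : (A <= kermx w^T)%MS.
  apply/sub_kermxP/row_matrixP => j; rewrite row_mul rowE.
  by apply/rowP => l; rewrite (ord1 l) [LHS]pairingC Aw !mxE.
have rK : \rank (kermx w^T) = n.-1 by rewrite mxrank_ker mxrank_tr rank_rV w0 subn1.
have KA : (kermx w^T <= A)%MS by rewrite -(geq_leqif (mxrank_leqif_sup AK)) rK row_leq_rank.
apply/idP/eqP => [/submxP[u ->]|wv]; first exact: Aw.
apply: submx_trans KA; apply/sub_kermxP/rowP => l.
by rewrite (ord1 l) [LHS]pairingC wv mxE.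
Qed.

Lemma Re_mul (a b : C) : Re (a * b) = Re a * Re b - Im a * Im b.
Proof. by case: a b => [? ?] [? ?]. Qed.

Lemma Im_mul (a b : C) : Im (a * b) = Re a * Im b + Im a * Re b.
Proof. by case: a b => [? ?] [? ?]. Qed.

Lemma ReD (a b : C) : Re (a + b) = Re a + Re b.
Proof. by case: a b => [? ?] [? ?]. Qed.

Lemma ImD (a b : C) : Im (a + b) = Im a + Im b.
Proof. by case: a b => [? ?] [? ?]. Qed.

Lemma ReN (a : C) : Re (- a) = - Re a. Proof. by case: a. Qed.

Lemma ImN (a : C) : Im (- a) = - Im a. Proof. by case: a. Qed.

Lemma Re_iM (a : C) : Re (iC * a) = - Im a.
Proof. by rewrite Re_mul /= mul0r mul1r sub0r. Qed.

Lemma Im_iM (a : C) : Im (iC * a) = Re a.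
Proof. by rewrite Im_mul /= mul0r mul1r add0r. Qed.

Lemma complexP (a b : C) : Re a = Re b -> Im a = Im b -> a = b.
Proof. by case: a b => [? ?] [? ?] /= -> ->. Qed.

Lemma iCiC : iC * iC = -1.
Proof. by apply: complexP; rewrite ?Re_iM ?Im_iM /= ?oppr0. Qed.

Lemma Re_pairing_inj (w w' : 'rV[C]_n) :
  (forall v, Re (pairing w v) = Re (pairing w' v)) -> w = w'.
Proof.
move=> H; apply/rowP => j.
have := H (delta_mx 0 j); have := H (iC *: delta_mx 0 j).
rewrite !pairingZr !pairing_delta !Re_iM => /oppr_inj I E; exact: complexP.
Qed.

(* The (1,0)-form of which the real linear form [l] is the real part. *)
Definition covector (l : 'rV[R]_(n + n) -> R) : 'rV[C]_n :=
  \row_j Complex (l (realify (delta_mx 0 j : 'rV[C]_n)))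
                 (- l (realify (iC *: delta_mx 0 j))).

Lemma covectorP (l : {linear 'rV[R]_(n + n) -> R}) v :
  Re (pairing (covector l) v) = l (realify v).
Proof.
rewrite /pairing mxE.
have -> : Re (\sum_j covector l 0 j * v^T j 0) = \sum_j Re (covector l 0 j * v^T j 0).
  by elim/big_ind2: _ => //= x y z t <- <-; rewrite ReD.
have -> : l (realify v) = \sum_j l (realify (v 0 j *: delta_mx 0 j)).
  rewrite {1}(row_sum_delta v).
  elim/big_rec2: _ => [|j x y _ <-]; first by rewrite realify0 linear0.
  by rewrite realifyD linearD.
apply: eq_bigr => j _; rewrite !mxE (complex_scale (v 0 j)).
rewrite realifyD !realifyZ linearD !linearZ /=.
by case: (v 0 j) => a b /=; rewrite /GRing.scale /=; ring.
Qed.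

Section DerivativeAlgebra.
(* [W] and [W'] play the roles of [u |-> D_u omega_1], [u |-> D_u omega_2]. *)
Variables (W W' : 'rV[C]_n -> 'rV[C]_n) (w : 'rV[C]_n) (tau : C) (T : 'rV[C]_n -> C).
Hypothesis W_sym : forall u v, Re (pairing (W u) v) = Re (pairing (W v) u).
Hypothesis W'_sym : forall u v, Re (pairing (W' u) v) = Re (pairing (W' v) u).
Hypothesis W'E : forall u, W' u = tau *: W u + T u *: w.

(** Expand the symmetry of [W'] in v and u. Since w(v) = 0, no term in [T u] survives, and the Re
    tau terms cancel by the symmetry of [W]. What is left is Im tau times the failure of [W] to
    commute with i at v. *)
Lemma antilinear_part v : pairing w v = 0 ->
  T v *: w = ((Im tau)%:C%C : C) *: (W (iC *: v) - iC *: W v).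
Proof.
move=> wv; apply: Re_pairing_inj => u.
have -> : Re (pairing (((Im tau)%:C%C : C) *: (W (iC *: v) - iC *: W v)) u) =
    Im tau * (Re (pairing (W (iC *: v)) u) + Im (pairing (W v) u)).
  by rewrite pairingZl pairingDl pairingNl pairingZl Re_mul /= mul0r subr0 ReD ReN Re_iM opprK.
have E1 := W_sym v u; have E2 := W_sym (iC *: v) u; have E3 := W'_sym v u.
move: E2 E3; rewrite pairingZr Re_iM !W'E !pairingDl !pairingZl wv mulr0 addr0.
rewrite ReD !(Re_mul tau) E1 => -> E3.
move: E3; set X := Re (T v * _); set a := Re tau; set b := Im tau.
set c := Re _; set d := Im _; set e := Im _ => E3.
have -> : X = (a * c - b * d + X) - (a * c - b * d) by ring.
by rewrite E3; ring.
Qed.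

(** The defect W(iv) - i W(v) is antilinear in v as soon as W(i(iv)) = - W(v); by [antilinear_part]
    so is [T]. This says that tau is antiholomorphic in the directions of ker w. *)
Lemma antilinear_T v : w != 0 -> (W (iC *: (iC *: v)) = - W v) -> pairing w v = 0 ->
  T (iC *: v) = - (iC * T v).
Proof.
move=> w0 Wi wv; apply/eqP; rewrite -subr_eq0 opprK; apply: contraNT w0 => nz.
have wiv : pairing w (iC *: v) = 0 by rewrite pairingZr wv mulr0.
have : (T (iC *: v) + iC * T v) *: w = 0.
  rewrite scalerDl -scalerA (antilinear_part wv) (antilinear_part wiv) Wi.
  rewrite scalerA mulrC -scalerA -scalerDr scalerBr (scalerA iC iC) iCiC scaleN1r opprK.
  by rewrite [X in _ + X]addrC addrACA !addNr addr0 scaler0.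
by move=> /eqP; rewrite scaler_eq0 (negPf nz).
Qed.

(** With T = 0 on ker w, [antilinear_part] makes [W] commute with i there. By symmetry the defect of
    [W] at an arbitrary u then vanishes on ker w, hence is a multiple of w. *)
Lemma transverse_part k : Im tau != 0 -> w 0 k != 0 ->
  (forall v, pairing w v = 0 -> T v = 0) ->
  forall u, exists c : C, W (iC *: u) - iC *: W u = c *: w.
Proof.
move=> tau0 wk T0 u; set z := W _ - _.
have Wi v : pairing w v = 0 -> W (iC *: v) = iC *: W v.
  move=> wv; have := antilinear_part wv; rewrite (T0 v wv) scale0r => /esym/eqP.
  rewrite scaler_eq0 subr_eq0 => /orP[/eqP/complexI E|/eqP //].
  by rewrite E eqxx in tau0.
have Rz v : pairing w v = 0 -> Re (pairing z v) = 0.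
  move=> wv; rewrite /z pairingDl pairingNl pairingZl ReD ReN.
  rewrite -(pairingZr iC) (W_sym _ v) (W_sym u) (Wi v wv) pairingZr pairingZl.
  by rewrite subrr.
have zv v : pairing w v = 0 -> pairing z v = 0.
  move=> wv; apply: complexP => /=; first exact: Rz.
  have := Rz (iC *: v); rewrite !pairingZr wv mulr0 Re_iM => /(_ erefl) /eqP.
  by rewrite oppr_eq0 => /eqP.
exists (z 0 k / w 0 k); apply/rowP => j; rewrite [RHS]mxE.
(* These vectors lie in ker w; testing on them compares each coefficient with the k-th. *)
have := zv (w 0 k *: delta_mx 0 j - w 0 j *: delta_mx 0 k).
rewrite -!scaleNr !pairingDr !pairingZr !pairing_delta.
rewrite mulrC mulNr addrN => /(_ erefl)/eqP; rewrite mulNr subr_eq0 => /eqP E.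
by rewrite mulrAC [z 0 k * _]mulrC -E mulrAC divff ?mul1r.
Qed.

End DerivativeAlgebra.

End Covectors.

Section NearDifferentials.
Variables (K : numFieldType) (V W : normedModType K).

Lemma near_add0 (x : V) (P : V -> Prop) : (\forall y \near x, P y) ->
  \forall h \near (0 : V), P (h + x).
Proof.
by move=> H; rewrite (near_shift x) /=; apply: filterS H => y; rewrite /= sub0r subrK.
Qed.

Lemma is_diff_near (f g : V -> W) x (df : {linear V -> W}) :
  (\forall y \near x, f y = g y) -> is_diff x f df -> is_diff x g df.
Proof.
move=> E [Df Edf]; apply: is_diff_eps; first by rewrite -Edf; exact: diff_continuous.
move=> e e0; apply: filterS2 (near_add0 E) (diff_eps Df e0) => h <-.
by rewrite -(nbhs_singleton E) Edf.
Qed.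

Lemma differentiable_near (f g : V -> W) x : (\forall y \near x, f y = g y) ->
  differentiable f x -> differentiable g x.
Proof. by move=> E df; have [] := is_diff_near E (differentiableP df). Qed.

Lemma derive_near (f g : V -> W) x v : (\forall y \near x, f y = g y) ->
  differentiable f x -> 'D_v g x = 'D_v f x.
Proof.
move=> E df; have [dg Eg] := is_diff_near E (differentiableP df).
by rewrite (deriveE v dg) (deriveE v df) Eg.
Qed.

End NearDifferentials.

Section ComplexValued.
Variables (R : realType) (V : normedModType R).
Local Notation C := (Cplx R).

Definition cdifferentiable (g : V -> C) x :=
  differentiable (fun y => Re (g y)) x /\ differentiable (fun y => Im (g y)) x.

Definition cderive v (g : V -> C) x : C :=
  Complex ('D_v (fun y => Re (g y)) x) ('D_v (fun y => Im (g y)) x).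

Lemma cderive_near g h x v : (\forall y \near x, g y = h y) ->
  cdifferentiable g x -> cderive v h x = cderive v g x.
Proof.
move=> E [dR dI]; rewrite /cderive.
have ER : \forall y \near x, Re (g y) = Re (h y) by apply: filterS E => y ->.
have EI : \forall y \near x, Im (g y) = Im (h y) by apply: filterS E => y ->.
by rewrite (derive_near v ER dR) (derive_near v EI dI).
Qed.

Lemma cdifferentiableM g h x : cdifferentiable g x -> cdifferentiable h x ->
  cdifferentiable (fun y => g y * h y) x.
Proof.
move=> [gR gI] [hR hI]; split.
  under eq_fun do rewrite Re_mul.
  by apply: differentiableB; apply: differentiableM.
under eq_fun do rewrite Im_mul.
by apply: differentiableD; apply: differentiableM.
Qed.

Lemma cdifferentiableV g x : cdifferentiable g x -> g x != 0 ->
  cdifferentiable (fun y => (g y)^-1) x.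
Proof.
move=> [gR gI] gx.
pose N y := Re (g y) * Re (g y) + Im (g y) * Im (g y).
have dN : differentiable N x by apply: differentiableD; apply: differentiableM.
have N0 : N x != 0.
  apply: contraNneq gx => /eqP; rewrite /N -!expr2 paddr_eq0 ?sqr_ge0 // !sqrf_eq0.
  by move=> /andP[/eqP a /eqP b]; apply/eqP/complexP.
have dNV : differentiable (fun y => (N y)^-1) x by exact: differentiableV.
have VE (z : C) : z^-1 = Complex (Re z * (Re z * Re z + Im z * Im z)^-1)
    (- Im z * (Re z * Re z + Im z * Im z)^-1).
  by case: z => a b; apply: complexP; rewrite /= -!expr2 ?mulNr.
split; under eq_fun do rewrite VE /=.
  exact: differentiableM.
by apply: differentiableM => //; exact: differentiableN.
Qed.

Lemma cderiveM g h x v : cdifferentiable g x -> cdifferentiable h x ->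
  cderive v (fun y => g y * h y) x = g x * cderive v h x + cderive v g x * h x.
Proof.
move=> [gR gI] [hR hI].
pose a y := Re (g y); pose b y := Im (g y); pose c y := Re (h y); pose d y := Im (h y).
have [da db dc dd] : [/\ derivable a x v, derivable b x v, derivable c x v & derivable d x v].
  by split; exact: diff_derivable.
have ER : (fun y => Re (g y * h y)) = a * c - b * d by apply/funext => y; exact: Re_mul.
have EI : (fun y => Im (g y * h y)) = a * d + b * c by apply/funext => y; exact: Im_mul.
rewrite /cderive ER EI.
have -> : 'D_v (a * c - b * d) x = 'D_v (a * c) x - 'D_v (b * d) x.
  exact: deriveB (derivableM da dc) (derivableM db dd).
have -> : 'D_v (a * d + b * c) x = 'D_v (a * d) x + 'D_v (b * c) x.
  exact: deriveD (derivableM da dd) (derivableM db dc).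
rewrite (deriveM da dc) (deriveM db dd) (deriveM da dd) (deriveM db dc) /GRing.scale /=.
rewrite -/a -/b -/c -/d.
move: ('D_v a x) ('D_v b x) ('D_v c x) ('D_v d x) => A B A' B'.
apply: complexP; rewrite ?ReD ?ImD ?Re_mul ?Im_mul /= -/(a x) -/(b x) -/(c x) -/(d x); ring.
Qed.

Lemma cdifferentiable_neq0 g x : cdifferentiable g x -> g x != 0 ->
  \forall y \near x, g y != 0.
Proof.
move=> [gR gI] gx.
have [R0|R0] := eqVneq (Re (g x)) 0.
  have I0 : Im (g x) != 0 by apply: contraNneq gx => I0; apply/eqP/complexP.
  have H := cvgr_neq0 _ (differentiable_continuous gI) I0; near=> y.
  have : Im (g y) != 0 by near: y; exact: H.
  by apply: contra_neq => ->.
have H := cvgr_neq0 _ (differentiable_continuous gR) R0; near=> y.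
have : Re (g y) != 0 by near: y; exact: H.
by apply: contra_neq => ->.
Unshelve. all: by end_near. Qed.

Lemma cderiveN g x v : cdifferentiable g x -> cderive (- v) g x = - cderive v g x.
Proof.
by move=> [gR gI]; apply: complexP; rewrite /cderive /= !deriveE // linearN.
Qed.

End ComplexValued.

(** * Complex gradients of real functions and the ratio of two of them *)

Section Gradients.
Variables (R : realType) (n : nat).
Local Notation C := (Cplx R).
Local Notation iC := (Complex 0 1 : C).
Local Notation E := 'rV[R]_(n + n).

(** This is 2 df/dz_j = df/dx_j - i df/dy_j, the (1,0)-covector whose real part is the differential
    of [f]. *)
Definition cgrad (f : E -> R) (x : E) : 'rV[C]_n := covector (fun v => 'D_v f x).

Lemma cgradE f x j : cgrad f x 0 j =
  Complex ('D_(realify (delta_mx 0 j : 'rV[C]_n)) f x) (- 'D_(realify (iC *: delta_mx 0 j)) f x).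
Proof. by rewrite mxE. Qed.

Lemma cgradP f x v : differentiable f x ->
  Re (pairing (cgrad f x) v) = 'D_(realify v) f x.
Proof.
move=> df; rewrite deriveE // -covectorP; congr (Re (pairing _ v)).
by apply/rowP => j; rewrite !mxE !deriveE.
Qed.

Lemma derive_along_cst m (f : E -> R) (g : 'rV[C]_m -> 'rV[C]_n) z u :
  differentiable g z -> differentiable f (realify (g z)) ->
  (\forall y \near z, f (realify (g y)) = f (realify (g z))) ->
  'D_(realify ('d g z u)) f (realify (g z)) = 0.
Proof.
move=> dg df Ncst; have [dG EG] := realify_is_diff dg.
set G := _ \o _ \o _ in dG EG; set x := realify z in dG EG.
have Gx : G x = realify (g z) by rewrite /G /= realifyK.
have df' : differentiable f (G x) by rewrite Gx.
have N : \forall y \near x, cst (f (G x)) y = (f \o G) y.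
  have : \forall y \near z, cst (f (G x)) (realify y) = (f \o G) (realify y).
    by apply: filterS Ncst => y Ey; rewrite /= Gx /G /= realifyK Ey.
  rewrite -{1}(realifyK z) => /near_complexify; apply: filterS => y.
  by rewrite complexifyK.
have [_ E0] := is_diff_near N (is_diff_cst (f (G x)) x).
have E2 := congr1 (fun l : _ -> R => l (realify u)) (diff_comp dG df').
have E3 : 'd f (G x) ('d G x (realify u)) = 'd f (realify (g z)) (realify ('d g z u)).
  by rewrite EG Gx /real_linear realifyK.
have E4 := congr1 (fun l : _ -> R => l (realify u)) E0.
exact: etrans (deriveE _ df) (etrans (esym E3) (etrans (esym E2) E4)).
Qed.

Definition twice_differentiable (f : E -> R) (x : E) :=
  (\forall y \near x, differentiable f y) /\ (forall v, differentiable ('D_v f) x).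

Lemma cgrad_cdifferentiable f x j : twice_differentiable f x ->
  cdifferentiable (fun y => cgrad f y 0 j) x.
Proof.
move=> [_ df]; split; under eq_fun do rewrite cgradE /=; first exact: df.
by apply: differentiableN; exact: df.
Qed.

Lemma cderive_cgrad f x u j : twice_differentiable f x ->
  cderive u (fun y => cgrad f y 0 j) x = cgrad ('D_u f) x 0 j.
Proof.
move=> [nf df]; rewrite cgradE /cderive.
set e := realify (delta_mx 0 j); set e' := realify (iC *: _).
have ER : (fun y => Re (cgrad f y 0 j)) = 'D_e f by apply/funext => y; rewrite cgradE.
have EI : (fun y => Im (cgrad f y 0 j)) = - 'D_e' f by apply/funext => y; rewrite cgradE.
have de' : derivable ('D_e' f) x u by exact/diff_derivable/df.
have EN : 'D_u (- 'D_e' f) x = - 'D_u ('D_e' f) x by exact: deriveN de'.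
have S1 := derive_sym nf (df u) (df e); have S2 := derive_sym nf (df u) (df e').
by rewrite ER EI; exact: congr2 S1 (etrans EN (congr1 -%R S2)).
Qed.

Lemma cgrad_sym f x u v : twice_differentiable f x ->
  Re (pairing (cgrad ('D_(realify u) f) x) v) = Re (pairing (cgrad ('D_(realify v) f) x) u).
Proof.
move=> [nf df]; rewrite (cgradP v (df (realify u))) (cgradP u (df (realify v))).
exact: derive_sym nf (df (realify v)) (df (realify u)).
Qed.

Lemma cgrad_deriveN f x u : twice_differentiable f x ->
  cgrad ('D_(- u) f) x = - cgrad ('D_u f) x.
Proof.
move=> df; apply/rowP => j; rewrite -cderive_cgrad // [RHS]mxE -cderive_cgrad //.
by rewrite cderiveN //; exact: cgrad_cdifferentiable.
Qed.

(** The Cauchy-Riemann equation D' = i D for a quotient l of two covector coefficients w' and w. A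
    and B are the derivatives of w' along iu and u, p and q those of w, D' and D those of l; the
    defects of both coefficients carry the same factor [c]. *)
Lemma quotient_rule_factor (F : fieldType) (i A B p q l w w' c D' D : F) :
  w != 0 -> w' = l * w -> A - i * B = c * w' -> p - i * q = c * w ->
  A = l * p + D' * w -> B = l * q + D * w -> D' = i * D.
Proof.
move=> w0 -> E1 E2 E3 E4; have : (D' - i * D) * w = 0.
  transitivity ((A - i * B) - l * (p - i * q)); first by rewrite E3 E4; ring.
  by rewrite E1 E2; ring.
by move/eqP; rewrite mulf_eq0 (negPf w0) orbF subr_eq0 => /eqP.
Qed.

(* [f1], [f2] are two transverse coordinates of a flat chart, and the kernel of
   [cgrad f1 x] is the tangent space of the leaf. *)
Section Ratio.
Variables (f1 f2 : E -> R) (tau : E -> C) (x : E).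
Hypothesis df1 : twice_differentiable f1 x.
Hypothesis df2 : twice_differentiable f2 x.
Hypothesis dtau : cdifferentiable tau x.
Hypothesis grad2 : \forall y \near x, cgrad f2 y = tau y *: cgrad f1 y.

Local Notation W := (fun u => cgrad ('D_(realify u) f1) x).
Local Notation W' := (fun u => cgrad ('D_(realify u) f2) x).
Local Notation T := (fun u => cderive (realify u) tau x).

Lemma derive_cgrad2 u : W' u = tau x *: W u + T u *: cgrad f1 x.
Proof.
apply/rowP => j; rewrite -cderive_cgrad // !mxE.
rewrite (@cderive_near _ _ (fun y => tau y * cgrad f1 y 0 j)); first last.
- by apply: cdifferentiableM => //; exact: cgrad_cdifferentiable.
- by apply: filterS grad2 => y ->; rewrite [RHS]mxE.
rewrite cderiveM //; last exact: cgrad_cdifferentiable.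
by rewrite cderive_cgrad // !cgradE.
Qed.

Lemma ratio_antilinear v : cgrad f1 x != 0 -> pairing (cgrad f1 x) v = 0 ->
  T (iC *: v) = - (iC * T v).
Proof.
move=> w0; have S1 a b := cgrad_sym a b df1; have S2 a b := cgrad_sym a b df2.
have Wi : W (iC *: (iC *: v)) = - W v.
  by rewrite scalerA iCiC scaleN1r realifyN cgrad_deriveN.
exact: (antilinear_T (W := W) (W' := W') (tau := tau x) (T := T) S1 S2 derive_cgrad2 w0 Wi).
Qed.

(** The derivative of [tau] is antilinear on leaf directions and that of [g] is C-linear, so
    conjugation produces the Cauchy-Riemann equations along [g]. *)
Lemma ratio_conj_holomorphic m (g : 'rV[C]_m -> 'rV[C]_n) (z : 'rV[C]_m) :
  cgrad f1 x != 0 -> differentiable g z -> realify (g z) = x ->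
  (forall u, pairing (cgrad f1 x) ('d g z u) = 0) ->
  differentiable (fun y => conjc (tau (realify (g y))) : C) z.
Proof.
move=> w0 dg gz ker; have [tR tI] := dtau.
have [dG EG] := realify_is_diff dg.
pose G := @realify R n \o g \o @complexify R m.
have Gz : G (realify z) = x by rewrite /G /= realifyK.
have dIN : differentiable (fun y => - Im (tau y)) x by exact: differentiableN.
pose a : {linear 'rV[R]_(m + m) -> R} := 'd (fun y => Re (tau y)) x \o real_linear ('d g z).
pose b : {linear 'rV[R]_(m + m) -> R} := 'd (fun y => - Im (tau y)) x \o real_linear ('d g z).
have Da : is_diff (realify z) (fun y => Re (conjc (tau (realify (g (complexify y)))))) a.
  have -> : (fun y => Re (conjc (tau (realify (g (complexify y)))))) = (fun y => Re (tau y)) \o G.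
    by apply/funext => y /=; case: (tau _).
  have dt : differentiable (fun y => Re (tau y)) (G (realify z)) by rewrite Gz.
  split; first exact: differentiable_comp.
  by rewrite diff_comp // Gz /a EG.
have Db : is_diff (realify z) (fun y => Im (conjc (tau (realify (g (complexify y)))))) b.
  have -> : (fun y => Im (conjc (tau (realify (g (complexify y)))))) = (fun y => - Im (tau y)) \o G.
    by apply/funext => y /=; case: (tau _).
  have dt : differentiable (fun y => - Im (tau y)) (G (realify z)) by rewrite Gz.
  split; first exact: differentiable_comp.
  by rewrite diff_comp // Gz /b EG.
have RI (c : C) : Complex (Re c) (Im c) = c by case: c.
have key u : T (iC *: 'd g z u) = - (iC * T ('d g z u)) by exact: ratio_antilinear (ker u).
have TE (u : 'rV[C]_n) : T u = Complex ('d (fun y => Re (tau y)) x (realify u)) ('d (fun y => Im (tau y)) x (realify u)).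
  by rewrite /cderive !deriveE.
have aE u : a (realify u) = Re (T ('d g z u)).
  by rewrite TE /a /= /real_linear realifyK.
have bE u : b (realify u) = - Im (T ('d g z u)).
  have -> : b (realify u) = 'd (fun y => - Im (tau y)) x (realify ('d g z u)).
    by rewrite /b /= /real_linear realifyK.
  have EN : 'd (fun y => - Im (tau y)) x = - ('d (fun y => Im (tau y)) x : E -> R) :> (E -> R).
    exact: diffN tI.
  by rewrite TE; exact: (congr1 (fun h : E -> R => h (realify ('d g z u))) EN).
clearbody a b.
have Lg u : 'd g z (iC *: u) = iC *: 'd g z u by exact: linearZ.
have CR1 u : a (realify (iC *: u)) = - b (realify u).
  by rewrite aE bE Lg key ReN Re_iM.
have CR2 u : b (realify (iC *: u)) = a (realify u).
  by rewrite aE bE Lg key ImN Im_iM opprK.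
by have [] := is_diff_CR (f := fun y => conjc (tau (realify (g y)))) CR1 CR2 Da Db.
Qed.

(** By [transverse_part] the defect of C-linearity of the covector's derivative is proportional to
    the covector itself in every direction, so it disappears from quotients of coefficients. *)
Lemma ratio_holomorphic_frame k : Im (tau x) != 0 -> cgrad f1 x 0 k != 0 ->
  (forall v, pairing (cgrad f1 x) v = 0 -> T v = 0) ->
  forall j, differentiable
    (fun z : 'rV[C]_n => cgrad f1 (realify z) 0 j / cgrad f1 (realify z) 0 k : C)
    (complexify x).
Proof.
move=> tau0 wk T0 j.
pose lam y := cgrad f1 y 0 j / cgrad f1 y 0 k.
have dj := cgrad_cdifferentiable j df1; have dk := cgrad_cdifferentiable k df1.
have dlam : cdifferentiable lam x by apply: cdifferentiableM => //; exact: cdifferentiableV.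
have nz : \forall y \near x, cgrad f1 y 0 j = lam y * cgrad f1 y 0 k.
  by apply: filterS (cdifferentiable_neq0 dk wk) => y yk; rewrite /lam divfK.
have lamE u : cgrad ('D_u f1) x 0 j = lam x * cgrad ('D_u f1) x 0 k + cderive u lam x * cgrad f1 x 0 k.
  rewrite -(cderive_cgrad u j df1) -(cderive_cgrad u k df1) -(cderiveM u dlam dk).
  exact/esym/(cderive_near u nz dj).
have key u : cderive (realify (iC *: u)) lam x = iC * cderive (realify u) lam x.
  have [c] := @transverse_part _ _ W W' (cgrad f1 x) (tau x) T
    (fun a b => cgrad_sym a b df1) (fun a b => cgrad_sym a b df2) derive_cgrad2 k tau0 wk T0 u.
  move=> Ec; have Ec' i : cgrad ('D_(realify (iC *: u)) f1) x 0 i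
      - iC * cgrad ('D_(realify u) f1) x 0 i = c * cgrad f1 x 0 i.
    by have := congr1 (fun A : 'rV[C]_n => A 0 i) Ec; rewrite [LHS]mxE [X in _ + X]mxE [X in - X]mxE [RHS]mxE.
  exact: quotient_rule_factor wk (nbhs_singleton nz) (Ec' j) (Ec' k) (lamE _) (lamE _).
have [dR dI] := dlam.
have EE u : Complex ('d (fun y => Re (lam y)) x (realify u)) ('d (fun y => Im (lam y)) x (realify u))
   = cderive (realify u) lam x by rewrite /cderive !deriveE.
have CR1 u : 'd (fun y => Re (lam y)) x (realify (iC *: u)) = - 'd (fun y => Im (lam y)) x (realify u).
  by have := congr1 (@complex.Re _) (key u); rewrite -!EE Re_iM.
have CR2 u : 'd (fun y => Im (lam y)) x (realify (iC *: u)) = 'd (fun y => Re (lam y)) x (realify u).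
  by have := congr1 (@complex.Im _) (key u); rewrite -!EE Im_iM.
have Ex : realify (complexify x) = x by exact: complexifyK.
have D1 : is_diff (realify (complexify x))
    (fun y => Re (lam (realify (complexify y)))) ('d (fun y => Re (lam y)) x).
  under eq_fun do rewrite complexifyK; rewrite Ex; exact: differentiableP.
have D2 : is_diff (realify (complexify x))
    (fun y => Im (lam (realify (complexify y)))) ('d (fun y => Im (lam y)) x).
  under eq_fun do rewrite complexifyK; rewrite Ex; exact: differentiableP.
by have [] := is_diff_CR (f := fun z => lam (realify z)) CR1 CR2 D1 D2.
Qed.

End Ratio.
End Gradients.

(** * Transverse coordinates and leaves *)

Section Charts.
Variables (T E : topologicalType) (c : chart T E).

Lemma chart_inv_near p (P : T -> Prop) : chart_dom c p -> (\forall q \near p, P q) ->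
  \forall y \near c p,
    [/\ chart_dom c (chart_inv c y), c (chart_inv c y) = y & P (chart_inv c y)].
Proof.
move=> cp nP.
have im : (c @` chart_dom c) (c p) by exists p.
have N1 : \forall y \near c p, (c @` chart_dom c) y.
  by apply: open_nbhs_nbhs; split => //; exact: open_chart_im.
have N2 : \forall y \near c p, P (chart_inv c y).
  by apply: (chart_inv_continuous im); rewrite /= chart_mapK.
by apply: filterS2 N1 N2 => _ [q cq <-]; rewrite chart_mapK.
Qed.

Lemma chart_near p (Q : E -> Prop) : chart_dom c p -> (\forall y \near c p, Q y) ->
  \forall q \near p, chart_dom c q /\ Q (c q).
Proof.
move=> cp nQ.
have N1 : \forall q \near p, chart_dom c q.
  by apply: open_nbhs_nbhs; split => //; exact: open_chart_dom.
have N2 : \forall q \near p, Q (c q) by apply: (chart_map_continuous cp).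
by apply: filterS2 N1 N2.
Qed.

Lemma chart_dom_near p : chart_dom c p -> \forall q \near p, chart_dom c q.
Proof. by move=> cp; apply: open_nbhs_nbhs; split => //; exact: open_chart_dom. Qed.

End Charts.

Section TransverseCoordinates.
Variables (R : realType) (n : nat) (M : complex_manifold R n) (m k : nat).
Local Notation C := (Cplx R).
Local Notation E := ('rV[R]_m * 'rV[R]_k)%type.
Implicit Types (c : chart M 'rV[C]_n) (h : chart M E) (q : M).

Definition transverse c h (a : 'I_k) (x : 'rV[R]_(n + n)) : R :=
  (h (chart_inv c (complexify x))).2 0 a.

Definition conormal c h q : 'M[C]_(k, n) :=
  \matrix_(a, j) cgrad (transverse c h a) (realify (c q)) 0 j.

Lemma row_conormal c h q a : row a (conormal c h q) = cgrad (transverse c h a) (realify (c q)).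
Proof. by apply/rowP => j; rewrite 2![LHS]mxE. Qed.

Lemma realify_chart_near c q (P : M -> Prop) : chart_dom c q -> (\forall q' \near q, P q') ->
  \forall x \near realify (c q), exists q', [/\ chart_dom c q', realify (c q') = x & P q'].
Proof.
move=> cq nP.
have := chart_inv_near cq nP; rewrite -{1}(realifyK (c q)) => /near_complexify.
apply: filterS => x [dx cx Px]; exists (chart_inv c (complexify x)); split => //.
by rewrite cx complexifyK.
Qed.

Definition second_coord (a : 'I_k) (z : E) : R := z.2 0 a.

Lemma second_coord_is_linear a : linear (second_coord a).
Proof. by move=> t x y; rewrite /second_coord /= !mxE. Qed.

HB.instance Definition _ a := GRing.isLinear.Build R _ _ _ (second_coord a)
  (second_coord_is_linear a).

Lemma second_coord_continuous a : continuous (second_coord a).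
Proof.
move=> z; apply: (@continuous_comp _ _ _ snd (fun x : 'rV[R]_k => x 0 a)).
  exact: cvg_snd.
exact: coord_continuous.
Qed.

Lemma Re_pairing_real (y : 'rV[R]_k) (A : 'M[C]_(k, n)) v :
  Re (pairing (map_mx (real_complex R : R -> C) y *m A) v) =
  \sum_a y 0 a * Re (pairing (row a A) v).
Proof.
rewrite /pairing -mulmxA mxE.
have -> : Re (\sum_j (map_mx (real_complex R : R -> C) y) 0 j * (A *m v^T) j 0)
   = \sum_j y 0 j * Re ((A *m v^T) j 0).
  by elim/big_rec2: _ => // a u w _ <-; rewrite ReD mxE Re_mul /=; ring.
by apply: eq_bigr => a _; rewrite -row_mul [in RHS]mxE.
Qed.

Section OneChart.
Variables (c : chart M 'rV[C]_n) (h : chart M E).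
Hypotheses (ac : atlas c) (sh : smooth_chart h).

Let H := h \o chart_inv c \o @complexify R n.
Let U := (@realify R n \o c) @` (chart_dom c `&` chart_dom h).

Let smoothH : smooth_on U H.
Proof. by have [] := sh ac. Qed.

Let U_near q : chart_dom c q -> chart_dom h q -> \forall x \near realify (c q), U x.
Proof.
move=> cq hq; have := realify_chart_near cq (chart_dom_near hq).
by apply: filterS => x [q' [dq' <- hq']]; exists q'.
Qed.

Lemma differentiable_flat_coord q : chart_dom c q -> chart_dom h q ->
  differentiable H (realify (c q)).
Proof.
move=> cq hq; have /= [D _] := smoothH 1; apply: D; by exists q.
Qed.

Lemma transverse_differentiable a q : chart_dom c q -> chart_dom h q ->
  differentiable (transverse c h a) (realify (c q)).
Proof.
move=> cq hq; apply: (@differentiable_comp _ _ _ _ H (second_coord a)).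
  exact: differentiable_flat_coord.
exact/linear_differentiable/second_coord_continuous.
Qed.

Lemma derive_transverse a q v : chart_dom c q -> chart_dom h q ->
  'D_v (transverse c h a) (realify (c q)) = second_coord a ('d H (realify (c q)) v).
Proof.
move=> cq hq; have dH := differentiable_flat_coord cq hq.
have dl := linear_differentiable (H (realify (c q))) (@second_coord_continuous a).
rewrite (deriveE v (transverse_differentiable a cq hq)).
have -> : 'd (transverse c h a) (realify (c q)) = 'd (second_coord a \o H) (realify (c q)) :> (_ -> _).
  by [].
rewrite diff_comp //=; exact: (congr1 (fun l : E -> R => l _) (diff_lin _ (@second_coord_continuous a))).
Qed.

Lemma transverse_twice_differentiable a q : chart_dom c q -> chart_dom h q ->
  twice_differentiable (transverse c h a) (realify (c q)).
Proof.
move=> cq hq; split.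
  by apply: filterS (U_near cq hq) => x [q' [cq' hq'] <-]; exact: transverse_differentiable.
move=> v; have /= [_ /(_ v) [D2 _]] := smoothH 2.
apply: (@differentiable_near _ _ _ (second_coord a \o (fun x => 'D_v H x))).
  apply: filterS (U_near cq hq) => x [q' [cq' hq'] <-] /=.
  by rewrite derive_transverse // (deriveE v (differentiable_flat_coord cq' hq')).
apply: differentiable_comp; first by apply: D2; exists q.
exact/linear_differentiable/second_coord_continuous.
Qed.

(** The differential of h in the coordinates c has that of the inverse chart as right inverse. *)
Lemma transverse_submersion q (xi : 'rV[R]_k) : chart_dom c q -> chart_dom h q ->
  exists v, forall a, 'D_v (transverse c h a) (realify (c q)) = xi 0 a.
Proof.
move=> cq hq; pose G := @realify R n \o c \o chart_inv h.
have dG : differentiable G (h q).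
  have [_ sG] := sh ac; have /= [D _] := sG 1; by apply: D; exists q.
have Gq : G (h q) = realify (c q) by rewrite /G /= chart_mapK.
have dH : differentiable H (G (h q)) by rewrite Gq; exact: differentiable_flat_coord.
have HG : \forall y \near h q, y = (H \o G) y.
  have := chart_inv_near hq (chart_dom_near cq).
  by apply: filterS => y [hy hyE cy]; rewrite /H /G /= realifyK chart_mapK.
have did : is_diff (h q) (id : E -> E) (idfun : {linear E -> E}) by exact: is_diff_id.
have [_ E1] := is_diff_near HG did.
exists ('d G (h q) (0, xi)) => a.
rewrite derive_transverse // -Gq.
have -> : 'd H (G (h q)) ('d G (h q) (0, xi)) = 'd (H \o G) (h q) (0, xi) by rewrite diff_comp.
by rewrite E1.
Qed.

(** Independence of the rows over R only. Choosing a vector along which the transverse coordinates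
    have derivatives [y] turns the real part of the pairing into the sum of the squares of [y]. *)
Lemma conormal_free q (y : 'rV[R]_k) : chart_dom c q -> chart_dom h q ->
  map_mx (real_complex R : R -> C) y *m conormal c h q = 0 -> y = 0.
Proof.
move=> cq hq E0.
have [v Hv] := transverse_submersion y cq hq.
have : Re (pairing (map_mx (real_complex R : R -> C) y *m conormal c h q) (complexify v))
    = \sum_a y 0 a * y 0 a.
  rewrite Re_pairing_real; apply: eq_bigr => a _; rewrite row_conormal.
  by rewrite (cgradP _ (transverse_differentiable a cq hq)) complexifyK Hv.
rewrite E0 /pairing mul0mx mxE /= => /esym/eqP.
rewrite psumr_eq0; last by move=> a _; rewrite -expr2 sqr_ge0.
move=> /allP yy; apply/rowP => a; rewrite mxE.
by have /eqP/eqP := yy a (mem_index_enum _); rewrite -expr2 sqrf_eq0 => /eqP.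
Qed.

End OneChart.

(** A change of holomorphic chart multiplies all rows on the right by one and the same complex
    matrix, so linear relations between the rows do not depend on the chart. *)
Lemma conormal_change c c' h q : atlas c -> atlas c' -> smooth_chart h ->
  chart_dom c q -> chart_dom c' q -> chart_dom h q ->
  conormal c h q = conormal c' h q *m (lin1_mx ('d (c' \o chart_inv c) (c q)))^T.
Proof.
move=> ac ac' sh cq c'q hq.
set B := 'd (c' \o chart_inv c) (c q).
have dB : differentiable (c' \o chart_inv c) (c q).
  by apply: (atlas_holomorphic ac ac'); exists q.
apply/row_matrixP => a; rewrite row_mul !row_conormal.
apply: Re_pairing_inj => v.
have -> : pairing (cgrad (transverse c' h a) (realify (c' q)) *m (lin1_mx B)^T) v =
    pairing (cgrad (transverse c' h a) (realify (c' q))) (B v).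
  by rewrite /pairing -mulmxA -trmx_mul mul_rV_lin1.
have d' := transverse_differentiable ac' sh a c'q hq.
have d := transverse_differentiable ac sh a cq hq.
rewrite (cgradP v d) (cgradP _ d').
have [dG EG] := realify_is_diff dB.
set G := _ \o _ \o _ in dG EG.
have Gq : G (realify (c q)) = realify (c' q) by rewrite /G /= realifyK chart_mapK.
set f := transverse c' h a in d' *; set x := realify (c q) in dG EG Gq d *.
have d'' : differentiable f (G x) by move: d'; rewrite -Gq.
have N : \forall y \near x, (f \o G) y = transverse c h a y.
  have := realify_chart_near cq (chart_dom_near c'q).
  apply: filterS => _ [q' [cq' <- c'q']].
  by rewrite /f /transverse /G /= !realifyK !chart_mapK.
have E1 := derive_near (realify v) N (differentiable_comp dG d'').
have E2 := deriveE (realify v) (differentiable_comp dG d'').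
have E3 := congr1 (fun l : _ -> R => l (realify v)) (diff_comp dG d'').
have E4 : 'd G x (realify v) = realify (B v) by rewrite EG /real_linear realifyK.
have E5 : 'd f (G x) ('d G x (realify v)) = 'd f (realify (c' q)) (realify (B v)).
  by rewrite E4 Gq.
exact: etrans E1 (etrans E2 (etrans E3 (etrans E5 (esym (deriveE (realify (B v)) d'))))).
Qed.

End TransverseCoordinates.

(** * Continuous paths in countable sets *)

Section CountableImages.
Variable R : realType.

(** Otherwise the image would contain a nondegenerate interval, which has positive Lebesgue
    measure. *)
Lemma countable_path_cst (f : R -> R) (S : set R) : countable S ->
  {within `[0, 1], continuous f} -> (forall t, 0 <= t <= 1 -> S (f t)) -> f 0 = f 1.
Proof.
move=> cS cf fS; apply/eqP; apply: contrapT => /negP f01.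
pose a := Num.min (f 0) (f 1); pose b := Num.max (f 0) (f 1).
have ab : a < b.
  by rewrite /a /b lt_max !gt_min !ltxx /= orbF orbC -neq_lt.
have sub : `[a, b]%classic `<=` S.
  move=> v; rewrite /= in_itv /= => vab.
  have [t t01 <-] := IVT ler01 cf vab.
  by apply: fS; rewrite in_itv /= in t01.
have cI : countable (`[a, b]%classic : set R) by apply: sub_countable cS; exact: subset_card_le.
have := countable_lebesgue_measure0 cI.
rewrite lebesgue_measure_itv /= lte_fin ab -EFinB => /eqP.
by rewrite eqe subr_eq0 gt_eqF.
Qed.

Lemma real_line_continuous m (z w : 'rV[Cplx R]_m) :
  continuous (fun t : R => z + (t%:C%C : Cplx R) *: w).
Proof.
have E t : z + (t%:C%C : Cplx R) *: w = complexify (realify z + t *: realify w).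
  by rewrite complexifyD complexifyZ !realifyK.
move=> t; rewrite (funext E); apply: continuous_comp; last exact: complexify_continuous.
apply: differentiable_continuous.
by apply: differentiableD; [exact: differentiable_cst|exact: differentiableZl].
Qed.

End CountableImages.

(** * Leaves in flat charts and changes of flat charts *)

Section Leaves.
Variables (R : realType) (n d : nat) (M : complex_manifold R n) (F : complex_foliation M d).
Local Notation C := (Cplx R).
Local Notation k := ((n - d).*2).
Local Notation E := ('rV[R]_(d.*2) * 'rV[R]_k)%type.
Implicit Types (c : chart M 'rV[C]_n) (h : chart M E) (q : M).

Definition flat_chart h := [/\ smooth_chart h,
  exists a (r : R), 0 < r /\ h @` chart_dom h = ball a r &
  forall i, exists2 S : set 'rV[R]_k, countable S &
    forall q, chart_dom h q -> (range (@leaf_incl _ _ _ _ F i) q <-> S (h q).2)].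

(** The path is continuous for the topology of M, not of the leaf; the countability of the slices
    makes up for this. *)
Lemma path_in_leaf_cst h i (g : R -> M) : flat_chart h ->
  (forall t, 0 <= t <= 1 ->
    [/\ {for t, continuous g}, chart_dom h (g t) & range (@leaf_incl _ _ _ _ F i) (g t)]) ->
  (h (g 0)).2 = (h (g 1)).2.
Proof.
move=> [_ _ /(_ i)[S cS HS]] Hg; apply/rowP => a.
apply: (@countable_path_cst R (fun t => (h (g t)).2 0 a) [set s 0 a | s in S]).
- exact: sub_countable (card_image_le _ _) cS.
- apply: continuous_in_subspaceT => t; rewrite inE /= in_itv /= => /Hg[cg hg _].
  apply: (@continuous_comp _ _ _ g (fun q => (h q).2 0 a)) => //.
  apply: (@continuous_comp _ _ _ h (second_coord a)); first exact: chart_map_continuous.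
  exact: second_coord_continuous.
- by move=> t /Hg[_ hg ig]; exists (h (g t)).2 => //; apply/HS.
Qed.

Lemma leaf_map_locally_cst h i m (g : 'rV[C]_m -> M) z : flat_chart h -> chart_dom h (g z) ->
  (\forall y \near z, {for y, continuous g} /\ range (@leaf_incl _ _ _ _ F i) (g y)) ->
  \forall y \near z, chart_dom h (g y) /\ (h (g y)).2 = (h (g z)).2.
Proof.
move=> fh hz N.
have Nh : \forall y \near z, chart_dom h (g y).
  by have [cg _] := nbhs_singleton N; apply: cg; exact: chart_dom_near.
have /nbhs_ballP[e /= e0 H] : \forall y \near z, ({for y, continuous g} /\
    range (@leaf_incl _ _ _ _ F i) (g y)) /\ chart_dom h (g y) by exact: filterS2 N Nh.
apply/(nbhs_ballP z); exists e => //= y zy.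
split; first by have [] := H y zy.
pose l (t : R) := z + (t%:C%C : C) *: (y - z).
have inb t : 0 <= t <= 1 -> ball z e (l t).
  move=> /andP[t0 t1]; rewrite -ball_normE /= /l opprD addrA subrr sub0r normrN normrZ.
  move: zy; rewrite -ball_normE /= distrC; apply: le_lt_trans.
  by rewrite ler_piMl // ger0_norm ?ler0c // lecR.
have := @path_in_leaf_cst h i (g \o l) fh; rewrite /l /= scale0r scale1r addr0 subrKC => <- //.
move=> t /inb /H[[cg ig] hg]; split => //.
by apply: continuous_comp; [exact: real_line_continuous|exact: cg].
Qed.

Definition leafwise i m (g : 'rV[C]_m -> M) (z : 'rV[C]_m) :=
  \forall y \near z, holomorphic_at g y /\ range (@leaf_incl _ _ _ _ F i) (g y).

(** The transverse coordinates are locally constant along [g], which kills the real part; applied to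
    i u, the same argument kills the imaginary part. *)
Lemma conormal_tangent0 c h i m (g : 'rV[C]_m -> M) z a u : leafwise i g z ->
  atlas c -> flat_chart h -> chart_dom c (g z) -> chart_dom h (g z) ->
  pairing (row a (conormal c h (g z))) ('d (c \o g) z u) = 0.
Proof.
move=> lg ac fh cz hz; have [sh _ _] := fh.
have N1 : \forall y \near z, {for y, continuous g} /\ range (@leaf_incl _ _ _ _ F i) (g y).
  by apply: filterS lg => y [[]].
have N2 := leaf_map_locally_cst fh hz N1.
have [[cg dg] _] := nbhs_singleton lg.
have {}dg := dg c ac cz.
have N3 : \forall y \near z, chart_dom c (g y) by apply: cg; exact: chart_dom_near.
have df := transverse_differentiable ac sh a cz hz; rewrite row_conormal.
have E5 v : Re (pairing (cgrad (transverse c h a) (realify (c (g z)))) ('d (c \o g) z v)) = 0.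
  rewrite (cgradP _ df); apply: (derive_along_cst _ dg df).
  apply: filterS2 N2 N3 => y [hy Ey] cy.
  by rewrite /transverse /= !realifyK !chart_mapK // Ey.
apply: complexP; first exact: E5.
have L : 'd (c \o g) z ((Complex 0 1 : C) *: u) = (Complex 0 1 : C) *: 'd (c \o g) z u.
  exact: linearZ.
have := E5 ((Complex 0 1 : C) *: u); rewrite L pairingZr Re_iM => /eqP.
by rewrite oppr_eq0 => /eqP.
Qed.

Lemma leaf_incl_leafwise i (b : chart (leaf F i) 'rV[C]_d) x : atlas b -> chart_dom b x ->
  leafwise i (@leaf_incl _ _ _ _ F i \o chart_inv b) (b x).
Proof.
move=> ab bx; have [hol _] := leaf_immersion i (c := F).
have := chart_inv_near bx (chart_dom_near bx); apply: filterS => y [by_ <- _].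
split; first exact: hol.
by rewrite /= chart_mapK //; exists (chart_inv b y).
Qed.

Lemma leafwise_leaf_incl i m (f : 'rV[C]_m -> leaf F i) z :
  (forall y, holomorphic_at f y) -> leafwise i (@leaf_incl _ _ _ _ F i \o f) z.
Proof.
move=> hf; apply: filterE => {}z; split; last by exists (f z).
have [cf df] := hf z.
have [b ab bz] := atlas_cover (f z).
have [[cg dg] _] := nbhs_singleton (leaf_incl_leafwise ab bz).
have N : \forall y \near z, chart_dom b (f y) by apply: cf; exact: chart_dom_near.
have NE : \forall y \near z, leaf_incl i (f y) = (leaf_incl i \o chart_inv b) ((b \o f) y).
  by apply: filterS N => y fy; rewrite /= chart_mapK.
split.
  have cbf : {for z, continuous (b \o f)}.
    by apply: continuous_comp => //; exact: chart_map_continuous.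
  have cc : {for z, continuous ((leaf_incl i \o chart_inv b) \o (b \o f))}.
    exact: continuous_comp.
  move=> A; rewrite /= (nbhs_singleton NE) => /cc; apply: filterS2 NE => y NEy.
  by rewrite /= NEy.
move=> c ac cz.
apply: (@differentiable_near _ _ _ ((c \o (leaf_incl i \o chart_inv b)) \o (b \o f))).
  by apply: filterS NE => y /= ->.
apply: differentiable_comp; first exact: df.
by apply: dg => //=; rewrite chart_mapK.
Qed.

Lemma leafwise_comp i m l (f : 'rV[C]_l -> 'rV[C]_m) (g : 'rV[C]_m -> M) :
  (forall y, differentiable f y) -> (forall y, leafwise i g y) ->
  forall z, leafwise i (g \o f) z.
Proof.
move=> df lg z; apply: filterE => {}z.
have [[cg dg] ig] := nbhs_singleton (lg (f z)).
split => //; split.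
  by apply: continuous_comp; [exact: differentiable_continuous|exact: cg].
move=> c ac cz; rewrite compA; apply: differentiable_comp; first exact: df.
exact: dg.
Qed.

(* By countability of the slices, [h'.2] is locally a function [kappa] of [h.2];
   [K] is its Jacobian at [(h q0).2], hence the same for all [q] on the plaque. *)
Lemma flat_change h h' q0 : flat_chart h -> flat_chart h' ->
  chart_dom h q0 -> chart_dom h' q0 ->
  exists K : 'M[R]_k, \forall q \near q0, (h q).2 = (h q0).2 ->
    forall c, atlas c -> chart_dom c q ->
    conormal c h' q = map_mx (real_complex R : R -> C) K *m conormal c h q.
Proof.
move=> fh fh' h0 h'0; have [sh _ Hh] := fh; have [sh' _ _] := fh'.
set x0 := (h q0).1; set t0 := (h q0).2.
pose kappa a (t : 'rV[R]_k) : R := (h' (chart_inv h (x0, t))).2 0 a.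
have hq0 : h q0 = (x0, t0) by rewrite /x0 /t0; case: (h q0).
have dkappa a : differentiable (kappa a) t0.
  have [c ac c0] := atlas_cover q0.
  pose G := @realify R n \o c \o chart_inv h.
  have dG : differentiable G (x0, t0).
    have [_ sG] := sh c ac; have /= [D _] := sG 1; by rewrite -hq0; apply: D; exists q0.
  have Gq : G (x0, t0) = realify (c q0) by rewrite -hq0 /G /= chart_mapK.
  have dp : differentiable (pair x0 : 'rV[R]_k -> E) t0.
    by apply: differentiable_pair; [exact: differentiable_cst|exact: ex_diff].
  have N : \forall t \near t0, (transverse c h' a \o (G \o pair x0)) t = kappa a t.
    have cp := differentiable_continuous dp.
    have Nc := chart_inv_near h0 (chart_dom_near c0); rewrite {1}hq0 in Nc.
    have {}Nc : \forall t \near t0, chart_dom c (chart_inv h (x0, t)).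
      by apply: (cp (fun y => chart_dom c (chart_inv h y))); apply: filterS Nc => y [].
    by apply: filterS Nc => t ct; rewrite /transverse /G /= realifyK chart_mapK.
  apply: differentiable_near N _.
  apply: differentiable_comp; first exact: differentiable_comp.
  by rewrite /= Gq; exact: transverse_differentiable.
(* In the slice of q, the segment from h q to the point over [x0] stays in the leaf through q, so
   [h'.2] is constant along it. *)
have claim : \forall q \near q0, chart_dom h q /\ chart_dom h' q /\
    (forall a, (h' q).2 0 a = kappa a (h q).2).
  have := chart_inv_near h0 (chart_dom_near h'0); rewrite {1}hq0.
  move=> /nbhs_ballP[e /= e0 H].
  have B : \forall y \near h q0, ball (x0, t0) e y by rewrite hq0; exact: nbhsx_ballx.
  apply: filterS2 (chart_near h0 B) (chart_dom_near h'0) => q [hq Bq] h'q; split => //; split => // a.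
  have [i [x ix]] := @leaf_cover _ _ _ _ F q.
  have [S cS HS] := Hh i.
  have Sq : S (h q).2 by apply/HS => //; exists x.
  pose l (s : R) : E := (x0 + s *: ((h q).1 - x0), (h q).2).
  have inb s : 0 <= s <= 1 -> ball (x0, t0) e (l s).
    move=> /andP[s0 s1]; case: Bq => B1 B2; split => //=.
    move: B1; rewrite -!ball_normE /= opprD addrA subrr sub0r normrN normrZ distrC.
    by apply: le_lt_trans; rewrite ler_piMl // ger0_norm.
  have := @path_in_leaf_cst h' i (chart_inv h \o l) fh' _.
  rewrite /l /= scale0r scale1r addr0 subrKC -surjective_pairing chart_mapK //.
  rewrite /kappa => -> // s /inb Bs; have [hs Es h's] := H _ Bs; split => //.
    apply: continuous_comp.
      apply: differentiable_continuous; apply: differentiable_pair; last exact: differentiable_cst.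
      by apply: differentiableD; [exact: differentiable_cst|exact: differentiableZl].
    by apply: chart_inv_continuous; exists (chart_inv h (l s)).
  by apply/HS => //; rewrite Es.
exists (\matrix_(a, b) 'd (kappa a) t0 (delta_mx 0 b)).
(* Differentiating at a nearby q requires the identity [h'.2 = kappa h.2] on a whole neighbourhood
   of q. *)
apply: filterS (near_join claim) => q N qt c ac cq.
have [hq [h'q _]] := nbhs_singleton N.
apply/row_matrixP => a; rewrite row_mul.
apply: Re_pairing_inj => v.
rewrite -map_row Re_pairing_real row_conormal.
pose H := h \o chart_inv c \o @complexify R n.
set x := realify (c q).
have dH : differentiable H x by exact: differentiable_flat_coord.
have Hx : H x = h q by rewrite /H /x /= realifyK chart_mapK.
have Ht : (snd \o H) x = t0 by rewrite /= Hx.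
have dk : differentiable (kappa a) ((snd \o H) x) by rewrite Ht.
have csnd : continuous (snd : E -> 'rV[R]_k) by move=> y; exact: cvg_snd.
have dsnd : differentiable (snd : E -> 'rV[R]_k) (H x) by exact: linear_differentiable.
have dsH := differentiable_comp dH dsnd.
have NE : \forall y \near x, (kappa a \o (snd \o H)) y = transverse c h' a y.
  have := realify_chart_near cq N.
  apply: filterS => _ [q' [cq' <- [hq' [h'q' E']]]].
  by rewrite /transverse /H /= !realifyK !chart_mapK // E'.
have d' := transverse_differentiable ac sh' a cq h'q.
have E1 := derive_near (realify v) NE (differentiable_comp dsH dk).
have E2 := deriveE (realify v) (differentiable_comp dsH dk).
have E3 := congr1 (fun l : _ -> R => l (realify v)) (diff_comp dsH dk).
set w : 'rV[R]_k := 'd (snd \o H) x (realify v) in E3 *.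
have E4 : 'd (kappa a) ((snd \o H) x) w = 'd (kappa a) t0 w.
  exact: (congr1 (fun t : 'rV[R]_k => 'd (kappa a) t w) Ht).
have E5 : 'd (kappa a) t0 w = \sum_b w 0 b * 'd (kappa a) t0 (delta_mx 0 b).
  rewrite {1}(row_sum_delta w) linear_sum.
  by apply: eq_bigr => b _; rewrite linearZ.
have E6 b : w 0 b = 'D_(realify v) (transverse c h b) x.
  rewrite (derive_transverse ac sh b _ cq hq) /second_coord.
  have E7 := congr1 (fun l : _ -> 'rV[R]_k => l (realify v)) (diff_comp dH dsnd).
  have E8 := congr1 (fun l : E -> 'rV[R]_k => l ('d H x (realify v))) (diff_lin (H x) csnd).
  by rewrite (etrans E7 E8 : w = ('d H x (realify v)).2).
rewrite (cgradP v d') E1 (etrans E2 (etrans E3 (etrans E4 E5))).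
apply: eq_bigr => b _; rewrite E6 !mxE mulrC row_conormal.
by rewrite (cgradP v (transverse_differentiable ac sh b cq hq)).
Qed.

End Leaves.

(** * The identification of R x R with C^1 *)

Section Plane.
Variable R : realType.
Local Notation C := (Cplx R).

Definition plane_point (p : R * R) : 'rV[C]_1 := const_mx (Complex p.1 p.2).

Definition plane_coord (z : 'rV[C]_1) : R * R := (Re (z 0 0), Im (z 0 0)).

Lemma plane_coordK : cancel plane_coord plane_point.
Proof.
by move=> z; apply/rowP => j; rewrite mxE (ord1 j) /=; case: (z 0 0).
Qed.

Lemma plane_pointK : cancel plane_point plane_coord.
Proof. by case=> x y; rewrite /plane_coord mxE. Qed.

Lemma near_plane_point p (P : 'rV[C]_1 -> Prop) : (\forall z \near plane_point p, P z) ->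
  \forall q \near p, P (plane_point q).
Proof.
move=> /nbhs_ballP[e /= e0 H].
have eE : e = (Re e)%:C%C by apply/esym/RRe_real/gtr0_real.
have er : 0 < Re e / 2 by rewrite divr_gt0 // -ltcR -eE.
apply/nbhs_ballP; exists (Re e / 2) => // q [/= H1 H2]; apply: H.
rewrite -ball_normE /=; apply: (@le_lt_trans _ _ ((`|p.1 - q.1| + `|p.2 - q.2|)%:C%C : C)).
  apply: mx_norm_le => [|i j]; first by rewrite ler0c addr_ge0.
  by rewrite !mxE cabsE lecR; exact: cabs_le.
rewrite eE ltcR [ltRHS]splitr; exact: ltrD.
Qed.

Lemma near_plane_coord z (P : R * R -> Prop) : (\forall p \near plane_coord z, P p) ->
  \forall y \near z, P (plane_coord y).
Proof.
move=> /nbhs_ballP[e /= e0 H].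
apply/(nbhs_ballP z); exists (e%:C%C : C); first by rewrite /= ltcR.
move=> y; rewrite -ball_normE /= => zy; apply: H.
have : cabs (z 0 0 - y 0 0) < e.
  rewrite -ltcR -cabsE; apply: le_lt_trans zy.
  by have := mx_norm_ge_coord (z - y) 0 0; rewrite !mxE.
move: (cabs_ge_Re (z 0 0 - y 0 0)) (cabs_ge_Im (z 0 0 - y 0 0)).
rewrite ReD ReN ImD ImN => H1 H2 H3.
by split => /=; [exact: le_lt_trans H3|exact: le_lt_trans H3].
Qed.

End Plane.

(** * Parallel conormal frames along an entire curve in a leaf *)

Section GlobalFrame.
Variables (R : realType) (n d : nat) (M : complex_manifold R n) (F : complex_foliation M d).
Local Notation C := (Cplx R).
Local Notation k := ((n - d).*2).
Local Notation E := ('rV[R]_(d.*2) * 'rV[R]_k)%type.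
Local Notation toC := (map_mx (real_complex R : R -> C)).

Lemma conormal_freeM c (h : chart M E) q (K K' : 'M[R]_k) :
  atlas c -> smooth_chart h -> chart_dom c q -> chart_dom h q ->
  toC K *m conormal c h q = toC K' *m conormal c h q -> K = K'.
Proof.
move=> ac sh cq hq E0; apply/row_matrixP => a; apply/eqP; rewrite -subr_eq0; apply/eqP.
apply: (conormal_free ac sh cq hq).
by rewrite map_mxB mulmxBl !map_row -!row_mul E0 subrr.
Qed.

Lemma flat_change_unit (h h' : chart M E) q0 : flat_chart F h -> flat_chart F h' ->
  chart_dom h q0 -> chart_dom h' q0 ->
  exists2 K : 'M[R]_k, K \in unitmx & \forall q \near q0, (h q).2 = (h q0).2 ->
    forall c, atlas c -> chart_dom c q -> conormal c h' q = toC K *m conormal c h q.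
Proof.
move=> fh fh' h0 h'0; have [K HK] := flat_change fh fh' h0 h'0.
have [K' HK'] := flat_change fh' fh h'0 h0.
exists K => //; have [c ac c0] := atlas_cover q0.
have E1 := nbhs_singleton HK erefl c ac c0.
have E2 := nbhs_singleton HK' erefl c ac c0.
have /mulmx1_unit[] // : K *m K' = 1%:M.
have [sh' _ _] := fh'.
apply: (conormal_freeM ac sh' c0 h'0).
by rewrite map_mxM -mulmxA -E2 -E1 map_mx1 mul1mx.
Qed.

Section AlongCurve.
Variables (i : leaf_index F) (g : 'rV[C]_1 -> M).
Hypothesis lg : forall z, leafwise i g z.

Let g_near (z : 'rV[C]_1) : \forall y \near z, {for y, continuous g} /\ range (@leaf_incl _ _ _ _ F i) (g y).
Proof. by apply: filterS (lg z) => y [[]]. Qed.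

Let g_dom_near (h : chart M E) z : chart_dom h (g z) -> \forall y \near z, chart_dom h (g y).
Proof. by move=> hz; have [cg _] := nbhs_singleton (g_near z); apply: cg; exact: chart_dom_near. Qed.

(** The charts [cc z] are chosen point by point, without any continuity, so [s] need not be
    continuous either. This is harmless: the transition matrix [K] of [flat_change_unit] is the same
    in all holomorphic charts, and only relations between the rows of [s] are used later. *)
Lemma global_frame : exists cc : 'rV[C]_1 -> chart M 'rV[C]_n,
  (forall z, atlas (cc z) /\ chart_dom (cc z) (g z)) /\
  forall h0, flat_chart F h0 -> chart_dom h0 (g 0) ->
  exists s : 'rV[C]_1 -> 'M[C]_(k, n),
    (\forall z \near (0 : 'rV[C]_1), s z = conormal (cc z) h0 (g z)) /\
    forall z : 'rV[C]_1, exists h (K : 'M[R]_k), [/\ flat_chart F h, K \in unitmx &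
      \forall y \near z, chart_dom h (g y) /\ s y = toC K *m conormal (cc y) h (g y)].
Proof.
have /choice[cc ccP] : forall z, exists c, atlas c /\ chart_dom c (g z).
  by move=> z; have [c ac cz] := atlas_cover (g z); exists c.
exists cc; split=> // h0 fh0 h00.
pose frame (h : chart M E) p := conormal (cc (plane_point p)) h (g (plane_point p)).
(* A flat section is locally a constant invertible real matrix times the frame of one flat chart;
   the fibre consists of all such products at a point. *)
pose flat (s : R * R -> 'M[C]_(k, n)) (p : R * R) := exists h (K : 'M[R]_k),
  [/\ flat_chart F h, K \in unitmx, chart_dom h (g (plane_point p)) &
    \forall q \near p, s q = toC K *m frame h q].
pose fiber (p : R * R) (y : 'M[C]_(k, n)) := exists h (K : 'M[R]_k),
  [/\ flat_chart F h, K \in unitmx, chart_dom h (g (plane_point p)) & y = toC K *m frame h p].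
have change h h' p : flat_chart F h -> flat_chart F h' -> chart_dom h (g (plane_point p)) ->
    chart_dom h' (g (plane_point p)) -> exists2 K, K \in unitmx &
    \forall q \near p, chart_dom h (g (plane_point q)) /\ frame h' q = toC K *m frame h q.
  move=> fh fh' hp h'p; have [K uK HK] := flat_change_unit fh fh' hp h'p.
  exists K => //; apply: (near_plane_point (P := fun z => chart_dom h (g z) /\
    conormal (cc z) h' (g z) = toC K *m conormal (cc z) h (g z))).
  have [cg _] := nbhs_singleton (g_near (plane_point p)).
  have N := leaf_map_locally_cst fh hp (g_near (plane_point p)).
  apply: filterS2 N (cg _ HK) => z [hz Ez] /(_ Ez) H; split => //.
  by have [az cz] := ccP z; exact: H.
have germ s s' p : (\forall q \near p, s q = s' q) -> flat s p -> flat s' p.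
  move=> N [h [K [fh uK hp E0]]]; exists h, K; split => //.
  by apply: filterS2 N E0 => q ->.
have extend p : exists2 e, 0 < e & forall q y, ball p e q -> fiber q y ->
    exists s, s q = y /\ forall q', ball p e q' -> flat s q'.
  have [h [hp sh [a [r [r0 Er]]] Hh]] := flat_charts F (g (plane_point p)).
  have fh : flat_chart F h by split => //; exists a, r.
  have /nbhs_ballP[e /= e0 H] := near_plane_point (g_dom_near hp).
  exists e => // q y /H hq [h' [K' [fh' uK' h'q ->]]].
  have [K uK /nbhs_singleton[_ E0]] := change h h' q fh fh' hq h'q.
  exists (fun q => toC (K' *m K) *m frame h q); split.
    by rewrite E0 map_mxM mulmxA.
  move=> q' /H hq'; exists h, (K' *m K); split; [exact: fh| |exact: hq'|].
    by rewrite unitmx_mul uK'.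
  by apply: filterE => x; reflexivity.
have unique s s' p : flat s p -> flat s' p -> exists2 e, 0 < e & forall q q',
    ball p e q -> ball p e q' -> s q = s' q -> s q' = s' q'.
  move=> [h [K [fh uK hp E1]]] [h' [K' [fh' uK' h'p E2]]].
  have [K2 uK2 E3] := change h h' p fh fh' hp h'p.
  have /nbhs_ballP[e /= e0 H] : \forall q \near p, chart_dom h (g (plane_point q)) /\
      s q = toC K *m frame h q /\ s' q = toC (K' *m K2) *m frame h q.
    apply: filterS3 E1 E2 E3 => q -> -> [hq ->]; split => //; split => //.
    by rewrite map_mxM mulmxA.
  exists e => // q q' /H[hq [-> ->]] /H[_ [-> ->]] Eq.
  have [az cz] := ccP (plane_point q); have [sh _ _] := fh.
  (* Equality at the single point [q] already determines the real matrix, the rows being independent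
     over R. *)
  have EK : K = K' *m K2.
    exact: (@conormal_freeM (cc (plane_point q)) h (g (plane_point q))).
  exact: (congr1 (fun L : 'M[R]_k => toC L *m frame h q') EK).
have in_fiber s p : flat s p -> fiber p (s p).
  by move=> [h [K [fh uK hp /nbhs_singleton E0]]]; exists h, K.
have pt0 : plane_point (0, 0) = 0 :> 'rV[C]_1.
  by apply/rowP => j; rewrite !mxE.
have F0 : fiber (0, 0) (frame h0 (0, 0)).
  exists h0, 1%:M; split; [exact: fh0|exact: unitmx1|by rewrite pt0|].
  by rewrite map_mx1 mul1mx.
have [s s0 fs] := monodromy germ extend unique in_fiber F0.
exists (s \o @plane_coord R); split.
  have f0 : flat (frame h0) (0, 0).
    exists h0, 1%:M; split; [exact: fh0|exact: unitmx1|by rewrite pt0|].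
    by apply: filterE => q; rewrite map_mx1; exact: (esym (mul1mx _)).
  have [e e0 U] := unique _ _ _ (fs (0, 0)) f0.
  have : \forall q \near (plane_coord (0 : 'rV[C]_1)), s q = frame h0 q.
    rewrite -{1}pt0 plane_pointK; apply/nbhs_ballP; exists e => // q Bq.
    exact: (U (0, 0)) (ballxx _ e0) Bq s0.
  move=> /near_plane_coord; apply: filterS => z Ez.
  by apply: (etrans Ez); rewrite /frame plane_coordK; reflexivity.
move=> z; have [h [K [fh uK hz E0]]] := fs (plane_coord z).
rewrite plane_coordK in hz; exists h, K; split => //.
apply: filterS2 (g_dom_near hz) (near_plane_coord E0) => y hy Ey; split; first exact: hy.
by apply: (etrans Ey); rewrite /frame plane_coordK; reflexivity.
Qed.

End AlongCurve.
End GlobalFrame.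

(** * Codimension one *)

Section Codimension1.
Variables (R : realType) (n : nat) (hn : (1 < n)%N).
Variables (M : complex_manifold R n) (F : complex_foliation M n.-1).
Local Notation C := (Cplx R).
Local Notation k := ((n - n.-1).*2).
Local Notation E := ('rV[R]_(n.-1.*2) * 'rV[R]_k)%type.
Local Notation toC := (map_mx (real_complex R : R -> C)).

(** The number of rows is 2 only propositionally; two named indices avoid a transport of types. *)
Lemma two_rows : exists a0 a1 : 'I_k, a0 != a1 /\ forall a, a = a0 \/ a = a1.
Proof.
have k2 : k = 2%N by rewrite -subn1 subKn // ltnW.
move: k2; move: k => _ ->; exists ord0, (lift ord0 ord0); split => // -[[|[|m]] hm] //.
  by left; apply/val_inj.
by right; apply/val_inj.
Qed.

Lemma row_conormal_neq0 c (h : chart M E) q a : atlas c -> flat_chart F h ->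
  chart_dom c q -> chart_dom h q -> row a (conormal c h q) != 0.
Proof.
move=> ac [sh _ _] cq hq; apply/eqP => E0.
have : delta_mx 0 a = 0 :> 'rV[R]_k.
  apply: (conormal_free ac sh cq hq); rewrite -E0.
  by rewrite map_delta_mx -rowE.
by move=> /rowP/(_ a); rewrite !mxE !eqxx => /eqP; rewrite oner_eq0.
Qed.

(** The leaf directions lie in the kernel of a nonzero covector, and both spaces have dimension n -
    1 because the inclusion is an immersion. *)
Lemma tangent10E c (h : chart M E) q a : atlas c -> flat_chart F h ->
  chart_dom c q -> chart_dom h q ->
  tangent10 F c q = [set v | pairing (row a (conormal c h q)) v = 0].
Proof.
move=> ac fh cq hq; apply/seteqP; split => [v [i [x [b [w [xq ab bx ->]]]]]|v] /=.
  have gq : (leaf_incl i \o chart_inv b) (b x) = q by rewrite /= chart_mapK.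
  have := @conormal_tangent0 R n n.-1 M F c h i _ _ _ a w (leaf_incl_leafwise ab bx) ac fh.
  by rewrite gq; apply.
move=> wv.
have [i [x xq]] := leaf_cover F q.
have [b ab bx] := atlas_cover x.
set B := 'd (c \o leaf_incl i \o chart_inv b) (b x).
have injB : injective B.
  by have [_ H] := @leaf_immersion _ _ _ _ F i; apply: H => //; rewrite xq.
have kB u : pairing (row a (conormal c h q)) (B u) = 0.
  have gq : (leaf_incl i \o chart_inv b) (b x) = q by rewrite /= chart_mapK.
  have := @conormal_tangent0 R n n.-1 M F c h i _ _ _ a u (leaf_incl_leafwise ab bx) ac fh.
  by rewrite gq; apply.
set w := row a (conormal c h q) in wv kB.
have w0 : w != 0 by exact: row_conormal_neq0.
pose A := lin1_mx B.
have AE u : u *m A = B u by rewrite /A mul_rV_lin1.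
have fA : row_free A.
  by apply: inj_row_free => u; rewrite AE => Bu; apply: injB; rewrite Bu linear0.
have /submxP[u ->] : (v <= A)%MS.
  by rewrite (row_free_sub_ker _ fA w0) ?wv // => u; rewrite AE.
by exists i, x, b, u; split; [exact: xq|exact: ab|exact: bx|exact: AE].
Qed.

Section TwoRows.
Variables a0 a1 : 'I_k.
Hypothesis a01 : a0 != a1.
Hypothesis a_all : forall a : 'I_k, a = a0 \/ a = a1.

Lemma sum_two_rows (V : nmodType) (f : 'I_k -> V) : \sum_a f a = f a0 + f a1.
Proof.
rewrite (bigD1 a0) //= (bigD1 a1) /=; last by rewrite eq_sym.
rewrite big1 ?addr0 // => a /andP[/negP H1 /negP H2].
by have [E0|E0] := a_all a; [case: H1|case: H2]; apply/eqP.
Qed.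

(** The function tau of the overview, read off from the j-th coefficients; usable where the
    denominator is nonzero. *)
Definition ratio c (h : chart M E) (j : 'I_n) (x : 'rV[R]_(n + n)) : C :=
  cgrad (transverse c h a1) x 0 j / cgrad (transverse c h a0) x 0 j.

Section AtPoint.
Variables (c : chart M 'rV[C]_n) (h : chart M E) (q : M) (j : 'I_n).
Hypotheses (ac : atlas c) (fh : flat_chart F h) (cq : chart_dom c q) (hq : chart_dom h q).
Hypothesis qj : cgrad (transverse c h a0) (realify (c q)) 0 j != 0.

(** By [tangent10E] both rows have the same kernel, namely the tangent space of the leaf. *)
Lemma conormal_ratio : row a1 (conormal c h q) =
  ratio c h j (realify (c q)) *: row a0 (conormal c h q).
Proof.
have K v : pairing (row a0 (conormal c h q)) v = 0 -> pairing (row a1 (conormal c h q)) v = 0.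
  have := tangent10E a0 ac fh cq hq; rewrite (tangent10E a1 ac fh cq hq) => /seteqP[_ H] wv.
  exact: H.
rewrite !row_conormal in K *; move: qj; rewrite /ratio.
move: (cgrad (transverse c h a0) (realify (c q))) (cgrad (transverse c h a1) (realify (c q))) K.
move=> w w' K wj; apply/rowP => l; rewrite mxE.
(* These vectors lie in the kernel of [w], and their pairing with [w'] compares its l-th and j-th
   coefficients. *)
have := K (w 0 j *: delta_mx 0 l - w 0 l *: delta_mx 0 j).
rewrite -!scaleNr !pairingDr !pairingZr !pairing_delta.
rewrite [w 0 j * _]mulrC mulNr addrN => /(_ erefl)/eqP; rewrite mulNr subr_eq0 => /eqP E0.
by rewrite mulrAC [w' 0 j * _]mulrC -E0 mulrAC divff // mul1r.
Qed.

(** A real ratio would be a real relation between the rows, against [conormal_free]. *)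
Lemma ratio_nonreal : Im (ratio c h j (realify (c q))) != 0.
Proof.
have [sh _ _] := fh; apply/eqP => I0.
have := conormal_ratio; set t := ratio _ _ _ _ in I0 *.
have -> : t = (Re t)%:C%C by apply: complexP.
move=> E0.
have /rowP/(_ a1) : delta_mx 0 a1 - Re t *: delta_mx 0 a0 = 0 :> 'rV[R]_k.
  apply: (conormal_free ac sh cq hq).
  by rewrite map_mxB map_mxZ !map_delta_mx mulmxBl -scalemxAl -!rowE E0 subrr.
rewrite !mxE !eqxx [a1 == a0]eq_sym (negPf a01) /= mulr0 subr0 => /eqP.
by rewrite oner_eq0.
Qed.

Lemma transverse_grad_neq0_near : \forall q' \near q,
  cgrad (transverse c h a0) (realify (c q')) 0 j != 0.
Proof.
have [sh _ _] := fh.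
have N := cdifferentiable_neq0 (cgrad_cdifferentiable j (transverse_twice_differentiable ac sh a0 cq hq)) qj.
by apply: filterS (chart_near cq (near_realify N)) => q' [].
Qed.

Lemma ratio_cdifferentiable : cdifferentiable (ratio c h j) (realify (c q)).
Proof.
have [sh _ _] := fh.
apply: cdifferentiableM; first exact: cgrad_cdifferentiable (transverse_twice_differentiable ac sh a1 cq hq).
apply: cdifferentiableV => //.
exact: cgrad_cdifferentiable (transverse_twice_differentiable ac sh a0 cq hq).
Qed.

End AtPoint.

Lemma ratio_grad_near c h q j : atlas c -> flat_chart F h -> chart_dom c q -> chart_dom h q ->
  cgrad (transverse c h a0) (realify (c q)) 0 j != 0 ->
  \forall y \near realify (c q),
  cgrad (transverse c h a1) y = ratio c h j y *: cgrad (transverse c h a0) y.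
Proof.
move=> ac fh cq hq qj.
have N : \forall q' \near q, chart_dom h q' /\ cgrad (transverse c h a0) (realify (c q')) 0 j != 0.
  by apply: filterS2 (chart_dom_near hq) (transverse_grad_neq0_near ac fh cq hq qj).
apply: filterS (realify_chart_near cq N) => _ [q' [cq' <- [hq' q'j]]].
by rewrite -!row_conormal; exact: conormal_ratio.
Qed.

End TwoRows.
End Codimension1.

(** * Constancy of the ratio along complex lines *)

Section ConstantRatio.
Variables (R : realType) (n : nat) (hn : (1 < n)%N).
Variables (M : complex_manifold R n) (F : complex_foliation M n.-1).
Local Notation C := (Cplx R).
Local Notation k := ((n - n.-1).*2).
Local Notation E := ('rV[R]_(n.-1.*2) * 'rV[R]_k)%type.
Local Notation toC := (map_mx (real_complex R : R -> C)).
Variables a0 a1 : 'I_k.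
Hypothesis a01 : a0 != a1.
Hypothesis a_all : forall a : 'I_k, a = a0 \/ a = a1.
Local Notation ratio := (@ratio R n M a0 a1).

(* The rows of [K *m A], when [A] has rows [r] and [t *: r], are
   [mobius_row K a t *: r]. *)
Definition mobius_row (K : 'M[R]_k) a (t : C) : C := (K a a0)%:C%C + (K a a1)%:C%C * t.

Lemma mobius_row_conj K a t : conjc (mobius_row K a t) = mobius_row K a (conjc t).
Proof. by case: t => u v; apply: complexP; rewrite /mobius_row /=; ring. Qed.

Lemma row_eq0_unit (K : 'M[R]_k) (y : 'rV[R]_k) : K \in unitmx ->
  (forall b, (y *m K) 0 b = 0) -> y = 0.
Proof.
move=> uK H; rewrite -(mulmxK uK y).
have -> : y *m K = 0 by apply/rowP => b; rewrite H mxE.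
by rewrite mul0mx.
Qed.

Lemma real_combination_eq0 (x y : R) (t : C) : Im t != 0 ->
  (x%:C%C : C) + (y%:C%C : C) * t = 0 -> x = 0 /\ y = 0.
Proof.
case: t => u v /= v0 [E1 E2].
have {E2} y0 : y = 0.
  by move/eqP: E2; rewrite add0r mul0r addr0 mulf_eq0 (negPf v0) orbF => /eqP.
by move: E1; rewrite y0 !mul0r subr0 addr0.
Qed.

Lemma mobius_row_neq0 K t : K \in unitmx -> Im t != 0 -> mobius_row K a0 t != 0.
Proof.
move=> uK t0; apply/eqP => /(real_combination_eq0 t0)[E0 E1].
have /rowP/(_ a0) : delta_mx 0 a0 = 0 :> 'rV[R]_k.
  by apply: row_eq0_unit uK _ => b; rewrite -rowE mxE; have [->|->] := a_all b.
by rewrite !mxE !eqxx => /eqP; rewrite oner_eq0.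
Qed.

(** A real value s would make row a1 of [K] equal to s times row a0, since 1 and t are independent
    over R. *)
Lemma mobius_nonreal K t : K \in unitmx -> Im t != 0 ->
  Im (mobius_row K a1 t / mobius_row K a0 t) != 0.
Proof.
move=> uK t0; have D0 := mobius_row_neq0 uK t0.
apply/eqP => I0; set r := _ / _ in I0.
have rE : r = (Re r)%:C%C by apply: complexP.
have : mobius_row K a1 t - r * mobius_row K a0 t = 0 by rewrite /r divfK ?subrr.
rewrite rE; set s := Re r => E0.
have : ((K a1 a0 - s * K a0 a0)%:C%C : C) + ((K a1 a1 - s * K a0 a1)%:C%C : C) * t = 0.
  by rewrite -E0 /mobius_row !rmorphB !rmorphM /=; ring.
move=> /(real_combination_eq0 t0)[E1 E2].
have /rowP/(_ a1) : delta_mx 0 a1 - s *: delta_mx 0 a0 = 0 :> 'rV[R]_k.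
  apply: row_eq0_unit uK _ => b.
  rewrite mulmxBl -scalemxAl -!rowE !mxE.
  by have [->|->] := a_all b.
rewrite !mxE !eqxx [a1 == a0]eq_sym (negPf a01) /= mulr0 subr0 => /eqP.
by rewrite oner_eq0.
Qed.

(** The frame is written in [c'] but the ratio in [c]: by [conormal_change] the relation between the
    rows is the same in both. *)
Lemma frame_rows c c' (h : chart M E) q j (K : 'M[R]_k) : atlas c -> atlas c' ->
  flat_chart F h -> chart_dom c q -> chart_dom c' q -> chart_dom h q ->
  cgrad (transverse c h a0) (realify (c q)) 0 j != 0 ->
  exists2 r : 'rV[C]_n, r != 0 & forall a,
    row a (toC K *m conormal c' h q) = mobius_row K a (ratio c h j (realify (c q))) *: r.
Proof.
move=> ac ac' fh cq c'q hq qj; have [sh _ _] := fh.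
exists (row a0 (conormal c' h q)); first exact: row_conormal_neq0 fh _ _.
have E1 : row a1 (conormal c' h q) = ratio c h j (realify (c q)) *: row a0 (conormal c' h q).
  rewrite (conormal_change ac' ac sh c'q cq hq) !row_mul.
  by rewrite (conormal_ratio a1 ac fh cq hq qj) scalemxAl.
move=> a; rewrite row_mul mulmx_sum_row (sum_two_rows a01 a_all) E1 scalerA -scalerDl.
by rewrite !mxE.
Qed.

Lemma near_transverse_grad_neq0 m (g : 'rV[C]_m -> M) c (h : chart M E) z j :
  {for z, continuous g} -> atlas c -> flat_chart F h ->
  chart_dom c (g z) -> chart_dom h (g z) ->
  cgrad (transverse c h a0) (realify (c (g z))) 0 j != 0 ->
  \forall y \near z, [/\ chart_dom c (g y), chart_dom h (g y) &
    cgrad (transverse c h a0) (realify (c (g y))) 0 j != 0].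
Proof.
move=> cg ac fh cz hz zj.
have N : \forall q \near g z, [/\ chart_dom c q, chart_dom h q &
    cgrad (transverse c h a0) (realify (c q)) 0 j != 0].
  by apply: filterS3 (chart_dom_near cz) (chart_dom_near hz)
    (transverse_grad_neq0_near ac fh cz hz zj).
exact: (cg _ N).
Qed.

Section AlongLine.
Variables (i : leaf_index F) (g : 'rV[C]_1 -> M).
Hypothesis lg : forall z, leafwise i g z.

Let cg z : {for z, continuous g}.
Proof. by have [[]] := nbhs_singleton (lg z). Qed.

Lemma ratio_conj_differentiable c (h : chart M E) z j : atlas c -> flat_chart F h ->
  chart_dom c (g z) -> chart_dom h (g z) ->
  cgrad (transverse c h a0) (realify (c (g z))) 0 j != 0 ->
  differentiable (fun y => conjc (ratio c h j (realify (c (g y)))) : C) z.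
Proof.
move=> ac fh cz hz zj; have [sh _ _] := fh.
have [[_ dg] _] := nbhs_singleton (lg z).
apply: (@ratio_conj_holomorphic R n (transverse c h a0) (transverse c h a1) (ratio c h j)
  (realify (c (g z))) _ _ _ _ 1 (c \o g) z).
- exact: transverse_twice_differentiable.
- exact: transverse_twice_differentiable.
- exact: (ratio_cdifferentiable a1 ac fh cz hz zj).
- exact: (ratio_grad_near a1 ac fh cz hz zj).
- by apply: contraNneq zj => ->; rewrite mxE.
- exact: dg.
- by [].
- by move=> u; rewrite -row_conormal; exact: conormal_tangent0 (lg z) ac fh cz hz.
Qed.

Lemma ratio_line_cst c (h : chart M E) j : atlas c -> flat_chart F h ->
  chart_dom c (g 0) -> chart_dom h (g 0) ->
  cgrad (transverse c h a0) (realify (c (g 0))) 0 j != 0 ->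
  \forall z \near (0 : 'rV[C]_1),
    ratio c h j (realify (c (g z))) = ratio c h j (realify (c (g 0))).
Proof.
move=> ac fh c0 h0 j0.
have [cc [ccP /(_ h fh h0)[s [s0 sP]]]] := global_frame lg.
have local z : exists c1 h1 j1 (K : 'M[R]_k), [/\ atlas c1, flat_chart F h1, K \in unitmx,
   \forall y \near z, exists2 r : 'rV[C]_n, r != 0 & forall a,
     row a (s y) = mobius_row K a (ratio c1 h1 j1 (realify (c1 (g y)))) *: r &
   [/\ chart_dom c1 (g z), chart_dom h1 (g z) &
     cgrad (transverse c1 h1 a0) (realify (c1 (g z))) 0 j1 != 0]].
  have [h1 [K [fh1 uK N]]] := sP z; have [hz _] := nbhs_singleton N.
  have [ac1 c1z] := ccP z.
  have /rV0Pn[j1 zj] : row a0 (conormal (cc z) h1 (g z)) != 0.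
    exact: row_conormal_neq0 fh1 _ _.
  rewrite row_conormal in zj.
  exists (cc z), h1, j1, K; split => //.
  apply: filterS2 N (near_transverse_grad_neq0 (@cg _) ac1 fh1 c1z hz zj).
  move=> y [_ Es] [cy hy yj]; have [acy ccy] := ccP y.
  by rewrite Es; exact: frame_rows.
have nonreal c1 h1 j1 q : atlas c1 -> flat_chart F h1 -> chart_dom c1 q -> chart_dom h1 q ->
    cgrad (transverse c1 h1 a0) (realify (c1 q)) 0 j1 != 0 ->
    Im (ratio c1 h1 j1 (realify (c1 q))) != 0.
  by move=> ac1 fh1 c1q h1q qj; exact: (ratio_nonreal a01 ac1 fh1 c1q h1q qj).
(* [T] is the quotient of the two rows of the global frame, hence single-valued on the whole
   line. *)
have /choice[T TP] : forall z, exists t : C, [/\ row a1 (s z) = t *: row a0 (s z),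
    row a0 (s z) != 0 & Im t != 0].
  move=> z; have [c1 [h1 [j1 [K [ac1 fh1 uK N [c1z h1z zj]]]]]] := local z.
  have [r r0 Er] := nbhs_singleton N; have t0 := nonreal _ _ _ _ ac1 fh1 c1z h1z zj.
  exists (mobius_row K a1 (ratio c1 h1 j1 (realify (c1 (g z)))) /
          mobius_row K a0 (ratio c1 h1 j1 (realify (c1 (g z))))).
  have D0 := mobius_row_neq0 uK t0.
  split; last exact: mobius_nonreal.
    by rewrite !Er scalerA divfK.
  by rewrite Er scaler_eq0 negb_or D0 r0.
have TE z t : row a1 (s z) = t *: row a0 (s z) -> T z = t.
  have [ET r0 _] := TP z; rewrite ET => /eqP.
  by rewrite -subr_eq0 -scalerBl scaler_eq0 (negPf r0) orbF subr_eq0 => /eqP.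
(* Locally [T] is a Moebius transform of the ratio with constant coefficients; these being real, its
   conjugate is the same transform of the conjugate ratio, which is holomorphic. *)
have dT z : differentiable (fun y => conjc (T y) : C) z.
  have [c1 [h1 [j1 [K [ac1 fh1 uK N [c1z h1z zj]]]]]] := local z.
  pose sg y : C := conjc (ratio c1 h1 j1 (realify (c1 (g y)))).
  have dsg : differentiable sg z by exact: ratio_conj_differentiable.
  apply: (@differentiable_near _ _ _ (fun y => mobius_row K a1 (sg y) / mobius_row K a0 (sg y))).
    apply: filterS2 N (near_transverse_grad_neq0 (@cg _) ac1 fh1 c1z h1z zj) => y [r r0 Er] [cy hy yj].
    have ty := nonreal _ _ _ _ ac1 fh1 cy hy yj.
    have D0 := mobius_row_neq0 uK ty.
    have -> : T y = mobius_row K a1 (ratio c1 h1 j1 (realify (c1 (g y)))) /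
          mobius_row K a0 (ratio c1 h1 j1 (realify (c1 (g y)))).
      by apply: TE; rewrite !Er scalerA divfK.
    by rewrite /sg -!mobius_row_conj -conjc_inv -rmorphM.
  have dm a : differentiable (fun y => mobius_row K a (sg y)) z.
    by apply: differentiableD; [exact: differentiable_cst|apply: differentiableM; [exact: differentiable_cst|]].
  apply: differentiableM; first exact: dm.
  apply: differentiableV; first exact: dm.
  apply: mobius_row_neq0 => //.
  have := nonreal _ _ _ _ ac1 fh1 c1z h1z zj; rewrite /sg.
  by case: (ratio _ _ _ _) => u v /=; rewrite oppr_eq0.
have Tcst z : T z = T 0.
  pose G (w : C) : C := conjc (T (w *: const_mx 1)).
  have dG w : derivable G w 1.
    apply/derivable1_diffP.
    apply: (@differentiable_comp _ _ _ _ (fun w : C => w *: (const_mx 1 : 'rV[C]_1)) (fun y => conjc (T y) : C)).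
      exact: differentiableZl.
    exact: dT.
  have G0 w : Im (G w) != 0.
    rewrite /G; have [_ _] := TP (w *: const_mx 1).
    by case: (T _) => u v /=; rewrite oppr_eq0.
  have := entire_nonreal_cst dG G0 (z 0 0); rewrite /G scale0r => /(can_inj (@conjcK R)).
  by have -> : z 0 0 *: const_mx 1 = z by apply/rowP => l; rewrite !mxE (ord1 l) mulr1.
(* Near 0 the global frame is that of [h] itself, so the Moebius transform is the identity, the case
   [K = 1]. *)
have Tr : \forall z \near (0 : 'rV[C]_1), T z = ratio c h j (realify (c (g z))).
  apply: filterS2 s0 (near_transverse_grad_neq0 (@cg _) ac fh c0 h0 j0) => z sz [cz hz zj].
  apply: TE; have [acz ccz] := ccP z.
  have [r r0 Er] := frame_rows 1%:M ac acz fh cz ccz hz zj.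
  rewrite sz -[conormal _ _ _]mul1mx -(map_mx1 (real_complex R : {rmorphism R -> C})).
  rewrite !Er /mobius_row !mxE !eqxx [a1 == a0]eq_sym (negPf a01) /=.
  by rewrite rmorph1 rmorph0 mul0r addr0 add0r mul1r scale1r.
rewrite -(nbhs_singleton Tr).
by apply: filterS Tr => z <-; exact: Tcst.
Qed.

End AlongLine.
End ConstantRatio.

(** * From leafwise constancy to a holomorphic frame *)

Section HolomorphicFrame.
Variables (R : realType) (n : nat) (hn : (1 < n)%N).
Variables (M : complex_manifold R n) (F : complex_foliation M n.-1).
Local Notation C := (Cplx R).
Local Notation k := ((n - n.-1).*2).
Local Notation E := ('rV[R]_(n.-1.*2) * 'rV[R]_k)%type.

Lemma locally_cst_segment (f : R -> C) :
  (forall t : R, 0 <= t <= 1 -> \forall s \near t, f s = f t) -> f 1 = f 0.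
Proof.
move=> H.
have K (p : C -> R) : p (f 1) = p (f 0).
  have D (t : R) : 0 <= t <= 1 -> is_derive t 1 (p \o f) 0.
    move=> /H/nbhs_ballP[e /= e0 He]; apply: is_derive_of_eps => e1 e10.
    exists e => // h he; rewrite /= (He (h + t)); last first.
      by rewrite /ball /= opprD addrCA subrr addr0 normrN.
    by rewrite subrr mulr0 subr0 normr0 mulr_ge0 // ltW.
  have [||t _ E0] := @MVT_segment R (p \o f) (fun=> 0) 0 1 ler01.
  - by move=> t; rewrite in_itv /= => /andP[t0 t1]; apply: D; rewrite !ltW.
  - apply: derivable_within_continuous => t; rewrite in_itv /= => t01.
    by have [] := D t t01.
  by apply/eqP; rewrite -subr_eq0; apply/eqP; rewrite [LHS]E0 mul0r.
by apply: complexP; exact: K.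
Qed.

Section TwoRows.
Variables a0 a1 : 'I_k.
Hypothesis a01 : a0 != a1.
Hypothesis a_all : forall a : 'I_k, a = a0 \/ a = a1.
Local Notation ratio := (@ratio R n M a0 a1).

Variables (c : chart M 'rV[C]_n) (h : chart M E) (j : 'I_n).
Hypotheses (ac : atlas c) (fh : flat_chart F h).

(* It is not known a priori that the differential of the covering [f] is
   invertible; only its openness is used. *)
Lemma ratio_leaf_cst i (x : leaf F i) : parabolic (leaf F i) ->
  chart_dom c (leaf_incl i x) -> chart_dom h (leaf_incl i x) ->
  cgrad (transverse c h a0) (realify (c (leaf_incl i x))) 0 j != 0 ->
  \forall y \near x, ratio c h j (realify (c (leaf_incl i y))) =
    ratio c h j (realify (c (leaf_incl i x))).
Proof.
move=> [f [hol [cf rf loc]]] cx hx xj.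
have [w _ fw] : range f x by rewrite rf.
pose g := @leaf_incl _ _ _ _ F i \o f.
have lg z : leafwise i g z by exact: leafwise_leaf_incl.
have gw : g w = leaf_incl i x by rewrite /g /= fw.
rewrite -gw in cx hx xj *.
have cg : {for w, continuous g} by have [[]] := nbhs_singleton (lg w).
have /nbhs_ballP[e /= e0 He] := near_transverse_grad_neq0 cg ac fh cx hx xj.
(* The ball is joined to its centre by segments, and each segment lies in a complex line. *)
have on_ball z : ball w e z -> ratio c h j (realify (c (g z))) = ratio c h j (realify (c (g w))).
  move=> wz; pose l (t : R) : 'rV[C]_n.-1 := w + (t%:C%C : C) *: (z - w).
  have inb t : 0 <= t <= 1 -> ball w e (l t).
    move=> /andP[t0 t1]; rewrite -ball_normE /= /l opprD addrA subrr sub0r normrN normrZ.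
    move: wz; rewrite -ball_normE /= distrC; apply: le_lt_trans.
    by rewrite ler_piMl // ger0_norm ?ler0c // lecR.
  have := @locally_cst_segment (fun t => ratio c h j (realify (c (g (l t))))).
  have l0 : l 0 = w by rewrite /l /= scale0r addr0.
  have l1 : l 1 = z by rewrite /l /= scale1r subrKC.
  rewrite l0 l1; apply => t t01.
  (* The complex line is recentred at [l t], because [ratio_line_cst] gives constancy near the
     origin only. *)
  pose a (u : 'rV[C]_1) := l t + u 0 0 *: (z - w).
  have da u : differentiable a u.
    apply: differentiableD; first exact: differentiable_cst.
    by apply: differentiableZl; exact: differentiable_coord.
  have a0E : a 0 = l t by rewrite /a mxE scale0r addr0.
  have [ct ht tj] := He _ (inb t t01); rewrite -a0E in ct ht tj.
  pose P (u : 'rV[C]_1) := ratio c h j (realify (c (g (a u)))) = ratio c h j (realify (c (g (a 0)))).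
  have N : \forall u \near (0 : 'rV[C]_1), P u.
    exact: (ratio_line_cst a01 a_all (leafwise_comp da lg) ac fh ct ht tj).
  pose b (s : R) : 'rV[C]_1 := const_mx (- (t%:C%C : C)) + (s%:C%C : C) *: const_mx 1.
  have cb : {for t, continuous b} by exact: real_line_continuous.
  have b0 : b t = 0 by apply/rowP => u; rewrite !mxE mulr1 addNr.
  have {}N : \forall s \near t, P (b s).
    have N' : nbhs (b t) P by rewrite b0; exact: N.
    exact: (near_continuous cb N').
  have E0 s : a (b s) = l s.
    have B0 : (b s) 0 0 = - (t%:C%C : C) + s%:C%C by rewrite !mxE mulr1.
    have B1 : (t%:C%C : C) + (b s) 0 0 = s%:C%C by rewrite B0 addrA subrr add0r.
    rewrite /a /l -(addrA w) -(scalerDl (z - w) (t%:C%C : C)) B1; reflexivity.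
  by apply: filterS N => s; rewrite /P E0 a0E.
(* The continuous inverse on the sheet through [w] carries points of the leaf near [x] into the
   ball. *)
have [V [oV Vx [sheets [oS tS covS invS]]]] := loc x.
have [S shS Sw] : (\bigcup_(S in sheets) S) w by rewrite covS /= fw.
have [fS [f' [f'f cf']]] := invS S shS.
have Nw : \forall y \near x, ball w e (f' y).
  have f'x : f' x = w by rewrite -fw f'f.
  have Nf' : \forall z \near f' x, ball w e z by rewrite f'x; exact: nbhsx_ballx.
  exact: near_continuous (cf' x Vx) Nf'.
have NV : \forall y \near x, V y by exact: open_nbhs_nbhs.
apply: filterS2 Nw NV => y Bz Vy.
have [u Su uy] : (f @` S) y by rewrite fS.
have gu : g u = leaf_incl i y by rewrite /g /= uy.
rewrite -gu; apply: on_ball; by rewrite -uy f'f in Bz.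
Qed.

(** This is the vanishing of the derivative on leaf directions that [ratio_holomorphic_frame] asks
    for: such a vector is the image of a vector of the leaf, along which the ratio is locally
    constant. *)
Lemma cderive_ratio_tangent q v : (forall i, parabolic (leaf F i)) ->
  chart_dom c q -> chart_dom h q ->
  cgrad (transverse c h a0) (realify (c q)) 0 j != 0 ->
  pairing (cgrad (transverse c h a0) (realify (c q))) v = 0 ->
  cderive (realify v) (ratio c h j) (realify (c q)) = 0.
Proof.
move=> par cq hq qj; have := tangent10E a0 ac fh cq hq => /seteqP[_ H] wv.
have {H} /H : [set v | pairing (row a0 (conormal c h q)) v = 0] v by rewrite /= row_conormal.
move=> [i [x [b [u [xq ab bx ->]]]]].
have dc := ratio_cdifferentiable a1 ac fh cq hq qj.
rewrite -xq in cq hq qj dc *.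
have N := chart_inv_near bx (ratio_leaf_cst (par i) cq hq qj).
pose g := @leaf_incl _ _ _ _ F i \o chart_inv b.
have gx : g (b x) = leaf_incl i x by rewrite /g /= chart_mapK.
have dg : differentiable (c \o g) (b x).
  by have [[_ dg] _] := nbhs_singleton (leaf_incl_leafwise ab bx); apply: dg => //; rewrite -/g gx.
have [dR dI] := dc.
have cgx : (c \o g) (b x) = c (leaf_incl i x) by rewrite /= gx.
rewrite -cgx in dR dI N *.
rewrite /cderive; apply: complexP => /=.
  apply: (derive_along_cst u dg dR).
  by apply: filterS N => y [_ _ Ey]; rewrite -[RHS]/(Re _) -Ey.
apply: (derive_along_cst u dg dI).
by apply: filterS N => y [_ _ Ey]; rewrite -[RHS]/(Im _) -Ey.
Qed.

End TwoRows.

(** The rows e_l - lam_l e_j, for l different from j, form the standard basis of the kernel of the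
    covector with coefficients lam_l and j-th coefficient 1, seen as a graph over the other
    coordinates. *)
Definition graph_frame (j : 'I_n) (lam : 'I_n -> C) : 'M[C]_(n.-1, n) :=
  \matrix_r (delta_mx 0 (lift j r) - lam (lift j r) *: delta_mx 0 j).

Lemma graph_frameE j lam r l : graph_frame j lam r l =
  (delta_mx 0 (lift j r) : 'rV[C]_n) 0 l - lam (lift j r) * (delta_mx 0 j : 'rV[C]_n) 0 l.
Proof. by rewrite !mxE. Qed.

Lemma graph_frame_free j lam : row_free (graph_frame j lam).
Proof.
apply: inj_row_free => u u0; apply/rowP => r.
have /rowP/(_ (lift j r)) := u0; rewrite mulmx_sum_row summxE !mxE => <-.
rewrite (bigD1 r) //= big1 ?addr0 => [|r' r'r].
  by rewrite rowK !mxE !eqxx [lift j r == j]eq_sym (negPf (neq_lift j r)) /= mulr0 subr0 mulr1.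
rewrite rowK !mxE eqxx [lift j r == j]eq_sym (negPf (neq_lift j r)) /= mulr0 subr0.
by rewrite (inj_eq (@lift_inj _ j)) eq_sym (negPf r'r) mulr0.
Qed.

Lemma pairing_graph_frame (w : 'rV[C]_n) j u : w 0 j != 0 ->
  pairing w (u *m graph_frame j (fun l => w 0 l / w 0 j)) = 0.
Proof.
move=> wj; rewrite mulmx_sum_row.
elim/big_rec: _ => [|r v _ IH]; first by rewrite /pairing trmx0 mulmx0 mxE.
rewrite pairingDr IH addr0 pairingZr rowK pairingDr -scaleNr pairingZr !pairing_delta.
by rewrite mulNr divfK // subrr mulr0.
Qed.

Lemma parabolic_leaves_holomorphic : (forall i, parabolic (leaf F i)) ->
  holomorphic_foliation F.
Proof.
move=> par p.
have [a0 [a1 [a01 a_all]]] := two_rows hn.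
have [c ac cp] := atlas_cover p.
have [h [hp sh [a [r [r0 Er]]] Hh]] := flat_charts F p.
have fh : flat_chart F h by split => //; exists a, r.
have := row_conormal_neq0 a0 ac fh cp hp; rewrite row_conormal => /rV0Pn[j pj].
pose good q := [/\ chart_dom c q, chart_dom h q &
  cgrad (transverse c h a0) (realify (c q)) 0 j != 0].
have Ngood : \forall q \near p, good q.
  apply: filterS3 (chart_dom_near cp) (chart_dom_near hp)
    (transverse_grad_neq0_near ac fh cp hp pj) => q *; by split.
pose w z := cgrad (transverse c h a0) (realify z).
(* Dividing by the j-th coefficient removes the non-holomorphic factor of the covector; its
   normalized coefficients are holomorphic, and so is this basis of its kernel. *)
exists c, (interior good), (fun z => graph_frame j (fun l => w z 0 l / w z 0 j)).
have goodP q : interior good q -> good q by exact: interior_subset.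
split => //.
- by split; [exact: open_interior|exact: Ngood].
- by move=> q /goodP[].
- move=> _ [q /goodP[cq hq qj] <-]; apply: differentiable_rV => s l.
  have dl m : differentiable (fun z => w z 0 m / w z 0 j : C) (c q).
    rewrite -(realifyK (c q)).
    apply: (@ratio_holomorphic_frame R n (transverse c h a0) (transverse c h a1)
      (ratio a0 a1 c h j) (realify (c q))).
    + exact: transverse_twice_differentiable.
    + exact: transverse_twice_differentiable.
    + exact: (ratio_cdifferentiable a1 ac fh cq hq qj).
    + exact: (ratio_grad_near a1 ac fh cq hq qj).
    + exact: (ratio_nonreal a01 ac fh cq hq qj).
    + exact: qj.
    + by move=> v; exact: cderive_ratio_tangent.
  under eq_fun do rewrite graph_frameE.
  apply: differentiableB; first exact: differentiable_cst.
  by apply: differentiableM; [exact: dl|exact: differentiable_cst].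
- move=> q /goodP[cq hq qj]; split; first exact: graph_frame_free.
  rewrite (tangent10E a0 ac fh cq hq) row_conormal.
  have w0 : w (c q) != 0 by apply: contraNneq qj => E0; rewrite -/(w (c q)) E0 mxE.
  apply/seteqP; split => v /=.
    move=> wv; rewrite (row_free_sub_ker _ (graph_frame_free _ _) w0) ?wv // => u.
    exact: pairing_graph_frame.
  rewrite (row_free_sub_ker _ (graph_frame_free _ _) w0) => [/eqP //|u].
  exact: pairing_graph_frame.
Qed.

End HolomorphicFrame.

Theorem theorem3p1 (R : realType) (n : nat) (hn : (1 < n)%N)
  (M : complex_manifold R n) (F : complex_foliation M n.-1)
  (hF : forall i : leaf_index F, parabolic (leaf F i)) :
  holomorphic_foliation F.
Proof. exact: parabolic_leaves_holomorphic. Qed.
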